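(* Let $\Omega\subset\mathbb{H}$ be a circular slice domain and let $h,\tilde h\in\mathcal{R}(\Omega)$ be such that $\exp_*(h)\notin\mathcal{R}_{\mathbb{R}}(\Omega)$. If $h_v$ has a non-real isolated zero, then $\exp_*(h)=\exp_*(\tilde h)$ if and only if $\tilde h\equiv h$.
   Context: $\mathbb{H}$ is the algebra of quaternions; $q=q_0+q_v$ with $q_0$ real and $q_v$ purely imaginary, $q^c=q_0-q_v$, $\mathbb{S}=\{I\in\mathbb{H}: I^2=-1\}$, $\mathbb{C}_I=\mathbb{R}+\mathbb{R}I$, $\mathbb{S}_q=\{q_0+\|q_v\|J: J\in\mathbb{S}\}$, $\Omega_I=\Omega\cap\mathbb{C}_I$. A domain (nonempty connected open set) $\Omega\subset\mathbb{H}$ is circular if $\mathbb{S}_q\subset\Omega$ for all $q\in\Omega$; it is a slice domain if $\Omega\cap\mathbb{R}\neq\emptyset$. A function $f:\Omega\to\mathbb{H}$ is slice regular if $f(\alpha+I\beta)=F_0(\alpha+\sqrt{-1}\beta)+I F_1(\alpha+\sqrt{-1}\beta)$ for all $I\in\mathbb{S}$ and $\alpha,\beta\in\mathbb{R}$ with $\alpha+I\beta\in\Omega$, where $F_0,F_1:\{\alpha+\sqrt{-1}\beta:\alpha+I\beta\in\Omega\}\to\mathbb{H}$ are $C^1$, $F_0(\bar z)=F_0(z)$, $F_1(\bar z)=-F_1(z)$ and $\partial_\alpha F_0=\partial_\beta F_1$, $\partial_\beta F_0=-\partial_\alpha F_1$. $\mathcal{R}(\Omega)$ is the set of slice regular functions;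 $f\in\mathcal{R}(\Omega)$ is slice preserving if $f(\Omega_I)\subset\mathbb{C}_I$ for all $I\in\mathbb{S}$, and $\mathcal{R}_{\mathbb{R}}(\Omega)$ is the set of slice preserving functions. The $*$-product is $(f*g)(q)=0$ if $f(q)=0$, and $(f*g)(q)=f(q)\,g(f(q)^{-1}qf(q))$ otherwise; with pointwise sum it makes $\mathcal{R}(\Omega)$ an associative algebra. The slice conjugate $f^c$ is the function induced by $(F_0^c,F_1^c)$ (pointwise conjugates), and $f^s=f*f^c$. Every $f\in\mathcal{R}(\Omega)$ is uniquely $f=f_0+f_1i+f_2j+f_3k$ with $f_\ell\in\mathcal{R}_{\mathbb{R}}(\Omega)$; $f_0$ is its real part and $f_v=f-f_0$ its vector part. $\exp_*(f)=\sum_{n\ge0}f^{*n}/n!$, with $f^{*n}$ the $n$-th $*$-power. Non-real isolated zeroes: let $f\in\mathcal{R}(\Omega)$ with $f^s\not\equiv0$ and $q_0\in\Omega\setminus\mathbb{R}$. Write $f=\Delta^m\tilde f$ with $m\ge0$ the largest integer for which this is possible with $\tilde f\in\mathcal{R}(\Omega)$, where $\Delta(q)=q^2-2q\,\mathrm{Re}(q_0)+|q_0|^2$ (so $\tilde f\not\equiv0$ on $\mathbb{S}_{q_0}$). The point $q_0$ is a non-real isolated zero of $f$ if $\tilde f(q_0)=0$. If $f^s\equiv0$, $f$ has no non-real isolated zeroes. *)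

(* Defs.v *)
From Stdlib Require Export Reals Factorial.
From Coquelicot Require Export Coquelicot.

Open Scope R_scope.

(** * Quaternions *)

(** [(a, b, c, d)] stands for [a + b i + c j + d k].  Sum, opposite, real
    scaling and topology are those of Coquelicot on the product [R * R * R * R]
    (the product norm is the Euclidean one). *)
Definition quat : Type := (R * R * R * R)%type.

Definition mkq (a b c d : R) : quat := (a, b, c, d).
Definition q_re (q : quat) : R := fst (fst (fst q)).
Definition q_i (q : quat) : R := snd (fst (fst q)).
Definition q_j (q : quat) : R := snd (fst q).
Definition q_k (q : quat) : R := snd q.

Declare Scope quat_scope.
Delimit Scope quat_scope with quat.
Bind Scope quat_scope with quat.

Definition qreal (a : R) : quat := mkq a 0 0 0.
Definition qi : quat := mkq 0 1 0 0.
Definition qj : quat := mkq 0 0 1 0.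
Definition qk : quat := mkq 0 0 0 1.

Definition qadd (p q : quat) : quat := plus p q.
Definition qopp (q : quat) : quat := opp q.
Definition qsub (p q : quat) : quat := minus p q.
Definition qscal (a : R) (q : quat) : quat := scal a q.

Definition qmul (p q : quat) : quat :=
  mkq (q_re p * q_re q - q_i p * q_i q - q_j p * q_j q - q_k p * q_k q)
      (q_re p * q_i q + q_i p * q_re q + q_j p * q_k q - q_k p * q_j q)
      (q_re p * q_j q - q_i p * q_k q + q_j p * q_re q + q_k p * q_i q)
      (q_re p * q_k q + q_i p * q_j q - q_j p * q_i q + q_k p * q_re q).

Notation "p + q" := (qadd p q) : quat_scope.
Notation "- q" := (qopp q) : quat_scope.
Notation "p - q" := (qsub p q) : quat_scope.
Notation "p * q" := (qmul p q) : quat_scope.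

Fixpoint qpow (q : quat) (n : nat) : quat :=
  match n with
  | O => qreal 1
  | S n' => (q * qpow q n')%quat
  end.

Definition qconj (q : quat) : quat := mkq (q_re q) (- q_i q) (- q_j q) (- q_k q).

Definition qnorm (q : quat) : R :=
  sqrt (q_re q ^ 2 + q_i q ^ 2 + q_j q ^ 2 + q_k q ^ 2).

Definition qinv (q : quat) : quat := qscal (/ (qnorm q ^ 2)) (qconj q).

Definition qvec (q : quat) : quat := mkq 0 (q_i q) (q_j q) (q_k q).

Definition quat_eq_dec (p q : quat) : {p = q} + {p <> q}.
Proof. repeat decide equality; apply Req_EM_T. Defined.

Definition is_real (q : quat) : Prop := exists a : R, q = qreal a.

Definition imag_unit (J : quat) : Prop := (J * J)%quat = qreal (-1).

Definition slice_point (J : quat) (a b : R) : quat := (qreal a + J * qreal b)%quat.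

Definition in_slice (J q : quat) : Prop := exists a b : R, q = slice_point J a b.

Definition in_sphere (q p : quat) : Prop :=
  exists J : quat, imag_unit J /\ p = slice_point J (q_re q) (qnorm (qvec q)).

(** * Circular slice domains *)

Definition connected_set (A : quat -> Prop) : Prop :=
  forall U V : quat -> Prop,
    open U -> open V ->
    (forall q, A q -> U q \/ V q) ->
    (exists q, A q /\ U q) -> (exists q, A q /\ V q) ->
    exists q, A q /\ U q /\ V q.

Definition domain (Omega : quat -> Prop) : Prop :=
  (exists q, Omega q) /\ connected_set Omega /\ open Omega.

Definition circular (Omega : quat -> Prop) : Prop :=
  forall q, Omega q -> forall p, in_sphere q p -> Omega p.

Definition slice_domain (Omega : quat -> Prop) : Prop :=
  domain Omega /\ exists q, Omega q /\ is_real q.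

(** * Slice regular functions

    A function on [Omega] is a total function [quat -> quat] of which only the
    values on [Omega] matter. *)

(** The complex number [z = (alpha, beta)] plays the role of
    [alpha + sqrt(-1) beta].  When [Omega] is circular the choice of [J] is
    irrelevant. *)
Definition stem_domain (Omega : quat -> Prop) (z : C) : Prop :=
  exists J : quat, imag_unit J /\ Omega (slice_point J (Re z) (Im z)).

Definition is_dalpha (F : C -> quat) (z : C) (l : quat) : Prop :=
  is_derive (fun t : R => F (t, Im z)) (Re z) l.

Definition is_dbeta (F : C -> quat) (z : C) (l : quat) : Prop :=
  is_derive (fun t : R => F (Re z, t)) (Im z) l.

Definition C1_on (D : C -> Prop) (F : C -> quat) : Prop :=
  exists Fa Fb : C -> quat,
    forall z, D z ->
      is_dalpha F z (Fa z) /\ is_dbeta F z (Fb z) /\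
      continuous Fa z /\ continuous Fb z.

Definition holomorphic_stem (D : C -> Prop) (F0 F1 : C -> quat) : Prop :=
  C1_on D F0 /\ C1_on D F1 /\
  (forall z, D z -> F0 (Cconj z) = F0 z) /\
  (forall z, D z -> F1 (Cconj z) = (- F1 z)%quat) /\
  (forall z, D z -> exists l m : quat,
      is_dalpha F0 z l /\ is_dbeta F1 z l /\
      is_dbeta F0 z m /\ is_dalpha F1 z (- m)%quat).

Definition induced_by (Omega : quat -> Prop) (F0 F1 : C -> quat)
    (f : quat -> quat) : Prop :=
  forall (J : quat) (a b : R), imag_unit J -> Omega (slice_point J a b) ->
    f (slice_point J a b) = (F0 (a, b) + J * F1 (a, b))%quat.

Definition slice_regular (Omega : quat -> Prop) (f : quat -> quat) : Prop :=
  exists F0 F1 : C -> quat,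
    holomorphic_stem (stem_domain Omega) F0 F1 /\ induced_by Omega F0 F1 f.

Definition slice_preserving (Omega : quat -> Prop) (f : quat -> quat) : Prop :=
  slice_regular Omega f /\
  forall J, imag_unit J -> forall q, Omega q -> in_slice J q -> in_slice J (f q).

(** [f_v = f - f_0] in the decomposition [f = f_0 + f_1 i + f_2 j + f_3 k] with
    slice preserving [f_l]; such a decomposition is unique on [Omega]. *)
Definition vector_part (Omega : quat -> Prop) (f fv : quat -> quat) : Prop :=
  exists f0 f1 f2 f3 : quat -> quat,
    slice_preserving Omega f0 /\ slice_preserving Omega f1 /\
    slice_preserving Omega f2 /\ slice_preserving Omega f3 /\
    (forall q, Omega q ->
       f q = (f0 q + f1 q * qi + f2 q * qj + f3 q * qk)%quat) /\
    (forall q, Omega q -> fv q = (f q - f0 q)%quat).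

(** * The star product, slice conjugate and star exponential *)

Definition star (f g : quat -> quat) (q : quat) : quat :=
  if quat_eq_dec (f q) (qreal 0) then qreal 0
  else (f q * g (qinv (f q) * q * f q))%quat.

Fixpoint star_pow (f : quat -> quat) (n : nat) : quat -> quat :=
  match n with
  | O => fun _ => qreal 1
  | S n' => star f (star_pow f n')
  end.

Definition slice_conjugate (Omega : quat -> Prop) (f fc : quat -> quat) : Prop :=
  exists F0 F1 : C -> quat,
    holomorphic_stem (stem_domain Omega) F0 F1 /\ induced_by Omega F0 F1 f /\
    induced_by Omega (fun z => qconj (F0 z)) (fun z => qconj (F1 z)) fc.

(** [f^s = f * f^c] is not identically zero. *)
Definition symm_nonzero (Omega : quat -> Prop) (f : quat -> quat) : Prop :=
  exists fc, slice_conjugate Omega f fc /\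
    exists q, Omega q /\ star f fc q <> qreal 0.

(** The series is summed componentwise with Coquelicot's total [Series]; it
    converges at every point of a circular [Omega] when [f] is slice regular. *)
Definition star_exp (f : quat -> quat) (q : quat) : quat :=
  let term (n : nat) : quat := qscal (/ INR (fact n)) (star_pow f n q) in
  mkq (Series (fun n => q_re (term n))) (Series (fun n => q_i (term n)))
      (Series (fun n => q_j (term n))) (Series (fun n => q_k (term n))).

(** * Non-real isolated zeroes *)

Definition Delta (p q : quat) : quat :=
  (q * q - qreal 2 * q * qreal (q_re p) + qreal (qnorm p ^ 2))%quat.

Definition Delta_factor (Omega : quat -> Prop) (f : quat -> quat) (p : quat)
    (m : nat) (g : quat -> quat) : Prop :=
  slice_regular Omega g /\
  forall q, Omega q -> f q = (qpow (Delta p q) m * g q)%quat.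

Definition nonreal_isolated_zero (Omega : quat -> Prop) (f : quat -> quat)
    (p : quat) : Prop :=
  Omega p /\ ~ is_real p /\ symm_nonzero Omega f /\
  exists (m : nat) (g : quat -> quat),
    Delta_factor Omega f p m g /\
    (forall (m' : nat) (g' : quat -> quat),
        Delta_factor Omega f p m' g' -> (m' <= m)%nat) /\
    g p = qreal 0.

(* Main.v *)
Require Import Defs.
From Stdlib Require Import Lra Lia Classical.

(** Write a slice regular function through its stem, a holomorphic map
    [z |-> X z] with values in the complexified quaternions
    [C^4 = H (x) C] and [X (conj z) = conj (X z)].  The star product becomes the
    pointwise product of [H (x) C], so the star exponential is computed pointwise:
    with [x] the scalar part of [X], [V] its vector part, [n = V1^2 + V2^2 + V3^2]
    and [s] any complex square root of [n],
    [exp X = e^x (cos s + (sin s / s) V)].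

    Suppose that the star exponentials of two functions agree, and let [y], [U], [t]
    be the data of the second one.

    Comparing the quaternionic norms gives [e^(2x) = e^(2y)], so [x - y] takes its
    values in the discrete set [i pi Z]; stems are real on the real axis, where
    this forces [x = y], and connectedness of the domain extends the equality
    everywhere ([scalar_parts_eq]).

    Now [cos s = cos t] and [(sin s / s) V = (sin t / t) U], so after changing the
    sign of [t] we have [t = s + 2 pi k].  For [k = 0] and small [s] this gives
    [V = U].  For [k <> 0] it gives [t V = s U], hence [|V_l| <= |s| |U_l|] for
    small [s] ([sinc_compare]).  The isolated zero rules this out nearby: at the
    point [z0] of the sphere, [V = delta^m G] where [G] is not zero at [z0] (else
    another factor [delta] could be split off) but its quaternionic norm [N] is zero
    there (because the function induced by [G] vanishes at a point of the sphere).
    Since [|s|^2 = |delta|^(2m) |N|], the bound would give [|G_l|^2 <= |N| |U_l|^2]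
    off [z0], and the right side tends to zero while the left side does not, for a
    suitable coordinate [l].  So [V = U] near [z0], off [z0]
    ([vector_parts_eq_near]), and [V = U] everywhere by the identity principle.

    Two facts on holomorphic functions of class [C^1] are needed: the identity
    principle ([identity_principle]), and that a zero can be divided out with a
    holomorphic quotient ([hol_divide]), which is what makes the maximality of [m]
    usable.  Both come from Cauchy's formula on circles ([cauchy_formula]), proved by
    contracting the circle and differentiating under the integral sign. *)

(** * Continuity of complex-valued functions *)

(** [ring] and [field] recognise the numbers at the carriers [R] and [C], but not
    at the convertible carriers of their uniform structures. *)
Ltac as_type T := match goal with |- @eq _ ?a ?b => change (@eq T a b) end.

(** The same change of carrier for a point just about to be introduced. *)
Ltac overC := match goal with |- forall x, @?P x => change (forall x : C, P x); cbv beta end.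

Lemma C_ext (z w : C) : Re z = Re w -> Im z = Im w -> z = w.
Proof. destruct z, w; simpl; intros -> ->; reflexivity. Qed.

Section ContC.
Context {T : UniformSpace}.
Implicit Types f g : T -> C.

Lemma continuous_Re_part f x : continuous f x -> continuous (fun y => Re (f y)) x.
Proof.
  intros H. apply (continuous_comp f (fst : C -> R)); auto.
  destruct (f x) as [a b]. apply continuous_fst.
Qed.

Lemma continuous_Im_part f x : continuous f x -> continuous (fun y => Im (f y)) x.
Proof.
  intros H. apply (continuous_comp f (snd : C -> R)); auto.
  destruct (f x) as [a b]. apply continuous_snd.
Qed.

Lemma continuous_pair {U V : UniformSpace} (f : T -> U) (g : T -> V) x :
  continuous f x -> continuous g x -> continuous (fun y => (f y, g y)) x.
Proof.
  intros Hf Hg P [eps HP].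
  generalize (Hf _ (locally_ball (f x) eps)) (Hg _ (locally_ball (g x) eps)).
  intros H1 H2. 
  generalize (filter_and (fun y => ball (f x) eps (f y)) (fun y => ball (g x) eps (g y)) H1 H2).
  unfold filtermap. apply filter_imp. intros y [A B]. apply HP. split; assumption.
Qed.

Lemma continuous_of_parts f x :
  continuous (fun y => Re (f y)) x -> continuous (fun y => Im (f y)) x -> continuous f x.
Proof.
  intros H1 H2. apply continuous_ext with (fun y => (Re (f y), Im (f y))).
  - intros y; now destruct (f y).
  - apply (continuous_pair (U:=R_UniformSpace) (V:=R_UniformSpace)); assumption.
Qed.

Lemma continuous_Rplus (u v : T -> R) x :
  continuous u x -> continuous v x -> continuous (fun y => u y + v y) x.
Proof. apply (continuous_plus (V:=R_NormedModule)). Qed.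
Lemma continuous_Rminus (u v : T -> R) x :
  continuous u x -> continuous v x -> continuous (fun y => u y - v y) x.
Proof. apply (continuous_minus (V:=R_NormedModule)). Qed.
Lemma continuous_Ropp (u : T -> R) x :
  continuous u x -> continuous (fun y => - u y) x.
Proof. apply (continuous_opp (V:=R_NormedModule)). Qed.
Lemma continuous_Rmult (u v : T -> R) x :
  continuous u x -> continuous v x -> continuous (fun y => u y * v y) x.
Proof. apply (continuous_mult (K:=R_AbsRing)). Qed.
Lemma continuous_Rsqr (u : T -> R) x :
  continuous u x -> continuous (fun y => u y ^ 2) x.
Proof.
  intros H. apply (continuous_ext (fun y => u y * u y)); [intros y; as_type R; ring|].
  now apply continuous_Rmult.
Qed.
Lemma continuous_Rinv_comp (u : T -> R) x :
  continuous u x -> u x <> 0 -> continuous (fun y => / u y) x.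
Proof. intros H H0. apply (continuous_comp u Rinv); auto. now apply continuous_Rinv. Qed.

Lemma continuous_Cplus f g x :
  continuous f x -> continuous g x -> continuous (fun y => f y + g y)%C x.
Proof.
  intros Hf Hg; apply continuous_of_parts.
  - apply (continuous_Rplus (fun y => Re (f y)) (fun y => Re (g y))); now apply continuous_Re_part.
  - apply (continuous_Rplus (fun y => Im (f y)) (fun y => Im (g y))); now apply continuous_Im_part.
Qed.

Lemma continuous_Copp f x : continuous f x -> continuous (fun y => - f y)%C x.
Proof.
  intros Hf; apply continuous_of_parts.
  - apply (continuous_Ropp (fun y => Re (f y))); now apply continuous_Re_part.
  - apply (continuous_Ropp (fun y => Im (f y))); now apply continuous_Im_part.
Qed.

Lemma continuous_Cminus f g x :
  continuous f x -> continuous g x -> continuous (fun y => f y - g y)%C x.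
Proof. intros; apply continuous_Cplus; auto. now apply continuous_Copp. Qed.

Lemma continuous_Cmult f g x :
  continuous f x -> continuous g x -> continuous (fun y => f y * g y)%C x.
Proof.
  intros Hf Hg.
  assert (F0 := continuous_Re_part f x Hf). assert (F1 := continuous_Im_part f x Hf).
  assert (G0 := continuous_Re_part g x Hg). assert (G1 := continuous_Im_part g x Hg).
  apply continuous_of_parts.
  - exact (continuous_Rminus _ _ x (continuous_Rmult _ _ x F0 G0) (continuous_Rmult _ _ x F1 G1)).
  - exact (continuous_Rplus _ _ x (continuous_Rmult _ _ x F0 G1) (continuous_Rmult _ _ x F1 G0)).
Qed.

Lemma Csqnorm_neq0 (z : C) : z <> 0%C -> Re z ^ 2 + Im z ^ 2 <> 0.
Proof.
  intros Hz H. apply Hz. apply C_ext; simpl; nra.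
Qed.

Lemma continuous_Cinv f x :
  continuous f x -> f x <> 0%C -> continuous (fun y => / f y)%C x.
Proof.
  intros Hf Hx.
  assert (F0 := continuous_Re_part f x Hf). assert (F1 := continuous_Im_part f x Hf).
  assert (N : continuous (fun y => / (Re (f y) ^ 2 + Im (f y) ^ 2)) x).
  { apply (continuous_Rinv_comp (fun y => Re (f y) ^ 2 + Im (f y) ^ 2)).
    - exact (continuous_Rplus _ _ x (continuous_Rsqr _ x F0) (continuous_Rsqr _ x F1)).
    - now apply Csqnorm_neq0. }
  apply continuous_of_parts.
  - exact (continuous_Rmult _ _ x F0 N).
  - exact (continuous_Rmult _ _ x (continuous_Ropp _ x F1) N).
Qed.

Lemma continuous_Cpow f n x : continuous f x -> continuous (fun y => f y ^ n)%C x.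
Proof.
  intros Hf; induction n as [|n IH].
  - apply continuous_const.
  - apply continuous_ext with (fun y => f y * f y ^ n)%C; [reflexivity|].
    now apply continuous_Cmult.
Qed.

Lemma continuous_Cmod f x : continuous f x -> continuous (fun y => Cmod (f y)) x.
Proof.
  intros Hf. apply (continuous_comp (fun y => fst (f y) ^ 2 + snd (f y) ^ 2) sqrt).
  - exact (continuous_Rplus _ _ x (continuous_Rsqr _ x (continuous_Re_part f x Hf))
             (continuous_Rsqr _ x (continuous_Im_part f x Hf))).
  - apply (proj1 (continuity_pt_filterlim _ _)). apply continuity_pt_sqrt. 
    assert (0 <= fst (f x) ^ 2 /\ 0 <= snd (f x) ^ 2) by (split; apply pow2_ge_0). lra.
Qed.

Lemma locally_lt (u v : T -> R) x :
  continuous u x -> continuous v x -> u x < v x -> locally x (fun y => u y < v y).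
Proof.
  intros Hu Hv H.
  assert (C : continuous (fun y => v y - u y) x) by (now apply continuous_Rminus).
  apply filter_imp with (fun y => 0 < v y - u y); [intros; lra|].
  apply (C (fun r => 0 < r)). apply (open_gt 0). lra.
Qed.

Lemma locally_neq0 f x : continuous f x -> f x <> 0%C -> locally x (fun y => f y <> 0%C).
Proof.
  intros Hf H. apply filter_imp with (fun y => 0 < Cmod (f y)).
  - intros y Hy; now apply Cmod_gt_0.
  - apply (locally_lt (fun _ => 0) (fun y => Cmod (f y))).
    + apply continuous_const.
    + now apply continuous_Cmod.
    + now apply Cmod_gt_0.
Qed.
End ContC.

Definition disk (c : C) (r : R) (z : C) : Prop := Cmod (z - c) < r.

Lemma locally_disk (c : C) (P : C -> Prop) :
  locally c P <-> exists r, 0 < r /\ forall z, disk c r z -> P z.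
Proof.
  split.
  - intros [e He]. exists e. split; [apply cond_pos|]. intros z Hz. apply He.
    apply C_NormedModule_mixin_compat1. exact Hz.
  - intros [r [Hr H]].
    apply filter_imp with (fun z => Cmod (z - c) < r); [exact H|].
    apply (locally_lt (fun z : C => Cmod (z - c)) (fun _ => r)).
    + apply (continuous_Cmod (fun z : C => z - c)%C). apply continuous_Cminus.
      apply continuous_id. apply continuous_const.
    + apply continuous_const.
    + replace (c - c)%C with (0 : C) by ring. now rewrite Cmod_0.
Qed.

Lemma disk_open c r z : disk c r z -> locally z (disk c r).
Proof.
  intros H. apply (locally_lt (fun z : C => Cmod (z - c)) (fun _ => r)); auto.
  - apply (continuous_Cmod (fun z : C => z - c)%C). apply continuous_Cminus.
    apply continuous_id. apply continuous_const.
  - apply continuous_const.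
Qed.

Lemma locally_other (z : C) (P : C -> Prop) : locally z P -> exists w, w <> z /\ P w.
Proof.
  intros H. apply locally_disk in H as [r [Hr H]].
  exists (z + RtoC (r / 2))%C. split.
  - intros E. apply (f_equal Re) in E. destruct z as [a b]. simpl in E. lra.
  - apply H. unfold disk. replace (z + RtoC (r/2) - z)%C with (RtoC (r / 2)) by ring.
    rewrite Cmod_R, Rabs_pos_eq; lra.
Qed.

(** Points other than [z] exist arbitrarily near [z], so a nonzero limit of the
    difference would be contradicted at one of them. *)
Lemma continuous_punctured_eq (f g : C -> C) z :
  continuous f z -> continuous g z -> locally z (fun w => w <> z -> f w = g w) -> f z = g z.
Proof.
  intros Hf Hg H. apply NNPP; intros N.
  assert (Hd : continuous (fun w => f w - g w)%C z) by (now apply continuous_Cminus).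
  destruct (locally_other z _ (filter_and _ _ (locally_neq0 _ _ Hd (Cminus_eq_contra _ _ N)) H))
    as [w [Hw [N' E]]].
  apply N'. rewrite E by exact Hw. ring.
Qed.

(** * Complex derivatives *)

(** Caratheodory's form of the complex derivative.  It reduces the rules of
    calculus, the chain rule along real paths included, to the continuity of the slope
    function. *)
Definition cderiv (f : C -> C) (z l : C) : Prop :=
  exists phi : C -> C,
    continuous phi z /\ phi z = l /\ forall w, f w = (f z + phi w * (w - z))%C.

Lemma cderiv_const (a z : C) : cderiv (fun _ => a) z 0.
Proof. exists (fun _ => 0%C). repeat split. apply continuous_const. intros; ring. Qed.

Lemma cderiv_id (z : C) : cderiv (fun w => w) z 1.
Proof. exists (fun _ => 1%C). repeat split. apply continuous_const. intros; ring. Qed.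

Lemma cderiv_continuous f z l : cderiv f z l -> continuous f z.
Proof.
  intros [phi [Hp [_ H]]].
  apply continuous_ext with (fun w => f z + phi w * (w - z))%C; [now intros; rewrite <- H|].
  apply continuous_Cplus; [apply continuous_const|]. apply continuous_Cmult; auto.
  apply continuous_Cminus; [apply continuous_id | apply continuous_const].
Qed.

Lemma cderiv_plus f g z l m :
  cderiv f z l -> cderiv g z m -> cderiv (fun w => f w + g w)%C z (l + m)%C.
Proof.
  intros [p [Hp [El H]]] [q [Hq [Em K]]].
  exists (fun w => p w + q w)%C. repeat split.
  - now apply continuous_Cplus.
  - now rewrite El, Em.
  - intros w. rewrite H, K. ring.
Qed.

Lemma cderiv_mult f g z l m :
  cderiv f z l -> cderiv g z m -> cderiv (fun w => f w * g w)%C z (l * g z + f z * m)%C.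
Proof.
  intros [p [Hp [El H]]] Hg. assert (Cg := cderiv_continuous _ _ _ Hg).
  destruct Hg as [q [Hq [Em K]]].
  exists (fun w => p w * g w + f z * q w)%C. repeat split.
  - apply continuous_Cplus; apply continuous_Cmult; auto. apply continuous_const.
  - now rewrite El, Em.
  - intros w. rewrite (H w), (K w). ring.
Qed.

Lemma cderiv_opp f z l : cderiv f z l -> cderiv (fun w => - f w)%C z (- l)%C.
Proof.
  intros [p [Hp [El H]]]. exists (fun w => - p w)%C. repeat split.
  - now apply continuous_Copp.
  - now rewrite El.
  - intros w. rewrite (H w). ring.
Qed.

(** The slope of [g] is recomputed as a quotient off [z]; near [z] it is the slope
    of [f]. *)
Lemma cderiv_ext_loc f g z l :
  locally z (fun w => f w = g w) -> cderiv f z l -> cderiv g z l.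
Proof.
  intros E [p [Hp [El H]]].
  exists (fun w => if Ceq_dec w z then l else (g w - g z) / (w - z))%C.
  assert (Ez : f z = g z) by exact (locally_singleton _ _ E).
  repeat split.
  - apply continuous_ext_loc with p; auto. revert E. apply filter_imp. overC. intros w Ew.
    destruct (Ceq_dec w z) as [->|N]; auto.
    rewrite <- Ew, <- Ez, (H w). as_type C. field. now apply Cminus_eq_contra.
  - destruct (Ceq_dec z z); tauto.
  - intros w. destruct (Ceq_dec w z) as [->|N]; [ring|]. field. now apply Cminus_eq_contra.
Qed.

(** The slope [- p w / (f w * f z)] only makes sense where [f w] is not zero, that
    is near [z], whence the use of locality. *)
Lemma cderiv_inv f z l : cderiv f z l -> f z <> 0%C ->
  cderiv (fun w => / f w)%C z (- l / (f z * f z))%C.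
Proof.
  intros Hf N. assert (Cf := cderiv_continuous _ _ _ Hf).
  destruct Hf as [p [Hp [El H]]].
  apply cderiv_ext_loc with
    (fun w => / f z + (- p w / (f w * f z)) * (w - z))%C.
  - generalize (locally_neq0 _ _ Cf N). apply filter_imp. intros w Nw.
    assert (E : (p w * (w - z) = f w - f z)%C) by (rewrite (H w); ring).
    replace (- p w / (f w * f z) * (w - z))%C with (- (p w * (w - z)) / (f w * f z))%C
      by (field; auto).
    rewrite E. field; auto.
  - exists (fun w => - p w / (f w * f z))%C. repeat split.
    + apply continuous_Cmult. now apply continuous_Copp. apply continuous_Cinv.
      apply continuous_Cmult; auto. apply continuous_const. now apply Cmult_neq_0.
    + now rewrite El.
    + intros w. ring.
Qed.

Definition rderiv (g : R -> C) (t : R) (l : C) : Prop :=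
  is_derive (fun u => Re (g u)) t (Re l) /\ is_derive (fun u => Im (g u)) t (Im l).

Lemma is_derive_slope (psi : R -> R) t a :
  continuous psi t -> is_derive (fun u => a + psi u * (u - t)) t (psi t).
Proof.
  intros H. apply is_derive_Reals. intros eps He.
  apply (proj2 (continuity_pt_filterlim _ _)) in H. destruct (H eps He) as [d [Hd K]].
  exists (mkposreal d Hd). intros h Hh Hb. simpl in Hb.
  replace ((a + psi (t + h) * (t + h - t) - (a + psi t * (t - t))) / h - psi t)
    with (psi (t + h) - psi t) by (field; auto).
  apply (K (t + h)). split.
  - split; [constructor|]. lra.
  - simpl. unfold R_dist. now replace (t + h - t) with h by ring.
Qed.

Lemma is_derive_slope_inv (f : R -> R) t l : is_derive f t l ->
  exists psi, continuous psi t /\ psi t = l /\ forall u, f u = f t + psi u * (u - t).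
Proof.
  intros H. apply is_derive_Reals in H.
  exists (fun u => if Req_EM_T u t then l else (f u - f t) / (u - t)).
  repeat split.
  - apply (proj1 (continuity_pt_filterlim _ _)). intros eps He.
    destruct (H eps He) as [d K]. exists d. split; [apply cond_pos|].
    intros u [[_ N] Hu]. simpl in *. unfold R_dist in *.
    destruct (Req_EM_T t t) as [_|]; [|tauto].
    destruct (Req_EM_T u t) as [->|Nu]; [tauto|].
    replace (f u) with (f (t + (u - t))) by (f_equal; ring).
    apply K; auto. lra.
  - destruct (Req_EM_T t t); tauto.
  - intros u. destruct (Req_EM_T u t) as [->|Nu]; [ring|]. field. lra.
Qed.

(** [f (g u) - f (g t)] is [(p o g) (u) * (g u - g t)] with [p] the slope of [f],
    and each real coordinate of [g u - g t] is [u - t] times a continuous slope. *)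
Lemma rderiv_comp (f : C -> C) (g : R -> C) t l m :
  cderiv f (g t) l -> rderiv g t m -> rderiv (fun u => f (g u)) t (l * m)%C.
Proof.
  intros [p [Hp [El H]]] [G1 G2].
  assert (Cg : continuous g t).
  { apply continuous_of_parts.
    - apply (ex_derive_continuous (K:=R_AbsRing) (V:=R_NormedModule) (fun u => Re (g u))).
      eexists; exact G1.
    - apply (ex_derive_continuous (K:=R_AbsRing) (V:=R_NormedModule) (fun u => Im (g u))).
      eexists; exact G2. }
  assert (Cp : continuous (fun u => p (g u)) t) by (now apply continuous_comp).
  assert (P0 := continuous_Re_part _ t Cp). assert (P1 := continuous_Im_part _ t Cp).
  destruct (is_derive_slope_inv _ _ _ G1) as [q1 [Q1 [E1 K1]]].
  destruct (is_derive_slope_inv _ _ _ G2) as [q2 [Q2 [E2 K2]]].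
  split.
  - apply is_derive_ext with (fun u => Re (f (g t)) +
       (Re (p (g u)) * q1 u - Im (p (g u)) * q2 u) * (u - t)).
    + intros u. rewrite (H (g u)). generalize (K1 u) (K2 u). unfold Re, Im; simpl. intros -> ->. ring.
    + replace (Re (l * m)) with (Re (p (g t)) * q1 t - Im (p (g t)) * q2 t)
        by (rewrite El, E1, E2; reflexivity).
      apply (is_derive_slope (fun u => Re (p (g u)) * q1 u - Im (p (g u)) * q2 u)).
      exact (continuous_Rminus _ _ t (continuous_Rmult _ _ t P0 Q1) (continuous_Rmult _ _ t P1 Q2)).
  - apply is_derive_ext with (fun u => Im (f (g t)) +
       (Re (p (g u)) * q2 u + Im (p (g u)) * q1 u) * (u - t)).
    + intros u. rewrite (H (g u)). generalize (K1 u) (K2 u). unfold Re, Im; simpl. intros -> ->. ring.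
    + replace (Im (l * m)) with (Re (p (g t)) * q2 t + Im (p (g t)) * q1 t)
        by (rewrite El, E1, E2; reflexivity).
      apply (is_derive_slope (fun u => Re (p (g u)) * q2 u + Im (p (g u)) * q1 u)).
      exact (continuous_Rplus _ _ t (continuous_Rmult _ _ t P0 Q2) (continuous_Rmult _ _ t P1 Q1)).
Qed.

(** A total function returning the derivative wherever one exists, read off along
    the horizontal direction. *)
Definition Cder (f : C -> C) (z : C) : C :=
  (Derive (fun t => Re (f (t, Im z))) (Re z), Derive (fun t => Im (f (t, Im z))) (Re z)).

Lemma rderiv_horizontal (z : C) : rderiv (fun t => (t, Im z) : C) (Re z) 1.
Proof. split; simpl; [apply (is_derive_id (Re z)) | apply (is_derive_const (Im z))]. Qed.

Lemma rderiv_vertical (z : C) : rderiv (fun t => (Re z, t) : C) (Im z) Ci.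
Proof. split; simpl; [apply (is_derive_const (Re z)) | apply (is_derive_id (Im z))]. Qed.

Lemma C_eta (z : C) : (Re z, Im z) = z.
Proof. now destruct z. Qed.

Lemma Cder_eq f z l : cderiv f z l -> Cder f z = l.
Proof.
  intros H. rewrite <- (C_eta z) in H.
  destruct (rderiv_comp f _ _ _ _ H (rderiv_horizontal z)) as [A B].
  rewrite Cmult_1_r in A, B. unfold Cder.
  apply is_derive_unique in A, B. rewrite <- (C_eta l), <- A, <- B. reflexivity.
Qed.

(** Being of class [C^1] is part of the definition: Cauchy's formula
    below differentiates under an integral sign. *)
Definition hol (f : C -> C) (z : C) : Prop :=
  locally z (fun w => cderiv f w (Cder f w)) /\ continuous (Cder f) z.

Lemma hol_intro f f' z :
  locally z (fun w => cderiv f w (f' w)) -> continuous f' z -> hol f z.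
Proof.
  intros H K. split.
  - revert H; apply filter_imp. intros w Hw. now rewrite (Cder_eq _ _ _ Hw).
  - apply continuous_ext_loc with f'; auto.
    revert H; apply filter_imp. intros w Hw. symmetry; now apply Cder_eq.
Qed.

Lemma hol_cderiv f z : hol f z -> cderiv f z (Cder f z).
Proof. intros [H _]. exact (locally_singleton _ _ H). Qed.

Lemma hol_continuous f z : hol f z -> continuous f z.
Proof. intros H. exact (cderiv_continuous _ _ _ (hol_cderiv _ _ H)). Qed.

Lemma hol_const a z : hol (fun _ => a) z.
Proof.
  apply hol_intro with (fun _ => 0%C).
  - apply filter_forall. intros; apply cderiv_const.
  - apply continuous_const.
Qed.

Lemma hol_id z : hol (fun w => w) z.
Proof.
  apply hol_intro with (fun _ => 1%C).
  - apply filter_forall. intros; apply cderiv_id.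
  - apply continuous_const.
Qed.

Lemma hol_plus f g z : hol f z -> hol g z -> hol (fun w => f w + g w)%C z.
Proof.
  intros [F F'] [G G']. apply hol_intro with (fun w => Cder f w + Cder g w)%C.
  - generalize (filter_and _ _ F G). apply filter_imp. intros w [A B]; now apply cderiv_plus.
  - now apply continuous_Cplus.
Qed.

Lemma hol_opp f z : hol f z -> hol (fun w => - f w)%C z.
Proof.
  intros [F F']. apply hol_intro with (fun w => - Cder f w)%C.
  - revert F. apply filter_imp. intros w A; now apply cderiv_opp.
  - now apply continuous_Copp.
Qed.

Lemma hol_minus f g z : hol f z -> hol g z -> hol (fun w => f w - g w)%C z.
Proof. intros; apply hol_plus; auto using hol_opp. Qed.

Lemma hol_mult f g z : hol f z -> hol g z -> hol (fun w => f w * g w)%C z.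
Proof.
  intros HF HG. generalize (hol_continuous _ _ HF) (hol_continuous _ _ HG). intros CF CG.
  destruct HF as [F F'], HG as [G G'].
  apply hol_intro with (fun w => Cder f w * g w + f w * Cder g w)%C.
  - generalize (filter_and _ _ F G). apply filter_imp. intros w [A B]; now apply cderiv_mult.
  - apply continuous_Cplus; now apply continuous_Cmult.
Qed.

Lemma hol_inv f z : hol f z -> f z <> 0%C -> hol (fun w => / f w)%C z.
Proof.
  intros HF N. generalize (hol_continuous _ _ HF). intros CF.
  destruct HF as [F F'].
  apply hol_intro with (fun w => - Cder f w / (f w * f w))%C.
  - generalize (filter_and _ _ F (locally_neq0 _ _ CF N)).
    apply filter_imp. intros w [A B]; now apply cderiv_inv.
  - apply continuous_Cmult; [now apply continuous_Copp|]. apply continuous_Cinv.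
    now apply continuous_Cmult. now apply Cmult_neq_0.
Qed.

Lemma hol_ext_loc f g z : locally z (fun w => f w = g w) -> hol f z -> hol g z.
Proof.
  intros E [F F']. apply hol_intro with (Cder f); auto.
  generalize (filter_and _ _ (locally_locally _ _ E) F). apply filter_imp.
  intros w [A B]. now apply cderiv_ext_loc with f.
Qed.

(** * Integrals over the circle *)

Definition circle_int (F : R -> C) : C :=
  (RInt (fun t => Re (F t)) 0 (2 * PI), RInt (fun t => Im (F t)) 0 (2 * PI)).

Lemma ex_RInt_parts F : (forall t : R, continuous F t) ->
  ex_RInt (fun t => Re (F t)) 0 (2 * PI) /\ ex_RInt (fun t => Im (F t)) 0 (2 * PI).
Proof.
  intros H; split; apply (ex_RInt_continuous (V:=R_CompleteNormedModule)); intros t _.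
  - apply continuous_Re_part, H.
  - apply continuous_Im_part, H.
Qed.

Lemma circle_int_ext F G : (forall t, F t = G t) -> circle_int F = circle_int G.
Proof. intros H. unfold circle_int. f_equal; apply RInt_ext; intros; now rewrite H. Qed.

Lemma circle_int_minus F G : (forall t : R, continuous F t) -> (forall t : R, continuous G t) ->
  circle_int (fun t => F t - G t)%C = (circle_int F - circle_int G)%C.
Proof.
  intros HF HG. destruct (ex_RInt_parts _ HF), (ex_RInt_parts _ HG).
  apply C_ext; simpl.
  - apply (RInt_minus (fun t => Re (F t)) (fun t => Re (G t))); auto.
  - apply (RInt_minus (fun t => Im (F t)) (fun t => Im (G t))); auto.
Qed.

Lemma circle_int_scal k F : (forall t : R, continuous F t) -> circle_int (fun t => k * F t)%C = (k * circle_int F)%C.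
Proof.
  intros HF. destruct (ex_RInt_parts _ HF) as [A B].
  assert (S : forall (a b : R) (f g : R -> R), ex_RInt f 0 (2 * PI) -> ex_RInt g 0 (2 * PI) ->
    RInt (fun t => a * f t + b * g t) 0 (2 * PI) = a * RInt f 0 (2*PI) + b * RInt g 0 (2*PI)).
  { intros a b f g Hf Hg.
    rewrite (RInt_plus (V:=R_CompleteNormedModule) (fun t => a * f t) (fun t => b * g t)).
    - rewrite (RInt_scal (V:=R_CompleteNormedModule) f), (RInt_scal (V:=R_CompleteNormedModule) g); auto.
    - now apply (ex_RInt_scal (V:=R_NormedModule)).
    - now apply (ex_RInt_scal (V:=R_NormedModule)). }
  apply C_ext; simpl.
  - replace (fst k * RInt (fun t => Re (F t)) 0 (2 * PI) - snd k * RInt (fun t => Im (F t)) 0 (2 * PI))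
      with (fst k * RInt (fun t => Re (F t)) 0 (2 * PI) + (- snd k) * RInt (fun t => Im (F t)) 0 (2 * PI))
      by ring.
    rewrite <- S by auto. apply RInt_ext. intros t _. as_type R. unfold Re, Im; simpl; ring.
  - rewrite Rplus_comm, (Rplus_comm (_ * _)). rewrite <- S by auto.
    apply RInt_ext. intros t _. as_type R. unfold Re, Im; simpl; ring.
Qed.

Lemma circle_int_const k : circle_int (fun _ => k) = (RtoC (2 * PI) * k)%C.
Proof.
  apply C_ext; simpl; rewrite RInt_const; unfold scal; simpl; unfold mult; simpl; unfold Re, Im; ring.
Qed.

(** Bounding the real and imaginary parts separately loses a factor 2, which is
    harmless here. *)
Lemma circle_int_bound F M : (forall t : R, continuous F t) -> (forall t, 0 <= t <= 2 * PI -> Cmod (F t) <= M) ->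
  Cmod (circle_int F) <= 4 * PI * M.
Proof.
  intros HF HM. destruct (ex_RInt_parts _ HF) as [A B].
  assert (P := PI_RGT_0).
  assert (R1 : Rabs (Re (circle_int F)) <= (2 * PI - 0) * M).
  { apply abs_RInt_le_const; auto; try lra. intros t Ht.
    eapply Rle_trans; [apply re_le_Cmod | now apply HM]. }
  assert (R2 : Rabs (Im (circle_int F)) <= (2 * PI - 0) * M).
  { apply abs_RInt_le_const; auto; try lra. intros t Ht.
    eapply Rle_trans; [|now apply (HM t)]. eapply Rle_trans; [|apply Rmax_Cmod]. apply Rmax_r. }
  replace (circle_int F) with (RtoC (Re (circle_int F)) + Ci * RtoC (Im (circle_int F)))%C.
  2:{ apply C_ext; unfold Re, Im; simpl; ring. }
  eapply Rle_trans; [apply Cmod_triangle|].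
  rewrite Cmod_mult, !Cmod_R, Cmod_Ci. lra.
Qed.

(** The derivative in [t] of the integral of [F t] is the integral of the exact
    derivative [X t = (Y t)'], with [Y t] periodic, so it vanishes.  This replaces the
    homotopy invariance of contour integrals. *)
Lemma RInt_constant_in_family (a b : R) (F X Y : R -> R -> R) : a < 0 -> 1 < b ->
  (forall t s, a < t < b -> is_derive (fun u => F u s) t (X t s)) ->
  (forall t s, a < t < b -> is_derive (Y t) s (X t s)) ->
  (forall t s, a < t < b -> continuous (fun p : R * R => X (fst p) (snd p)) (t, s)) ->
  (forall t s, a < t < b -> continuous (F t) s) ->
  (forall t, a < t < b -> Y t (2 * PI) = Y t 0) ->
  RInt (F 0) 0 (2 * PI) = RInt (F 1) 0 (2 * PI).
Proof.
  intros Ha Hb HF HY HX CF HP.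
  assert (Loc : forall t, a < t < b -> locally t (fun u => a < u < b)).
  { intros t Ht. apply (open_and _ _ (open_gt a) (open_lt b)). exact Ht. }
  apply (eq_is_derive (V:=R_NormedModule) (fun t => RInt (F t) 0 (2 * PI)) 0 1); [|lra].
  intros t Ht. assert (Ht' : a < t < b) by lra.
  replace (@zero R_NormedModule) with (RInt (fun s => Derive (fun u => F u s) t) 0 (2 * PI)).
  - apply is_derive_RInt_param.
    + generalize (Loc t Ht'). apply filter_imp. intros u Hu s _. eexists. now apply HF.
    + intros s _. apply continuity_2d_pt_ext_loc with X.
      * destruct (Loc t Ht') as [d Hd]. exists d. intros u v Hu _.
        symmetry. apply is_derive_unique. apply HF. apply Hd. exact Hu.
      * apply (proj2 (continuity_2d_pt_filterlim X t s)). now apply HX.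
    + generalize (Loc t Ht'). apply filter_imp. intros u Hu.
      apply (ex_RInt_continuous (V:=R_CompleteNormedModule)). intros s _. now apply CF.
  - rewrite (RInt_ext _ (X t)).
    + apply is_RInt_unique. replace (@zero R_NormedModule) with (minus (Y t (2 * PI)) (Y t 0)).
      * apply (is_RInt_derive (V:=R_CompleteNormedModule)).
        -- intros s _. now apply HY.
        -- intros s _. apply (continuous_comp (fun s : R => (t, s)) (fun p : R * R => X (fst p) (snd p))).
           ++ apply (continuous_pair (U:=R_UniformSpace) (V:=R_UniformSpace)).
              apply continuous_const. apply continuous_id.
           ++ now apply HX.
      * rewrite HP by auto. apply (minus_eq_zero (G:=R_AbelianGroup)).
    + intros s _. apply is_derive_unique. now apply HF.
Qed.

Lemma circle_int_constant_in_family (a b : R) (F X Y : R -> R -> C) : a < 0 -> 1 < b ->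
  (forall t s, a < t < b -> rderiv (fun u => F u s) t (X t s)) ->
  (forall t s, a < t < b -> rderiv (Y t) s (X t s)) ->
  (forall t s, a < t < b -> continuous (fun p : R * R => X (fst p) (snd p)) (t, s)) ->
  (forall t s, a < t < b -> continuous (F t) s) ->
  (forall t, a < t < b -> Y t (2 * PI) = Y t 0) ->
  circle_int (F 0) = circle_int (F 1).
Proof.
  intros Ha Hb HF HY HX CF HP. unfold circle_int. f_equal.
  - apply (RInt_constant_in_family a b (fun t s => Re (F t s)) (fun t s => Re (X t s)) (fun t s => Re (Y t s)));
      auto; intros.
    + now apply HF.
    + now apply HY.
    + apply (continuous_Re_part (fun p : R * R => X (fst p) (snd p))); auto.
    + apply continuous_Re_part; auto.
    + now rewrite HP.
  - apply (RInt_constant_in_family a b (fun t s => Im (F t s)) (fun t s => Im (X t s)) (fun t s => Im (Y t s)));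
      auto; intros.
    + now apply HF.
    + now apply HY.
    + apply (continuous_Im_part (fun p : R * R => X (fst p) (snd p))); auto.
    + apply continuous_Im_part; auto.
    + now rewrite HP.
Qed.

(** * Cauchy's formula *)

Definition cis (s : R) : C := (cos s, sin s).

Lemma rderiv_cis s : rderiv cis s (Ci * cis s)%C.
Proof.
  split; simpl.
  - replace (0 * cos s - 1 * sin s) with (- sin s) by ring. apply is_derive_Reals, derivable_pt_lim_cos.
  - replace (0 * sin s + 1 * cos s) with (cos s) by ring. apply is_derive_Reals, derivable_pt_lim_sin.
Qed.

Lemma Cmod_cis s : Cmod (cis s) = 1.
Proof.
  unfold Cmod, cis; simpl. transitivity (sqrt 1); [|apply sqrt_1]. f_equal.
  generalize (sin2_cos2 s). unfold Rsqr. lra.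
Qed.

Lemma cis_2PI : cis (2 * PI) = cis 0.
Proof. unfold cis. now rewrite cos_2PI, sin_2PI, cos_0, sin_0. Qed.

Lemma rderiv_RtoC t : rderiv RtoC t 1.
Proof. split; simpl; [apply (is_derive_id t) | apply (is_derive_const 0)]. Qed.

Section ContPaths.
Context {T : UniformSpace}.
Lemma continuous_cis (u : T -> R) x : continuous u x -> continuous (fun y => cis (u y)) x.
Proof.
  intros H. apply continuous_of_parts; simpl.
  - apply (continuous_comp u cos); auto. apply continuous_cos.
  - apply (continuous_comp u sin); auto. apply continuous_sin.
Qed.
Lemma continuous_RtoC (u : T -> R) x : continuous u x -> continuous (fun y => RtoC (u y)) x.
Proof.
  intros H. apply continuous_of_parts; simpl; auto. apply continuous_const.
Qed.
End ContPaths.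

Lemma cderiv_affine (a b z : C) : cderiv (fun w => a + w * b)%C z b.
Proof.
  exists (fun _ => b). repeat split.
  - apply continuous_const.
  - intros; ring.
Qed.

Lemma rderiv_eq g t l m : rderiv g t l -> l = m -> rderiv g t m.
Proof. now intros H <-. Qed.

Lemma rderiv_affine (a b : C) g t l :
  rderiv g t l -> rderiv (fun u => a + g u * b)%C t (l * b)%C.
Proof.
  intros H. apply (rderiv_eq _ _ (b * l)%C); [|ring].
  apply (rderiv_comp (fun w => a + w * b)%C); auto. apply cderiv_affine.
Qed.

Lemma rderiv_scal (b : C) g t l : rderiv g t l -> rderiv (fun u => b * g u)%C t (b * l)%C.
Proof.
  intros H. apply (rderiv_eq _ _ ((0 * g t + b * 1) * l)%C); [|ring].
  apply (rderiv_comp (fun w => b * w)%C); auto.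
  apply (cderiv_mult (fun _ => b) (fun w => w)); [apply cderiv_const | apply cderiv_id].
Qed.

Lemma rderiv_inv g t l : rderiv g t l -> g t <> 0%C ->
  rderiv (fun u => / g u)%C t (- l / (g t * g t))%C.
Proof.
  intros H N. apply (rderiv_eq _ _ ((- (1) / (g t * g t)) * l)%C); [|field; auto].
  apply (rderiv_comp (fun w => / w)%C); auto.
  apply (cderiv_inv (fun w => w)); auto. apply cderiv_id.
Qed.

Lemma rderiv_ext f g t l : (forall u, f u = g u) -> rderiv f t l -> rderiv g t l.
Proof.
  intros E [A B]; split; eapply is_derive_ext; eauto; intros; simpl; now rewrite E.
Qed.

Ltac cont :=
  repeat match goal with
  | |- continuous (fun y => Cplus (@?u y) (@?v y)) _ => apply (continuous_Cplus u v)
  | |- continuous (fun y => Cminus (@?u y) (@?v y)) _ => apply (continuous_Cminus u v)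
  | |- continuous (fun y => Cmult (@?u y) (@?v y)) _ => apply (continuous_Cmult u v)
  | |- continuous (fun y => Cdiv (@?u y) (@?v y)) _ =>
      apply (continuous_Cmult u (fun y => Cinv (v y)))
  | |- continuous (fun y => Copp (@?u y)) _ => apply (continuous_Copp u)
  | |- continuous (fun y => Cinv (@?u y)) _ => apply (continuous_Cinv u)
  | |- continuous (fun y => cis (@?u y)) _ => apply (continuous_cis u)
  | |- continuous (fun _ => ?k) _ => apply continuous_const
  | |- continuous (fun y => RtoC (@?u y)) _ => apply (continuous_RtoC u)
  | |- continuous (fun y => y) _ => apply continuous_id
  | |- continuous (fun y => fst y) _ => apply continuous_fst
  | |- continuous (fun y => snd y) _ => apply continuous_snd
  | H : forall s : R, continuous _ s |- _ => apply H
  end; auto.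

Lemma circle_neq (r : R) (w : C) s : Cmod w < r -> (RtoC r * cis s - w)%C <> 0%C.
Proof.
  intros H E. assert (E' : (RtoC r * cis s)%C = w).
  { apply Ceq_minus. exact E. }
  assert (Hr : 0 < r) by (generalize (Cmod_ge_0 w); lra).
  rewrite <- E', Cmod_mult, Cmod_cis, Cmod_R, Rabs_pos_eq in H; lra.
Qed.

Lemma Cmod_circle (r : R) s : 0 <= r -> Cmod (RtoC r * cis s) = r.
Proof. intros H. rewrite Cmod_mult, Cmod_cis, Cmod_R, Rabs_pos_eq; lra. Qed.

(** Move the pole from [w] to the centre along [t * w]; at [t = 0] the integrand
    is the constant 1. *)
Lemma circle_int_cauchy_kernel (r : R) (w : C) : Cmod w < r ->
  circle_int (fun s => RtoC r * cis s / (RtoC r * cis s - w))%C = RtoC (2 * PI).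
Proof.
  intros Hw. assert (W0 := Cmod_ge_0 w).
  (* the circle avoids [t * w] for [t] slightly outside [0, 1] as well, as is needed
     to differentiate at the end points *)
  set (e := (r - Cmod w) / (2 * r)).
  assert (He : 0 < e). { unfold e. apply Rdiv_lt_0_compat; lra. }
  assert (Her : Cmod w + e * r < r). { unfold e. field_simplify; lra. }
  assert (N : forall t s, - e < t < 1 + e -> (RtoC r * cis s - RtoC t * w)%C <> 0%C).
  { intros t s Ht. apply circle_neq. rewrite Cmod_mult, Cmod_R.
    assert (Rabs t <= 1 + e) by (apply Rabs_le; lra).
    assert (e * Cmod w <= e * r) by (apply Rmult_le_compat_l; lra). nra. }
  rewrite (circle_int_ext _ (fun s => RtoC r * cis s * / (RtoC r * cis s - RtoC 1 * w))%C).
  2:{ intros s. unfold Cdiv. do 3 f_equal. ring. }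
  rewrite <- (circle_int_constant_in_family (-e) (1+e)
    (fun t s => RtoC r * cis s * / (RtoC r * cis s - RtoC t * w))%C
    (fun t s => RtoC r * cis s * w / ((RtoC r * cis s - RtoC t * w) * (RtoC r * cis s - RtoC t * w)))%C
    (fun t s => Ci * w * / (RtoC r * cis s - RtoC t * w))%C); try lra.
  - rewrite (circle_int_ext _ (fun _ => 1%C)).
    + rewrite circle_int_const. ring.
    + intros s. assert (N0 := N 0 s ltac:(lra)).
      replace (RtoC r * cis s - RtoC 0 * w)%C with (RtoC r * cis s)%C in * by ring.
      now apply Cinv_r.
  - intros t s Ht. specialize (N t s Ht).
    eapply rderiv_eq.
    + apply rderiv_scal. apply (rderiv_inv (fun u => RtoC r * cis s - RtoC u * w)%C); auto.
      apply (rderiv_ext (fun u => RtoC r * cis s + RtoC u * (- w))%C); [intros; ring|].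
      apply rderiv_affine. apply rderiv_RtoC.
    + field. exact N.
  - intros t s Ht. specialize (N t s Ht).
    eapply rderiv_eq.
    + apply rderiv_scal. apply (rderiv_inv (fun u => RtoC r * cis u - RtoC t * w)%C); auto.
      apply (rderiv_ext (fun u => (- (RtoC t * w)) + cis u * RtoC r)%C); [intros; ring|].
      apply rderiv_affine. apply rderiv_cis.
    + replace (Ci * w * (- (Ci * cis s * r) / ((r * cis s - t * w) * (r * cis s - t * w))))%C
        with (- (Ci * Ci) * (w * (cis s * r)) / ((r * cis s - t * w) * (r * cis s - t * w)))%C
        by (field; exact N).
      replace (Ci * Ci)%C with (- (1))%C by (apply C_ext; simpl; ring). field. exact N.
  - intros t s Ht. specialize (N t s Ht). cont. simpl. now apply Cmult_neq_0.
  - intros t s Ht. specialize (N t s Ht). cont.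
  - intros t Ht. now rewrite cis_2PI.
Qed.

(** Contract the circle to the point [c + w], keeping the kernel fixed: along
    [g t s = c + w + t (r e^(is) - w)] the [t]-derivative of [f (g t s) K s] is
    [f' (g t s) r e^(is)], because [K s] cancels the factor [r e^(is) - w], and this
    is the [s]-derivative of [f (g t s) / (i t)]. *)
Lemma cauchy_formula (f : C -> C) (c : C) (R0 r : R) (w : C) :
  (forall z, disk c R0 z -> hol f z) -> Cmod w < r -> r < R0 ->
  circle_int (fun s => f (c + RtoC r * cis s) * (RtoC r * cis s / (RtoC r * cis s - w)))%C
  = (RtoC (2 * PI) * f (c + w))%C.
Proof.
  intros Hf Hw Hr. assert (W0 := Cmod_ge_0 w).
  (* margin such that [(|1 - t| + |t|) r < R0] for [t] in [(-e, 1 + e)] *)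
  set (e := (R0 - r) / (4 * r)).
  assert (He : 0 < e). { unfold e. apply Rdiv_lt_0_compat; lra. }
  assert (Her : r + 2 * e * r < R0). { unfold e. field_simplify; lra. }
  set (g := fun t s => (c + w + RtoC t * (RtoC r * cis s - w))%C).
  set (K := fun s => (RtoC r * cis s / (RtoC r * cis s - w))%C).
  assert (N : forall s, (RtoC r * cis s - w)%C <> 0%C) by (intros; now apply circle_neq).
  assert (D : forall t s, - e < t < 1 + e -> disk c R0 (g t s)).
  { intros t s Ht. unfold disk, g.
    replace (c + w + RtoC t * (RtoC r * cis s - w) - c)%C
      with (RtoC (1 - t) * w + RtoC t * (RtoC r * cis s))%C by (rewrite RtoC_minus; ring).
    eapply Rle_lt_trans; [apply Cmod_triangle|].
    rewrite (Cmod_mult _ w), (Cmod_mult (RtoC t)), !Cmod_R, Cmod_circle by lra.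
    assert (Rabs (1 - t) + Rabs t <= 1 + 2 * e).
    { unfold Rabs. destruct (Rcase_abs (1 - t)), (Rcase_abs t); lra. }
    assert (0 <= Rabs (1 - t)) by apply Rabs_pos.
    assert (Rabs (1 - t) * Cmod w <= Rabs (1 - t) * r) by (apply Rmult_le_compat_l; lra).
    nra. }
  assert (CK : forall s : R, continuous K s).
  { intros s. unfold K. specialize (N s). cont. }
  rewrite (circle_int_ext _ (fun s => f (g 1 s) * K s)%C).
  2:{ intros s. unfold g, K. do 2 f_equal. ring. }
  rewrite <- (circle_int_constant_in_family (-e) (1+e)
    (fun t s => f (g t s) * K s)%C
    (fun t s => Cder f (g t s) * (RtoC r * cis s))%C
    (* at [t = 0] the primitive is that of [f' (c + w) r e^(is)] *)
    (fun t s => if Req_EM_T t 0 then - Ci * (Cder f (c + w) * RtoC r) * cis s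
                else - Ci * / RtoC t * f (g t s))%C); try lra.
  - rewrite (circle_int_ext _ (fun s => f (c + w) * K s)%C).
    + rewrite circle_int_scal by exact CK. unfold K. rewrite circle_int_cauchy_kernel by exact Hw. ring.
    + intros s. unfold g. do 2 f_equal. ring.
  - intros t s Ht. apply (rderiv_eq _ _ (K s * (Cder f (g t s) * (1 * (RtoC r * cis s - w))))%C).
    + apply (rderiv_ext (fun u => K s * f (g u s))%C); [intros; ring|].
      apply rderiv_scal. apply rderiv_comp.
      * apply hol_cderiv. now apply Hf, D.
      * apply rderiv_affine. apply rderiv_RtoC.
    + unfold K. field. apply N.
  - intros t s Ht. destruct (Req_EM_T t 0) as [->|Nt].
    + eapply rderiv_eq; [apply rderiv_scal; apply rderiv_cis|].
      replace (g 0 s) with (c + w)%C by (unfold g; ring).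
      replace (- Ci * (Cder f (c + w) * r) * (Ci * cis s))%C
        with (- (Ci * Ci) * (Cder f (c + w) * r) * cis s)%C by ring.
      replace (Ci * Ci)%C with (- (1))%C by (apply C_ext; simpl; ring). ring.
    + assert (Nt' : RtoC t <> 0%C) by (intros E; apply Nt; now apply RtoC_inj).
      eapply rderiv_eq.
      * apply rderiv_scal. apply rderiv_comp.
        -- apply hol_cderiv. now apply Hf, D.
        -- apply (rderiv_ext (fun s => (c + w - RtoC t * w) + cis s * (RtoC t * RtoC r))%C);
             [intros; unfold g; ring|].
           apply rderiv_affine. apply rderiv_cis.
      * replace (- Ci * / t * (Cder f (g t s) * (Ci * cis s * (t * r))))%C
          with (- (Ci * Ci) * (Cder f (g t s) * (cis s * r)))%C by (field; exact Nt').
        replace (Ci * Ci)%C with (- (1))%C by (apply C_ext; simpl; ring). ring.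
  - intros t s Ht. apply continuous_Cmult.
    + apply (continuous_comp (fun p : R * R => g (fst p) (snd p)) (Cder f)).
      * unfold g. cont.
      * apply Hf. now apply D.
    + cont.
  - intros t s Ht. apply continuous_Cmult; [|apply CK].
    apply (continuous_comp (g t) f).
    + unfold g. cont.
    + apply hol_continuous. now apply Hf, D.
  - intros t Ht. unfold g. now rewrite cis_2PI.
Qed.

(** * Consequences of Cauchy's formula *)

Lemma bounded_on_period (g : R -> C) : (forall s : R, continuous g s) ->
  exists M, 0 <= M /\ forall s, 0 <= s <= 2 * PI -> Cmod (g s) <= M.
Proof.
  intros H. assert (P := PI_RGT_0).
  destruct (continuity_ab_maj (fun s => Cmod (g s)) 0 (2 * PI)) as [m [Hm _]]; [lra| |].
  - intros s _. apply (proj2 (continuity_pt_filterlim _ _)). apply continuous_Cmod, H.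
  - exists (Cmod (g m)). split; [apply Cmod_ge_0|exact Hm].
Qed.

Lemma continuous_lipschitz (Phi : C -> C) z L :
  locally z (fun w => Cmod (Phi w - Phi z) <= L * Cmod (w - z)) -> continuous Phi z.
Proof.
  intros H. intros P HP. apply locally_disk in HP as [e [He HP]].
  apply locally_disk in H as [d [Hd H]].
  assert (L0 : 0 <= Rabs L) by apply Rabs_pos.
  apply locally_disk. exists (Rmin d (e / (Rabs L + 1))).
  assert (E1 : 0 < e / (Rabs L + 1)) by (apply Rdiv_lt_0_compat; lra).
  split; [now apply Rmin_glb_lt|].
  intros w Hw. unfold disk in Hw. apply HP. unfold disk.
  assert (W1 : Cmod (w - z) < d) by (eapply Rlt_le_trans; [exact Hw|apply Rmin_l]).
  assert (W2 : Cmod (w - z) < e / (Rabs L + 1)) by (eapply Rlt_le_trans; [exact Hw|apply Rmin_r]).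
  eapply Rle_lt_trans; [apply H; exact W1|].
  assert (W0 := Cmod_ge_0 (w - z)).
  apply Rle_lt_trans with ((Rabs L + 1) * Cmod (w - z)).
  - apply Rmult_le_compat_r; auto. generalize (Rle_abs L). lra.
  - apply (Rmult_lt_compat_l (Rabs L + 1)) in W2; [|lra].
    replace ((Rabs L + 1) * (e / (Rabs L + 1))) with e in W2 by (field; lra). exact W2.
Qed.

Lemma continuous_circle_int_lipschitz (F : C -> R -> C) z L :
  locally z (fun w => (forall s : R, continuous (F w) s) /\
     forall s, 0 <= s <= 2 * PI -> Cmod (F w s - F z s) <= L * Cmod (w - z)) ->
  continuous (fun w => circle_int (F w)) z.
Proof.
  intros H. assert (Hz := proj1 (locally_singleton _ _ H)).
  apply continuous_lipschitz with (4 * PI * L). revert H. apply filter_imp.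
  intros w [Hw B]. rewrite <- circle_int_minus by auto.
  rewrite Rmult_assoc. apply circle_int_bound; auto. intros s. now apply continuous_Cminus.
Qed.

Lemma dist_circle_ge (c : C) (r : R) (z : C) s : 0 <= r ->
  r - Cmod (z - c) <= Cmod (c + RtoC r * cis s - z).
Proof.
  intros Hr. assert (T := Cmod_triangle (c + RtoC r * cis s - z) (z - c)).
  replace (c + r * cis s - z + (z - c))%C with (RtoC r * cis s)%C in T by ring.
  rewrite Cmod_circle in T by exact Hr. lra.
Qed.

(** The resolvent identity [1/(a-w) - 1/(a-z) = (w-z) / ((a-w)(a-z))], applied
    under the integral sign, exhibits the slope function; applied once more it shows that
    the slope and the derivative are Lipschitz near each point of the disk. *)
Lemma hol_cauchy_integral (g : R -> C) (c : C) (r : R) (z : C) :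
  (forall s : R, continuous g s) -> disk c r z ->
  hol (fun w => circle_int (fun s => g s * / (c + RtoC r * cis s - w)))%C z.
Proof.
  intros Hg Hz. destruct (bounded_on_period g Hg) as [M [M0 HM]].
  assert (Nb : forall z, disk c r z -> forall s, (c + RtoC r * cis s - z)%C <> 0%C).
  { intros w Hw s E. apply (circle_neq r (w - c) s Hw). rewrite <- E. ring. }
  assert (Ck : forall z, disk c r z -> forall s : R, continuous (fun s => / (c + RtoC r * cis s - z))%C s).
  { intros w Hw s. specialize (Nb w Hw s). cont. }
  assert (Kb : forall z, disk c r z -> exists K, 0 < K /\
     locally z (fun w => disk c r w /\ forall s, Cmod (/ (c + RtoC r * cis s - w)) <= K)).
  { intros w Hw. unfold disk in Hw. set (e := (r - Cmod (w - c)) / 2).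
    assert (He : 0 < e) by (unfold e; lra).
    assert (W0 := Cmod_ge_0 (w - c)).
    exists (/ e). split; [now apply Rinv_0_lt_compat|].
    apply locally_disk. exists e. split; auto. intros v Hv. unfold disk in Hv.
    assert (T := Cmod_triangle (v - w) (w - c)).
    replace (v - w + (w - c))%C with (v - c)%C in T by ring.
    assert (Hd : disk c r v) by (unfold disk, e in *; lra).
    split; [exact Hd|]. intros s. rewrite Cmod_inv by now apply Nb.
    apply Rinv_le_contravar; auto.
    generalize (dist_circle_ge c r v s). unfold e in *. lra. }
  apply hol_intro with (fun w => circle_int (fun s => g s * (/ (c + RtoC r * cis s - w) * / (c + RtoC r * cis s - w))))%C.
  - generalize (disk_open _ _ _ Hz). apply filter_imp. clear z Hz. intros z Hz.
    destruct (Kb z Hz) as [K [K0 HK]].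
    assert (Kz := proj2 (locally_singleton _ _ HK)).
    apply cderiv_ext_loc with (fun w => circle_int (fun s => g s * / (c + RtoC r * cis s - z)) +
       circle_int (fun s => g s * (/ (c + RtoC r * cis s - w) * / (c + RtoC r * cis s - z))) * (w - z))%C.
    + revert HK. apply filter_imp. intros w [Hw _].
      rewrite (Cmult_comm _ (w - z)).
      assert (C1 : forall s : R, continuous (fun s => g s * (/ (c + RtoC r * cis s - w)))%C s)
        by (intros; apply continuous_Cmult; auto).
      assert (C2 : forall s : R, continuous (fun s => g s * (/ (c + RtoC r * cis s - z)))%C s)
        by (intros; apply continuous_Cmult; auto).
      assert (C3 : forall s : R, continuous (fun s => g s * (/ (c + RtoC r * cis s - w) * / (c + RtoC r * cis s - z)))%C s).
      { intros s. apply continuous_Cmult; auto. apply continuous_Cmult; auto. }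
      rewrite <- circle_int_scal by exact C3.
      rewrite (circle_int_ext (fun t => (w - z) * _)%C
        (fun s => g s * / (c + RtoC r * cis s - w) - g s * / (c + RtoC r * cis s - z))%C).
      * rewrite circle_int_minus by auto. ring.
      * intros s. field. split; now apply Nb.
    + exists (fun w => circle_int (fun s => g s * (/ (c + RtoC r * cis s - w) * / (c + RtoC r * cis s - z))))%C.
      split; [|split; [reflexivity|]].
      * apply continuous_circle_int_lipschitz with (M * (K * (K * K))). revert HK. apply filter_imp.
        intros w [Hw Kw]. split.
        -- intros s. apply continuous_Cmult; auto. apply continuous_Cmult; auto.
        -- intros s Hs.
           replace (g s * (/ (c + r * cis s - w) * / (c + r * cis s - z)) -
                    g s * (/ (c + r * cis s - z) * / (c + r * cis s - z)))%C
             with (g s * (/ (c + r * cis s - z) * (/ (c + r * cis s - w) * / (c + r * cis s - z))) * (w - z))%C.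
           2:{ field. split; now apply Nb. }
           rewrite Cmod_mult. apply Rmult_le_compat_r; [apply Cmod_ge_0|].
           rewrite !Cmod_mult.
           apply Rmult_le_compat; auto using Cmod_ge_0, Rmult_le_pos.
           apply Rmult_le_compat; auto using Cmod_ge_0, Rmult_le_pos.
           apply Rmult_le_compat; auto using Cmod_ge_0, Rmult_le_pos.
      * intros w. ring.
  - destruct (Kb z Hz) as [K [K0 HK]].
    assert (Kz := proj2 (locally_singleton _ _ HK)).
    apply continuous_circle_int_lipschitz with (M * ((K + K) * (K * K))). revert HK. apply filter_imp.
    intros w [Hw Kw]. split.
    + intros s. apply continuous_Cmult; auto. apply continuous_Cmult; auto.
    + intros s Hs.
      replace (g s * (/ (c + r * cis s - w) * / (c + r * cis s - w)) -
               g s * (/ (c + r * cis s - z) * / (c + r * cis s - z)))%C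
        with (g s * ((/ (c + r * cis s - w) + / (c + r * cis s - z)) *
              (/ (c + r * cis s - w) * / (c + r * cis s - z))) * (w - z))%C.
      2:{ field. split; now apply Nb. }
      rewrite Cmod_mult. apply Rmult_le_compat_r; [apply Cmod_ge_0|].
      rewrite Cmod_mult.
      apply Rmult_le_compat; auto using Cmod_ge_0.
      rewrite Cmod_mult. apply Rmult_le_compat; auto using Cmod_ge_0.
      * eapply Rle_trans; [apply Cmod_triangle|]. apply Rplus_le_compat; auto.
      * rewrite Cmod_mult. apply Rmult_le_compat; auto using Cmod_ge_0.
Qed.

Lemma RtoC_2PI_neq0 : RtoC (2 * PI) <> 0%C.
Proof. intros E. apply (f_equal Re) in E. simpl in E. generalize PI_RGT_0. lra. Qed.

Lemma continuous_on_circle (f : C -> C) c R0 r : (forall z, disk c R0 z -> hol f z) -> 0 <= r < R0 ->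
  forall s : R, continuous (fun s => f (c + RtoC r * cis s)%C) s.
Proof.
  intros Hf Hr s. apply (continuous_comp (fun s => c + RtoC r * cis s)%C f).
  - cont.
  - apply hol_continuous, Hf. unfold disk.
    replace (c + r * cis s - c)%C with (RtoC r * cis s)%C by ring. rewrite Cmod_circle; lra.
Qed.

(** In Cauchy's formula split the kernel as [a/(a-u) = 1 + u/(a-u)].  The first
    term integrates to [f c = 0], and the second is [u] times a Cauchy integral. *)
Lemma hol_divide_local (f : C -> C) (c : C) :
  locally c (hol f) -> f c = 0%C ->
  exists q, locally c (hol q) /\ locally c (fun z => f z = ((z - c) * q z)%C).
Proof.
  intros H Hc. apply locally_disk in H as [R0 [HR Hf]].
  set (r := R0 / 2). assert (Hr : 0 <= r < R0) by (unfold r; lra).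
  set (g := fun s => f (c + RtoC r * cis s)%C).
  assert (Cg : forall s : R, continuous g s) by (exact (continuous_on_circle f c R0 r Hf Hr)).
  exists (fun z => / RtoC (2 * PI) * circle_int (fun s => g s * / (c + RtoC r * cis s - z)))%C.
  assert (Hd : locally c (disk c r)).
  { apply disk_open. unfold disk. replace (c - c)%C with (RtoC 0) by ring. rewrite Cmod_0. unfold r; lra. }
  split; revert Hd; apply filter_imp; overC; intros z Hz.
  - apply hol_mult; [apply hol_const|]. now apply hol_cauchy_integral.
  - assert (F0 := cauchy_formula f c R0 r 0 Hf). rewrite Cmod_0 in F0.
    specialize (F0 ltac:(unfold r; lra) ltac:(lra)).
    assert (F1 := cauchy_formula f c R0 r (z - c) Hf Hz ltac:(lra)).
    replace (c + 0)%C with c in F0 by ring. rewrite Hc in F0.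
    replace (c + (z - c))%C with z in F1 by ring.
    assert (N0 : forall s, (RtoC r * cis s - 0)%C <> 0%C).
    { intros s; apply circle_neq. rewrite Cmod_0; unfold r; lra. }
    assert (N1 : forall s, (RtoC r * cis s - (z - c))%C <> 0%C) by (intros; now apply circle_neq).
    assert (N2 : forall s, (c + RtoC r * cis s - z)%C <> 0%C).
    { intros s E. apply (N1 s). rewrite <- E. ring. }
    assert (Ci1 : forall s : R, continuous (fun s => g s * / (c + RtoC r * cis s - z))%C s).
    { intros s. specialize (N2 s). apply continuous_Cmult; auto. clear Cg. cont. }
    rewrite (circle_int_ext _ g) in F0.
    2:{ intros s. unfold g. specialize (N0 s).
        replace (RtoC r * cis s - 0)%C with (RtoC r * cis s)%C in * by ring.
        unfold Cdiv. rewrite Cinv_r by exact N0. ring. }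
    assert (E : circle_int (fun s => (z - c) * (g s * / (c + RtoC r * cis s - z)))%C =
                (RtoC (2 * PI) * f z)%C).
    { rewrite (circle_int_ext _ (fun s => g s * (RtoC r * cis s / (RtoC r * cis s - (z - c))) - g s)%C).
      - rewrite circle_int_minus; auto.
        + unfold g at 1. rewrite F1, F0. ring.
        + intros s. specialize (N1 s). apply continuous_Cmult; auto. clear Cg Ci1. cont.
      - intros s. specialize (N1 s). specialize (N2 s).
        replace (c + RtoC r * cis s - z)%C with (RtoC r * cis s - (z - c))%C in * by ring.
        field. exact N1. }
    rewrite circle_int_scal in E by auto.
    replace ((z - c) * (/ RtoC (2 * PI) * circle_int (fun s => g s * / (c + RtoC r * cis s - z))))%C
      with (/ RtoC (2 * PI) * ((z - c) * circle_int (fun s => g s * / (c + RtoC r * cis s - z))))%C by ring.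
    rewrite E. field. apply RtoC_2PI_neq0.
Qed.

Lemma hol_pow f n z : hol f z -> hol (fun w => f w ^ n)%C z.
Proof.
  intros H. induction n as [|n IH].
  - apply (hol_const 1%C).
  - apply (hol_ext_loc (fun w => f w * f w ^ n)%C).
    + apply filter_forall. reflexivity.
    + now apply hol_mult.
Qed.

Lemma geom_bound_zero a B x : 0 <= a -> 0 <= x < 1 -> (forall n, a <= B * x ^ n) -> a = 0.
Proof.
  intros Ha Hx H. apply Rle_antisym; auto.
  apply (is_lim_seq_le (fun _ => a) (fun n => B * x ^ n) a 0); auto.
  - apply is_lim_seq_const.
  - replace (Finite 0) with (Rbar_mult B 0) by (simpl; f_equal; ring).
    apply is_lim_seq_scal_l. apply is_lim_seq_geom. rewrite Rabs_pos_eq; lra.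
Qed.

(** As [f] vanishes near [c], the functions [f / (z - c)^n] are holomorphic on the
    whole disk.  Cauchy's formula for them bounds [|f z|] by a constant times
    [(|z - c| / r)^n] for every [n]. *)
Lemma hol_zero_disk (f : C -> C) (c : C) (R0 : R) :
  (forall z, disk c R0 z -> hol f z) -> locally c (fun z => f z = 0%C) ->
  forall z, disk c R0 z -> f z = 0%C.
Proof.
  intros Hf H0 z Hz. unfold disk in Hz.
  destruct (Ceq_dec z c) as [->|Nz]; [exact (locally_singleton _ _ H0)|].
  assert (Nzc : (z - c)%C <> 0%C) by now apply Cminus_eq_contra.
  assert (Pz : 0 < Cmod (z - c)) by now apply Cmod_gt_0.
  set (r := (Cmod (z - c) + R0) / 2). assert (Hr : Cmod (z - c) < r < R0) by (unfold r; lra).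
  assert (Hr' : 0 <= r < R0) by lra.
  destruct (bounded_on_period _ (continuous_on_circle f c R0 r Hf Hr')) as [M [M0 HM]].
  assert (Hn : forall n w, disk c R0 w -> hol (fun w => f w * (/ (w - c)) ^ n)%C w).
  { intros n w Hw. destruct (Ceq_dec w c) as [->|N].
    (* at the centre the quotient is zero whatever [/ 0] is, and so it is around it *)
    - apply (hol_ext_loc (fun _ => 0%C)); [|apply hol_const].
      revert H0. apply filter_imp. intros v Hv. rewrite Hv. now rewrite Cmult_0_l.
    - apply hol_mult; auto. apply hol_pow. apply hol_inv.
      + apply hol_minus; [apply hol_id | apply hol_const].
      + now apply Cminus_eq_contra. }
  apply Cmod_eq_0.
  apply (geom_bound_zero _ (2 * (M * (r / (r - Cmod (z - c))))) (Cmod (z - c) / r)).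
  - apply Cmod_ge_0.
  - split.
    + apply Rdiv_le_0_compat; lra.
    + apply Rlt_div_l; lra.
  - intros n.
    assert (F := cauchy_formula _ c R0 r (z - c) (Hn n) ltac:(lra) ltac:(lra)).
    simpl in F. replace (c + (z - c))%C with z in F by ring.
    apply (f_equal Cmod) in F. rewrite !Cmod_mult, Cmod_pow, Cmod_inv, Cmod_R in F by exact Nzc.
    assert (P := PI_RGT_0). rewrite (Rabs_pos_eq (2 * PI)) in F by lra.
    assert (Nr : forall s, (RtoC r * cis s - (z - c))%C <> 0%C) by (intros; apply circle_neq; lra).
    assert (B : Cmod (circle_int (fun s : R => f (c + r * cis s) * (/ (c + r * cis s - c)) ^ n *
            (r * cis s / (r * cis s - (z - c))))%C) <= 4 * PI * (M * (/ r) ^ n * (r / (r - Cmod (z - c))))).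
    { apply circle_int_bound.
      - intros s. specialize (Nr s). apply continuous_Cmult.
        + apply (continuous_on_circle _ c R0 r (Hn n) Hr').
        + cont.
      - intros s Hs. replace (c + r * cis s - c)%C with (RtoC r * cis s)%C by ring.
        assert (Nc : (RtoC r * cis s)%C <> 0%C) by (apply Cmod_gt_0; rewrite Cmod_circle; lra).
        rewrite !(Cmod_mult (_ * _)), (Cmod_mult (f _)), Cmod_pow, Cmod_inv, Cmod_div, !Cmod_circle by (auto; lra).
        apply Rmult_le_compat.
        + apply Rmult_le_pos; [apply Cmod_ge_0|]. apply pow_le. apply Rlt_le, Rinv_0_lt_compat; lra.
        + apply Rdiv_le_0_compat; [lra|]. now apply Cmod_gt_0.
        + apply Rmult_le_compat_r; [|now apply HM].
          apply pow_le. apply Rlt_le, Rinv_0_lt_compat; lra.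
        + apply Rmult_le_compat_l; [lra|]. apply Rinv_le_contravar; [lra|].
          generalize (dist_circle_ge c r z s ltac:(lra)).
          replace (c + r * cis s - z)%C with (r * cis s - (z - c))%C by ring. lra. }
    rewrite F in B. clear F.
    assert (Q : 0 < Cmod (z - c) ^ n) by now apply pow_lt.
    apply (Rmult_le_reg_l (2 * PI * (/ Cmod (z - c)) ^ n)).
    { apply Rmult_lt_0_compat; [lra|]. apply pow_lt. now apply Rinv_0_lt_compat. }
    replace (2 * PI * (/ Cmod (z - c)) ^ n * Cmod (f z)) with
      (2 * PI * (Cmod (f z) * (/ Cmod (z - c)) ^ n)) by ring.
    eapply Rle_trans; [exact B|]. right.
    unfold Rdiv. rewrite Rpow_mult_distr, !pow_inv. field.
    repeat split; try lra; apply pow_nonzero; lra.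
Qed.

(** * The complex exponential, cosine and sine *)

Definition cexp (z : C) : C := (RtoC (exp (Re z)) * cis (Im z))%C.

Lemma cexp_add z w : cexp (z + w) = (cexp z * cexp w)%C.
Proof.
  unfold cexp. rewrite re_plus, im_plus, exp_plus.
  apply C_ext; simpl; rewrite ?cos_plus, ?sin_plus; ring.
Qed.

Lemma cexp_0 : cexp 0 = 1%C.
Proof. unfold cexp; simpl. apply C_ext; simpl; rewrite exp_0, cos_0, sin_0; ring. Qed.

Lemma cexp_opp_r z : (cexp z * cexp (- z))%C = 1%C.
Proof. rewrite <- cexp_add. replace (z + - z)%C with (0 : C) by ring. apply cexp_0. Qed.

Lemma cexp_neq0 z : cexp z <> 0%C.
Proof. intros E. generalize (cexp_opp_r z). rewrite E, Cmult_0_l. intros H. now apply C1_nz. Qed.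

Lemma Cmod_cexp z : Cmod (cexp z) = exp (Re z).
Proof.
  unfold cexp. rewrite Cmod_mult, Cmod_cis, Cmod_R, Rabs_pos_eq; [ring|].
  apply Rlt_le, exp_pos.
Qed.

Lemma cexp_eq_1 z : cexp z = 1%C -> exists k : Z, z = (Ci * RtoC (2 * PI * IZR k))%C.
Proof.
  intros H. assert (M := f_equal Cmod H). rewrite Cmod_cexp, Cmod_1 in M.
  rewrite <- exp_0 in M. apply exp_inv in M.
  apply (f_equal Re) in H. unfold cexp in H. simpl in H. unfold Re, Im in *. rewrite M, exp_0 in H.
  assert (Hc : cos (2 * (snd z / 2)) = 1) by (replace (2 * (snd z / 2)) with (snd z) by field; lra).
  rewrite cos_2a_sin in Hc.
  assert (Hs : sin (snd z / 2) = 0) by nra.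
  destruct (sin_eq_0_0 _ Hs) as [k Hk]. exists k.
  apply C_ext; simpl; unfold Re, Im; lra.
Qed.

Lemma cexp_eq z w : cexp z = cexp w -> exists k : Z, z = (w + Ci * RtoC (2 * PI * IZR k))%C.
Proof.
  intros H. destruct (cexp_eq_1 (z + - w)) as [k Hk].
  - rewrite cexp_add, H. apply cexp_opp_r.
  - exists k. rewrite <- Hk. ring.
Qed.

Lemma Csqrt_exists (n : C) : exists s, (s * s)%C = n.
Proof.
  destruct n as [a b]. set (m := Cmod (a, b)).
  assert (Hm : m ^ 2 = a ^ 2 + b ^ 2).
  { unfold m. rewrite Cmod2_alt. reflexivity. }
  assert (m0 : 0 <= m) by apply Cmod_ge_0.
  assert (Ha : Rabs a <= m) by (apply (re_le_Cmod (a, b))).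
  assert (A1 := Rle_abs a). assert (A2 := Rle_abs (- a)). rewrite Rabs_Ropp in A2.
  set (x := sqrt ((m + a) / 2)). set (y := sqrt ((m - a) / 2)).
  assert (X2 : x * x = (m + a) / 2) by (apply sqrt_sqrt; lra).
  assert (Y2 : y * y = (m - a) / 2) by (apply sqrt_sqrt; lra).
  assert (XY : 2 * (x * y) = Rabs b).
  { assert (0 <= x * y) by (apply Rmult_le_pos; apply sqrt_pos).
    rewrite <- (Rabs_pos_eq (2 * (x * y))) by lra. apply Rsqr_eq_abs_0. unfold Rsqr.
    replace (2 * (x * y) * (2 * (x * y))) with (4 * (x * x) * (y * y)) by ring.
    rewrite X2, Y2. nra. }
  destruct (Rle_dec 0 b).
  - exists (x, y). rewrite Rabs_pos_eq in XY by auto. apply C_ext; simpl; lra.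
  - exists (x, - y). rewrite Rabs_left in XY by lra. apply C_ext; simpl; lra.
Qed.

(** Convergence by parts, the form in which the star exponential is defined. *)
Definition cseries (u : nat -> C) (l : C) : Prop :=
  is_series (fun n => Re (u n)) (Re l) /\ is_series (fun n => Im (u n)) (Im l).

Lemma cseries_ext u v l : (forall n, u n = v n) -> cseries u l -> cseries v l.
Proof. intros E [A B]; split; eapply is_series_ext; eauto; intros; simpl; now rewrite E. Qed.

Lemma is_series_lin2 (u v : nat -> R) l m a b : is_series u l -> is_series v m ->
  is_series (fun n => a * u n + b * v n) (a * l + b * m).
Proof.
  intros H K. apply (is_series_plus (V:=R_NormedModule)).
  - now apply (is_series_scal (V:=R_NormedModule)).
  - now apply (is_series_scal (V:=R_NormedModule)).
Qed.

Lemma cseries_scal k u l : cseries u l -> cseries (fun n => k * u n)%C (k * l)%C.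
Proof.
  intros [A B]. split.
  - replace (Re (k * l)) with (Re k * Re l + (- Im k) * Im l) by (simpl; unfold Re, Im; ring).
    eapply is_series_ext; [|apply (is_series_lin2 _ _ _ _ (Re k) (- Im k) A B)].
    intros n. as_type R. simpl; unfold Re, Im; ring.
  - replace (Im (k * l)) with (Im k * Re l + Re k * Im l) by (simpl; unfold Re, Im; ring).
    eapply is_series_ext; [|apply (is_series_lin2 _ _ _ _ (Im k) (Re k) A B)].
    intros n. as_type R. simpl; unfold Re, Im; ring.
Qed.

Lemma cseries_plus u v l m : cseries u l -> cseries v m -> cseries (fun n => u n + v n)%C (l + m)%C.
Proof.
  intros [A B] [A' B']. split.
  - now apply (is_series_plus (V:=R_NormedModule)).
  - now apply (is_series_plus (V:=R_NormedModule)).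
Qed.

Definition ifact (n : nat) : C := RtoC (/ INR (fact n)).

(** The factor [k] makes the statement stable under differentiation, and gives the
    imaginary part as well ([k = -i]). *)
Lemma Derive_n_Re_cexp (z : C) n : forall k t,
  is_derive_n (fun t => Re (k * cexp (RtoC t * z))) n t (Re (k * z ^ n * cexp (RtoC t * z))).
Proof.
  assert (D1 : forall k t, is_derive (fun t => Re (k * cexp (RtoC t * z))) t
     (Re (k * z * cexp (RtoC t * z)))).
  { intros [k1 k2] t. destruct z as [a b]. unfold cexp, cis; simpl. unfold Re, Im; simpl.
    auto_derive; auto.
    replace (t * a - 0 * b) with (t * a) by ring. replace (t * b + 0 * a) with (t * b) by ring.
    replace (t * a + - (0 * b)) with (t * a) by ring. ring. }
  induction n as [|n IH]; intros k t.
  - change (Re (k * cexp (RtoC t * z)) = Re (k * 1 * cexp (RtoC t * z))). now rewrite Cmult_1_r.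
  - change (is_derive (Derive_n (fun t => Re (k * cexp (RtoC t * z))) n) t
              (Re (k * z ^ S n * cexp (RtoC t * z)))). rewrite Cpow_S.
    apply is_derive_ext with (fun t => Re (k * z ^ n * cexp (RtoC t * z))).
    + intros u. symmetry. apply is_derive_n_unique. apply IH.
    + replace (k * (z * z ^ n))%C with (k * z ^ n * z)%C by ring. apply D1.
Qed.

(** Taylor's formula with Lagrange remainder for the real function
    [t |-> Re (k e^(tz))] on [[0, 1]]. *)
Lemma Re_cexp_series (k z : C) :
  is_series (fun n => Re (k * (ifact n * z ^ n))) (Re (k * cexp z)).
Proof.
  set (phi := fun t => Re (k * cexp (RtoC t * z))).
  assert (D : forall n t, is_derive_n phi n t (Re (k * z ^ n * cexp (RtoC t * z)))).
  { intros n t. apply (Derive_n_Re_cexp z n k t). }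
  assert (Tay : forall n, Rabs (sum_n (fun n => Re (k * (ifact n * z ^ n))) n - Re (k * cexp z)) <=
     (Cmod k * exp (Cmod z)) * (Cmod z ^ S n / INR (fact (S n)))).
  { intros n. destruct (Taylor_Lagrange phi n 0 1) as [ze [Hz E]]; [lra| |].
    - intros t _ m _. destruct m; [exact I|]. eexists. exact (D (S m) t).
    - replace (phi 1) with (Re (k * cexp z)) in E.
      2:{ unfold phi. do 3 f_equal. ring. }
      rewrite E. rewrite sum_n_Reals.
      rewrite (sum_eq (fun n => Re (k * (ifact n * z ^ n)))
         (fun m => (1 - 0) ^ m / INR (fact m) * Derive_n phi m 0) n).
      2:{ intros i _. rewrite (is_derive_n_unique _ _ _ _ (D i 0)).
          replace (RtoC 0 * z)%C with (RtoC 0) by ring. rewrite cexp_0.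
          replace (1 - 0) with 1 by ring. rewrite pow1. unfold ifact.
          replace (k * (RtoC (/ INR (fact i)) * z ^ i))%C with (RtoC (/ INR (fact i)) * (k * z ^ i * 1))%C by ring.
          rewrite re_scal_l. unfold Rdiv. ring. }
      match goal with |- Rabs (?S - (?S + ?T)) <= _ => replace (S - (S + T)) with (- T) by ring end.
      rewrite Rabs_Ropp, (is_derive_n_unique _ _ _ _ (D (S n) ze)).
      replace (1 - 0) with 1 by ring. rewrite pow1.
      assert (P : 0 < INR (fact (S n))) by apply INR_fact_lt_0.
      rewrite Rabs_mult, (Rabs_pos_eq (1 / _)) by (apply Rlt_le, Rdiv_lt_0_compat; lra).
      apply Rle_trans with (1 / INR (fact (S n)) * (Cmod k * Cmod z ^ S n * exp (Cmod z))).
      + apply Rmult_le_compat_l; [apply Rlt_le, Rdiv_lt_0_compat; lra|].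
        eapply Rle_trans; [apply re_le_Cmod|]. rewrite !Cmod_mult, Cmod_pow.
        apply Rmult_le_compat_l.
        { apply Rmult_le_pos; [apply Cmod_ge_0|]. apply pow_le, Cmod_ge_0. }
        rewrite Cmod_cexp. 
        assert (L : Re (RtoC ze * z) <= Cmod z).
        { rewrite re_scal_l. assert (L1 := re_le_Cmod z). assert (L2 := Rle_abs (Re z)).
          assert (L3 := Cmod_ge_0 z). nra. }
        destruct L as [L|L]; [left; now apply exp_increasing | right; now rewrite L].
      + right. unfold Rdiv. ring. }
  change (is_lim_seq (sum_n (fun n => Re (k * (ifact n * z ^ n)))) (Finite (Re (k * cexp z)))).
  apply (is_lim_seq_ext (fun n => (sum_n (fun n => Re (k * (ifact n * z ^ n))) n - Re (k * cexp z)) + Re (k * cexp z))).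
  { intros n; ring. }
  replace (Finite (Re (k * cexp z))) with (Rbar_plus 0 (Re (k * cexp z))) by (simpl; f_equal; ring).
  apply is_lim_seq_plus'; [|apply is_lim_seq_const].
  apply is_lim_seq_abs_0.
  apply (is_lim_seq_le_le (fun _ => 0) _ (fun n => (Cmod k * exp (Cmod z)) * (Cmod z ^ S n / INR (fact (S n))))).
  - intros n. split; [apply Rabs_pos|apply Tay].
  - apply is_lim_seq_const.
  - replace (Finite 0) with (Rbar_mult (Cmod k * exp (Cmod z)) 0) by (simpl; f_equal; ring).
    apply is_lim_seq_scal_l.
    apply (is_lim_seq_incr_1 (fun n => Cmod z ^ n / INR (fact n))).
    apply is_lim_seq_Reals. apply cv_speed_pow_fact.
Qed.

Lemma cexp_series z : cseries (fun n => ifact n * z ^ n)%C (cexp z).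
Proof.
  split.
  - replace (Re (cexp z)) with (Re (1 * cexp z)) by (now rewrite Cmult_1_l).
    eapply is_series_ext; [|apply Re_cexp_series]. intros n. cbv beta. now rewrite Cmult_1_l.
  - replace (Im (cexp z)) with (Re (- Ci * cexp z)) by (simpl; unfold Re, Im; ring).
    eapply is_series_ext; [|apply Re_cexp_series]. intros n. as_type R. simpl; unfold Re, Im; ring.
Qed.

Definition ccos (s : C) : C := ((cexp (Ci * s) + cexp (- (Ci * s))) / RtoC 2)%C.
(** The entire function [sin s / s].  Both it and [ccos] are even, so they do not
    depend on which square root of the norm is chosen. *)
Definition csinc (s : C) : C :=
  if Ceq_dec s 0 then 1%C else ((cexp (Ci * s) - cexp (- (Ci * s))) / (RtoC 2 * Ci * s))%C.

Lemma C2_nz : RtoC 2 <> 0%C.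
Proof. intros E. apply (f_equal Re) in E. simpl in E. lra. Qed.

Lemma Ci_Ci : (Ci * Ci)%C = (- (1))%C.
Proof. apply C_ext; simpl; ring. Qed.

Lemma csin_eq s : (RtoC 2 * Ci * (s * csinc s))%C = (cexp (Ci * s) - cexp (- (Ci * s)))%C.
Proof.
  unfold csinc. destruct (Ceq_dec s 0) as [->|N].
  - replace (- (Ci * 0))%C with (Ci * 0)%C by ring. ring.
  - field. repeat split; auto using Ci_nz, C2_nz.
Qed.

Lemma cos2_sin2 s : (ccos s * ccos s + s * s * (csinc s * csinc s))%C = 1%C.
Proof.
  assert (S := csin_eq s). assert (E := cexp_opp_r (Ci * s)).
  set (x := cexp (Ci * s)) in *. set (y := cexp (- (Ci * s))) in *.
  assert (S2 : (s * csinc s)%C = ((x - y) / (RtoC 2 * Ci))%C).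
  { rewrite <- S. field. repeat split; auto using Ci_nz, C2_nz. }
  replace (s * s * (csinc s * csinc s))%C with ((s * csinc s) * (s * csinc s))%C by ring.
  rewrite S2. unfold ccos. fold x y.
  replace ((x - y) / (RtoC 2 * Ci) * ((x - y) / (RtoC 2 * Ci)))%C
    with (((x - y) * (x - y)) / (RtoC 2 * RtoC 2 * (Ci * Ci)))%C
    by (field; repeat split; auto using Ci_nz, C2_nz).
  rewrite Ci_Ci.
  replace ((x + y) / 2 * ((x + y) / 2) + (x - y) * (x - y) / (2 * 2 * - (1)))%C with (x * y)%C; auto.
  field.
Qed.

Lemma csinc_opp s : csinc (- s) = csinc s.
Proof.
  unfold csinc. destruct (Ceq_dec s 0) as [E|N], (Ceq_dec (- s) 0) as [N'|N']; auto.
  - exfalso; apply N'; rewrite E; ring.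
  - exfalso; apply N. replace s with (- - s)%C by ring. rewrite N'. ring.
  - replace (Ci * - s)%C with (- (Ci * s))%C by ring.
    replace (- - (Ci * s))%C with (Ci * s)%C by ring. field. repeat split; auto using Ci_nz, C2_nz.
Qed.

Lemma cexp_shift z (k : Z) : cexp (z + Ci * RtoC (2 * PI * IZR k)) = cexp z.
Proof.
  rewrite cexp_add. replace (cexp (Ci * RtoC (2 * PI * IZR k))) with (RtoC 1); [ring|].
  unfold cexp. apply C_ext; simpl.
  - replace (0 * (2 * PI * IZR k) - 1 * 0) with 0 by ring.
    replace (0 * 0 + 1 * (2 * PI * IZR k)) with (2 * (IZR k * PI)) by ring.
    rewrite exp_0, cos_2a_sin. rewrite (sin_eq_0_1 (IZR k * PI)) by (now exists k). ring.
  - replace (0 * (2 * PI * IZR k) - 1 * 0) with 0 by ring.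
    replace (0 * 0 + 1 * (2 * PI * IZR k)) with (2 * (IZR k * PI)) by ring.
    rewrite exp_0, sin_2a. rewrite (sin_eq_0_1 (IZR k * PI)) by (now exists k). ring.
Qed.

(** With [x = e^(is)] and [u = e^(it)] the hypothesis reads
    [(u - x) (u - 1/x) = 0]. *)
Lemma ccos_eq s t : ccos s = ccos t ->
  exists k : Z, t = (s + RtoC (2 * PI * IZR k))%C \/ (- t)%C = (s + RtoC (2 * PI * IZR k))%C.
Proof.
  intros H. assert (Es := cexp_opp_r (Ci * s)). assert (Et := cexp_opp_r (Ci * t)).
  unfold ccos in H.
  assert (CiK : forall a b : C, (Ci * a = Ci * b -> a = b)%C).
  { intros a b E. replace a with (/ Ci * (Ci * a))%C by (field; apply Ci_nz). rewrite E. field; apply Ci_nz. }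
  assert (Hp : ((cexp (Ci * t) - cexp (Ci * s)) * (cexp (Ci * t) - cexp (- (Ci * s))) = 0)%C).
  { set (x := cexp (Ci * s)) in *. set (y := cexp (- (Ci * s))) in *.
    set (u := cexp (Ci * t)) in *. set (v := cexp (- (Ci * t))) in *.
    assert (H' : (x + y = u + v)%C).
    { replace (x + y)%C with ((x + y) / RtoC 2 * RtoC 2)%C by field.
      rewrite H. field. }
    replace ((u - x) * (u - y))%C with (u * u - (x + y) * u + x * y)%C by ring.
    rewrite H', Es. replace (u * u - (u + v) * u + 1)%C with (1 - u * v)%C by ring.
    rewrite Et. ring. }
  destruct (Ceq_dec (cexp (Ci * t) - cexp (Ci * s)) 0) as [E|N1].
  - apply Ceq_minus in E. destruct (cexp_eq _ _ E) as [k Hk]. exists k. left.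
    apply CiK. rewrite Hk. ring.
  - destruct (Ceq_dec (cexp (Ci * t) - cexp (- (Ci * s))) 0) as [E|N2].
    + apply Ceq_minus in E. destruct (cexp_eq _ _ E) as [k Hk]. exists (- k)%Z. right.
      apply CiK. replace (Ci * - t)%C with (- (Ci * t))%C by ring. rewrite Hk, opp_IZR.
      rewrite !RtoC_mult, RtoC_opp. ring.
    + exfalso. now apply (Cmult_neq_0 _ _ N1 N2).
Qed.

Lemma IZR_abs_ge_1 (k : Z) : k <> 0%Z -> 1 <= Rabs (IZR k).
Proof. intros H. rewrite <- abs_IZR. apply IZR_le. lia. Qed.

Lemma csinc_neq0 s : Cmod s < 1 -> csinc s <> 0%C.
Proof.
  intros H E. assert (S := csin_eq s). rewrite E in S.
  assert (N : s <> 0%C).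
  { intros ->. unfold csinc in E. destruct (Ceq_dec 0 0); [now apply C1_nz|tauto]. }
  assert (X : cexp (Ci * s) = cexp (- (Ci * s))).
  { apply Ceq_minus. rewrite <- S. ring. }
  destruct (cexp_eq _ _ X) as [k Hk].
  assert (Hs : s = RtoC (PI * IZR k)).
  { replace s with ((Ci * s - - (Ci * s)) / (RtoC 2 * Ci))%C by (field; repeat split; auto using Ci_nz, C2_nz).
    rewrite Hk at 1. rewrite !RtoC_mult. field. repeat split; auto using Ci_nz, C2_nz. }
  assert (k <> 0%Z) by (intros ->; apply N; rewrite Hs; f_equal; ring).
  rewrite Hs, Cmod_R, Rabs_mult, (Rabs_pos_eq PI) in H by (generalize PI_RGT_0; lra).
  assert (1 <= Rabs (IZR k)) by now apply IZR_abs_ge_1.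
  assert (P := PI2_1). nra.
Qed.

(** The alternative is decided by whether [k] is zero, before [v] and [u] are
    chosen, so that it is the same for all coordinates.  For [k <> 0] one has
    [|t| >= 2 pi - 1 >= 1], while [t csinc t = sin t = sin s = s csinc s] gives
    [t v = s u]. *)
Lemma sinc_compare_shift (s t : C) (k : Z) : Cmod s < 1 -> t = (s + RtoC (2 * PI * IZR k))%C ->
  (forall v u : C, (csinc s * v = csinc t * u)%C -> v = u) \/
  (forall v u : C, (csinc s * v = csinc t * u)%C -> Cmod v <= Cmod s * Cmod u).
Proof.
  intros Hs Ht. assert (N := csinc_neq0 s Hs).
  destruct (Z.eq_dec k 0) as [->|Nk].
  - left. intros v u E. replace t with s in E by (rewrite Ht; rewrite Rmult_0_r; ring).
    replace v with (/ csinc s * (csinc s * v))%C by (field; auto). rewrite E. field; auto.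
  - right. intros v u E.
    assert (T1 : 1 <= Cmod t).
    { assert (K := IZR_abs_ge_1 k Nk). assert (P := PI2_1).
      assert (T := Cmod_triangle t (- s)). rewrite Cmod_opp in T.
      replace (t + - s)%C with (RtoC (2 * PI * IZR k)) in T by (rewrite Ht; ring).
      rewrite Cmod_R, Rabs_mult, (Rabs_pos_eq (2 * PI)) in T by lra. nra. }
    assert (ST : (t * csinc t)%C = (s * csinc s)%C).
    { assert (A := csin_eq t). rewrite Ht in A at 3 4.
      replace (- (Ci * (s + RtoC (2 * PI * IZR k))))%C
        with (- (Ci * s) + Ci * RtoC (2 * PI * IZR (- k)))%C in A.
      2:{ rewrite opp_IZR, !RtoC_mult, RtoC_opp. ring. }
      rewrite Cmult_plus_distr_l, !cexp_shift, <- csin_eq in A.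
      replace (t * csinc t)%C with (RtoC 2 * Ci * (t * csinc t) / (RtoC 2 * Ci))%C
        by (field; repeat split; auto using Ci_nz, C2_nz).
      rewrite A. field; repeat split; auto using Ci_nz, C2_nz. }
    assert (TV : (t * v)%C = (s * u)%C).
    { replace (t * v)%C with (t * (csinc s * v) / csinc s)%C by (field; auto).
      rewrite E. replace (t * (csinc t * u))%C with ((t * csinc t) * u)%C by ring.
      rewrite ST. field; auto. }
    apply (f_equal Cmod) in TV. rewrite !Cmod_mult in TV. rewrite <- TV.
    generalize (Cmod_ge_0 v). nra.
Qed.

Lemma sinc_compare (s t : C) : Cmod s < 1 -> ccos s = ccos t ->
  (forall v u : C, (csinc s * v = csinc t * u)%C -> v = u) \/
  (forall v u : C, (csinc s * v = csinc t * u)%C -> Cmod v <= Cmod s * Cmod u).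
Proof.
  intros Hs Hc. destruct (ccos_eq s t Hc) as [k [H|H]].
  - exact (sinc_compare_shift s t k Hs H).
  - rewrite <- (csinc_opp t). exact (sinc_compare_shift s (- t) k Hs H).
Qed.

(** * Quaternions and slices *)

Lemma quat_ext (p q : quat) :
  q_re p = q_re q -> q_i p = q_i q -> q_j p = q_j q -> q_k p = q_k q -> p = q.
Proof.
  destruct p as [[[a b] c] d], q as [[[a' b'] c'] d']. unfold q_re, q_i, q_j, q_k; simpl.
  now intros -> -> -> ->.
Qed.

Lemma q_re_add p q : q_re (p + q)%quat = q_re p + q_re q. Proof. reflexivity. Qed.
Lemma q_i_add p q : q_i (p + q)%quat = q_i p + q_i q. Proof. reflexivity. Qed.
Lemma q_j_add p q : q_j (p + q)%quat = q_j p + q_j q. Proof. reflexivity. Qed.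
Lemma q_k_add p q : q_k (p + q)%quat = q_k p + q_k q. Proof. reflexivity. Qed.
Lemma q_re_opp p : q_re (- p)%quat = - q_re p. Proof. reflexivity. Qed.
Lemma q_i_opp p : q_i (- p)%quat = - q_i p. Proof. reflexivity. Qed.
Lemma q_j_opp p : q_j (- p)%quat = - q_j p. Proof. reflexivity. Qed.
Lemma q_k_opp p : q_k (- p)%quat = - q_k p. Proof. reflexivity. Qed.
Lemma q_re_sub p q : q_re (p - q)%quat = q_re p - q_re q. Proof. reflexivity. Qed.
Lemma q_i_sub p q : q_i (p - q)%quat = q_i p - q_i q. Proof. reflexivity. Qed.
Lemma q_j_sub p q : q_j (p - q)%quat = q_j p - q_j q. Proof. reflexivity. Qed.
Lemma q_k_sub p q : q_k (p - q)%quat = q_k p - q_k q. Proof. reflexivity. Qed.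
Lemma q_re_scal a p : q_re (qscal a p) = a * q_re p. Proof. reflexivity. Qed.
Lemma q_i_scal a p : q_i (qscal a p) = a * q_i p. Proof. reflexivity. Qed.
Lemma q_j_scal a p : q_j (qscal a p) = a * q_j p. Proof. reflexivity. Qed.
Lemma q_k_scal a p : q_k (qscal a p) = a * q_k p. Proof. reflexivity. Qed.
Lemma q_re_mul p q : q_re (p * q)%quat =
  q_re p * q_re q - q_i p * q_i q - q_j p * q_j q - q_k p * q_k q. Proof. reflexivity. Qed.
Lemma q_i_mul p q : q_i (p * q)%quat =
  q_re p * q_i q + q_i p * q_re q + q_j p * q_k q - q_k p * q_j q. Proof. reflexivity. Qed.
Lemma q_j_mul p q : q_j (p * q)%quat =
  q_re p * q_j q - q_i p * q_k q + q_j p * q_re q + q_k p * q_i q. Proof. reflexivity. Qed.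
Lemma q_k_mul p q : q_k (p * q)%quat =
  q_re p * q_k q + q_i p * q_j q - q_j p * q_i q + q_k p * q_re q. Proof. reflexivity. Qed.
Lemma q_re_mk a b c d : q_re (mkq a b c d) = a. Proof. reflexivity. Qed.
Lemma q_i_mk a b c d : q_i (mkq a b c d) = b. Proof. reflexivity. Qed.
Lemma q_j_mk a b c d : q_j (mkq a b c d) = c. Proof. reflexivity. Qed.
Lemma q_k_mk a b c d : q_k (mkq a b c d) = d. Proof. reflexivity. Qed.

(** Rewriting replaces simplification here because [plus], [opp] and [scal] on
    [quat] are canonical operations of nested products. *)
Ltac qcoord :=
  unfold slice_point, qreal, qi, qj, qk in *; 
  repeat rewrite ?q_re_add, ?q_i_add, ?q_j_add, ?q_k_add, ?q_re_opp, ?q_i_opp, ?q_j_opp, ?q_k_opp,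
    ?q_re_sub, ?q_i_sub, ?q_j_sub, ?q_k_sub,
    ?q_re_scal, ?q_i_scal, ?q_j_scal, ?q_k_scal, ?q_re_mul, ?q_i_mul, ?q_j_mul, ?q_k_mul,
    ?q_re_mk, ?q_i_mk, ?q_j_mk, ?q_k_mk.
Ltac qring := apply quat_ext; qcoord; ring.

Lemma qmul_assoc p q r : (p * (q * r) = p * q * r)%quat.
Proof. qring. Qed.

Lemma imag_unit_coords J :
  imag_unit J <-> q_re J = 0 /\ q_i J ^ 2 + q_j J ^ 2 + q_k J ^ 2 = 1.
Proof.
  unfold imag_unit. split.
  - intros H. assert (H0 := f_equal q_re H). assert (H1 := f_equal q_i H).
    assert (H2 := f_equal q_j H). assert (H3 := f_equal q_k H).
    revert H0 H1 H2 H3. clear H. qcoord. intros H0 H1 H2 H3.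
    assert (Z : q_re J = 0) by (destruct (Req_dec (q_re J) 0); [auto|nra]).
    split; [auto|]. rewrite Z in H0. lra.
  - intros [Z N]. apply quat_ext; qcoord; rewrite Z; nra.
Qed.

Lemma imag_unit_opp J : imag_unit J -> imag_unit (- J)%quat.
Proof. rewrite !imag_unit_coords. qcoord. intros [-> N]. split; [ring|rewrite <- N; ring]. Qed.

Lemma imag_unit_qi : imag_unit qi.
Proof. apply imag_unit_coords. qcoord. split; ring. Qed.

Lemma slice_point_opp J a b : slice_point (- J)%quat a b = slice_point J a (- b).
Proof. qring. Qed.

Lemma qnorm_sq q : qnorm q ^ 2 = q_re q ^ 2 + q_i q ^ 2 + q_j q ^ 2 + q_k q ^ 2.
Proof. unfold qnorm. apply pow2_sqrt. nra. Qed.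

Lemma slice_point_re J a b : imag_unit J -> q_re (slice_point J a b) = a.
Proof. intros [Z _]%imag_unit_coords. qcoord. rewrite Z. ring. Qed.

Lemma slice_point_vec_norm J a b : imag_unit J -> qnorm (qvec (slice_point J a b)) = Rabs b.
Proof.
  intros [Z N]%imag_unit_coords. unfold qnorm, qvec. qcoord. rewrite Z.
  rewrite <- sqrt_Rsqr_abs. f_equal. unfold Rsqr.
  replace (b * b) with (b * b * (q_i J ^ 2 + q_j J ^ 2 + q_k J ^ 2)) by (rewrite N; ring). ring.
Qed.

(** [in_sphere] uses the nonnegative number [|b|]; for [b < 0] the unit is
    replaced by its opposite. *)
Lemma circular_slice Omega J J' a b : circular Omega ->
  imag_unit J -> imag_unit J' -> Omega (slice_point J a b) -> Omega (slice_point J' a b).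
Proof.
  intros Hc HJ HJ' HO. apply (Hc _ HO). unfold in_sphere.
  rewrite slice_point_re, slice_point_vec_norm by auto.
  destruct (Rle_dec 0 b).
  - exists J'. split; auto. now rewrite Rabs_pos_eq.
  - exists (- J')%quat. split; [now apply imag_unit_opp|].
    rewrite slice_point_opp, Rabs_left, Ropp_involutive; lra || auto.
Qed.

Lemma slice_decomp q : exists J b, imag_unit J /\ 0 <= b /\ q = slice_point J (q_re q) b.
Proof.
  set (b := qnorm (qvec q)). assert (Hb : b ^ 2 = q_i q ^ 2 + q_j q ^ 2 + q_k q ^ 2).
  { unfold b. rewrite qnorm_sq. unfold qvec; qcoord. ring. }
  assert (b0 : 0 <= b) by apply sqrt_pos.
  destruct (Req_dec b 0) as [Z|N].
  - exists qi, 0. split; [exact imag_unit_qi|]. split; [lra|]. rewrite Z in Hb.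
    apply quat_ext; qcoord; nra.
  - exists (qscal (/ b) (qvec q)), b. split; [|split; auto].
    + apply imag_unit_coords. unfold qvec; qcoord. split; [ring|].
      replace ((/ b * q_i q) ^ 2 + (/ b * q_j q) ^ 2 + (/ b * q_k q) ^ 2)
        with ((q_i q ^ 2 + q_j q ^ 2 + q_k q ^ 2) / b ^ 2) by (field; auto).
      rewrite <- Hb. field; auto.
    + unfold qvec. apply quat_ext; qcoord; field; auto.
Qed.

(** * Complexified quaternions and the star product *)

Record cquat := CQ { c0 : C; c1 : C; c2 : C; c3 : C }.

Definition cq_mul (X Y : cquat) : cquat :=
  CQ (c0 X * c0 Y - c1 X * c1 Y - c2 X * c2 Y - c3 X * c3 Y)
     (c0 X * c1 Y + c1 X * c0 Y + c2 X * c3 Y - c3 X * c2 Y)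
     (c0 X * c2 Y - c1 X * c3 Y + c2 X * c0 Y + c3 X * c1 Y)
     (c0 X * c3 Y + c1 X * c2 Y - c2 X * c1 Y + c3 X * c0 Y).

Fixpoint cq_pow (X : cquat) (n : nat) : cquat :=
  match n with O => CQ 1 0 0 0 | S n' => cq_mul X (cq_pow X n') end.

Definition cq_re (X : cquat) : quat := mkq (Re (c0 X)) (Re (c1 X)) (Re (c2 X)) (Re (c3 X)).
Definition cq_im (X : cquat) : quat := mkq (Im (c0 X)) (Im (c1 X)) (Im (c2 X)) (Im (c3 X)).
(** The map [H (x) C -> H] sending the formal imaginary unit to [J].  It is not
    multiplicative; see [slice_eval_mul]. *)
Definition slice_eval (J : quat) (X : cquat) : quat := (cq_re X + J * cq_im X)%quat.

Definition stem (F0 F1 : C -> quat) (z : C) : cquat :=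
  CQ (q_re (F0 z), q_re (F1 z)) (q_i (F0 z), q_i (F1 z))
     (q_j (F0 z), q_j (F1 z)) (q_k (F0 z), q_k (F1 z)).

(** [induced_by], with the two components of the stem packed in [H (x) C]. *)
Definition induces (Omega : quat -> Prop) (X : C -> cquat) (f : quat -> quat) : Prop :=
  forall J a b, imag_unit J -> Omega (slice_point J a b) -> f (slice_point J a b) = slice_eval J (X (a, b)).

Lemma cquat_ext X Y : c0 X = c0 Y -> c1 X = c1 Y -> c2 X = c2 Y -> c3 X = c3 Y -> X = Y.
Proof. destruct X, Y; simpl; now intros -> -> -> ->. Qed.

Lemma cq_re_stem F0 F1 z : cq_re (stem F0 F1 z) = F0 z.
Proof. now apply quat_ext. Qed.
Lemma cq_im_stem F0 F1 z : cq_im (stem F0 F1 z) = F1 z.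
Proof. now apply quat_ext. Qed.

Lemma induced_induces Omega F0 F1 f : induced_by Omega F0 F1 f -> induces Omega (stem F0 F1) f.
Proof. intros H J a b HJ HO. unfold slice_eval. rewrite cq_re_stem, cq_im_stem. now apply H. Qed.

Lemma cq_of_parts X Y : cq_re X = cq_re Y -> cq_im X = cq_im Y -> X = Y.
Proof.
  intros A B. apply cquat_ext; apply C_ext.
  - exact (f_equal q_re A). - exact (f_equal q_re B).
  - exact (f_equal q_i A). - exact (f_equal q_i B).
  - exact (f_equal q_j A). - exact (f_equal q_j B).
  - exact (f_equal q_k A). - exact (f_equal q_k B).
Qed.

Lemma J_mul_inj J p q : imag_unit J -> (J * p = J * q)%quat -> p = q.
Proof.
  intros HJ E. assert (E' : (J * (J * p) = J * (J * q))%quat) by now rewrite E.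
  rewrite !qmul_assoc in E'. unfold imag_unit in HJ. rewrite HJ in E'.
  assert (N : forall r, (- (qreal (-1) * r))%quat = r) by (intros; qring).
  rewrite <- (N p), <- (N q). now rewrite E'.
Qed.

Lemma two_slices (A B A' B' J : quat) : imag_unit J ->
  (A + J * B = A' + J * B')%quat -> (A + - J * B = A' + - J * B')%quat -> A = A' /\ B = B'.
Proof.
  intros HJ E1 E2.
  assert (HA : A = A').
  { assert (HH : forall P Q : quat, qscal (/ 2) ((P + J * Q) + (P + - J * Q))%quat = P).
    { intros P Q. apply quat_ext; qcoord; field. }
    rewrite <- (HH A B), <- (HH A' B'). now rewrite E1, E2. }
  split; auto. apply (J_mul_inj J); auto.
  assert (HH : forall P Q : quat, ((P + J * Q) - P)%quat = (J * Q)%quat) by (intros; qring).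
  rewrite <- (HH A B), <- (HH A' B'). now rewrite E1, HA.
Qed.

(** The units [J] and [- J] suffice to recover a stem, being the half sum and the
    half difference. *)
Lemma slice_eval_inj X Y J : imag_unit J -> slice_eval J X = slice_eval J Y -> slice_eval (- J)%quat X = slice_eval (- J)%quat Y -> X = Y.
Proof.
  intros HJ E1 E2. destruct (two_slices _ _ _ _ _ HJ E1 E2). now apply cq_of_parts.
Qed.

(** The right-hand side is what the star product computes: [Y] is evaluated
    at the unit [p^-1 J p] with [p] the value of [X] at [J], and
    [p (p^-1 J p) = J p]. *)
Lemma slice_eval_mul J X Y : imag_unit J ->
  slice_eval J (cq_mul X Y) = (slice_eval J X * cq_re Y + J * (slice_eval J X * cq_im Y))%quat.
Proof.
  intros HJ.
  assert (E : forall q, (J * (J * q) = - q)%quat).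
  { intros q. rewrite qmul_assoc. unfold imag_unit in HJ. rewrite HJ. qring. }
  assert (R1 : cq_re (cq_mul X Y) = (cq_re X * cq_re Y - cq_im X * cq_im Y)%quat).
  { apply quat_ext; unfold cq_re, cq_im; qcoord; simpl; unfold Re, Im; ring. }
  assert (R2 : cq_im (cq_mul X Y) = (cq_im X * cq_re Y + cq_re X * cq_im Y)%quat).
  { apply quat_ext; unfold cq_re, cq_im; qcoord; simpl; unfold Re, Im; ring. }
  unfold slice_eval. rewrite R1, R2.
  transitivity ((cq_re X * cq_re Y + J * (cq_im X * cq_re Y) + J * (cq_re X * cq_im Y) +
                 (- (cq_im X * cq_im Y)))%quat); [qring|].
  rewrite <- (E (cq_im X * cq_im Y)%quat). qring.
Qed.

Lemma qnorm_neq0 q : q <> qreal 0 -> qnorm q <> 0.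
Proof.
  intros N H. apply N. assert (S := qnorm_sq q). rewrite H in S.
  apply quat_ext; qcoord; nra.
Qed.

Lemma qinv_l q : q <> qreal 0 -> (qinv q * q)%quat = qreal 1.
Proof.
  intros N. apply qnorm_neq0 in N. unfold qinv. assert (H := qnorm_sq q).
  apply quat_ext; unfold qconj; qcoord; [|field; exact N..].
  transitivity ((q_re q ^ 2 + q_i q ^ 2 + q_j q ^ 2 + q_k q ^ 2) / qnorm q ^ 2).
  - field; exact N.
  - rewrite <- H. field; exact N.
Qed.

Lemma qinv_r q : q <> qreal 0 -> (q * qinv q)%quat = qreal 1.
Proof.
  intros N. apply qnorm_neq0 in N. unfold qinv. assert (H := qnorm_sq q).
  apply quat_ext; unfold qconj; qcoord; [|field; exact N..].
  transitivity ((q_re q ^ 2 + q_i q ^ 2 + q_j q ^ 2 + q_k q ^ 2) / qnorm q ^ 2).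
  - field; exact N.
  - rewrite <- H. field; exact N.
Qed.

Lemma qmul_1_l q : (qreal 1 * q)%quat = q.
Proof. qring. Qed.
Lemma qmul_1_r q : (q * qreal 1)%quat = q.
Proof. qring. Qed.

Lemma star_induces Omega X Y f g : circular Omega ->
  induces Omega X f -> induces Omega Y g -> induces Omega (fun z => cq_mul (X z) (Y z)) (star f g).
Proof.
  intros Hc Hf Hg J a b HJ HO. unfold star. rewrite slice_eval_mul by auto.
  rewrite <- (Hf J a b HJ HO). set (p := f (slice_point J a b)).
  destruct (quat_eq_dec p (qreal 0)) as [->|N].
  - qring.
  - set (J' := (qinv p * J * p)%quat).
    assert (HJ' : imag_unit J').
    { unfold imag_unit, J'.
      transitivity (qinv p * (J * (p * qinv p) * J) * p)%quat; [now rewrite !qmul_assoc|].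
      rewrite qinv_r, qmul_1_r by auto. unfold imag_unit in HJ. rewrite HJ.
      transitivity (qreal (-1) * (qinv p * p))%quat; [qring|].
      rewrite qinv_l by auto. qring. }
    replace (qinv p * slice_point J a b * p)%quat with (slice_point J' a b).
    2:{ unfold slice_point. transitivity (qreal a * (qinv p * p) + J' * qreal b)%quat.
        - rewrite qinv_l by auto. qring.
        - unfold J'. qring. }
    rewrite (Hg J' a b HJ') by (now apply (circular_slice Omega J)).
    unfold slice_eval. transitivity (p * cq_re (Y (a, b)) + (p * J') * cq_im (Y (a, b)))%quat; [qring|].
    unfold J'. rewrite !qmul_assoc, qinv_r, qmul_1_l by auto. reflexivity.
Qed.

Lemma star_pow_induces Omega X f n : circular Omega ->
  induces Omega X f -> induces Omega (fun z => cq_pow (X z) n) (star_pow f n).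
Proof.
  intros Hc Hf. induction n as [|n IH].
  - intros J a b _ _. unfold slice_eval, cq_re, cq_im. simpl. apply quat_ext; qcoord; simpl; ring.
  - exact (star_induces Omega X _ f _ Hc Hf IH).
Qed.

(** * The star exponential *)

Definition cq_series (u : nat -> cquat) (E : cquat) : Prop :=
  cseries (fun n => ifact n * c0 (u n))%C (c0 E) /\ cseries (fun n => ifact n * c1 (u n))%C (c1 E) /\
  cseries (fun n => ifact n * c2 (u n))%C (c2 E) /\ cseries (fun n => ifact n * c3 (u n))%C (c3 E).

Lemma cseries_lin u l a b : cseries u l ->
  is_series (fun n => a * Re (u n) + b * Im (u n)) (a * Re l + b * Im l).
Proof. intros [A B]. now apply is_series_lin2. Qed.

Lemma Series_lin4 (a0 b0 a1 b1 a2 b2 a3 b3 : R) (u0 u1 u2 u3 : nat -> C) l0 l1 l2 l3 (w : nat -> R) :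
  cseries u0 l0 -> cseries u1 l1 -> cseries u2 l2 -> cseries u3 l3 ->
  (forall n, w n = (a0 * Re (u0 n) + b0 * Im (u0 n)) + (a1 * Re (u1 n) + b1 * Im (u1 n)) +
    ((a2 * Re (u2 n) + b2 * Im (u2 n)) + (a3 * Re (u3 n) + b3 * Im (u3 n)))) ->
  Series w = (a0 * Re l0 + b0 * Im l0) + (a1 * Re l1 + b1 * Im l1) +
    ((a2 * Re l2 + b2 * Im l2) + (a3 * Re l3 + b3 * Im l3)).
Proof.
  intros H0 H1 H2 H3 E. apply is_series_unique.
  eapply is_series_ext; [intros n; symmetry; apply E|].
  apply (is_series_plus (V:=R_NormedModule)); apply (is_series_plus (V:=R_NormedModule));
    now apply cseries_lin.
Qed.

Lemma star_exp_value Omega X f J a b E : circular Omega -> induces Omega X f ->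
  imag_unit J -> Omega (slice_point J a b) -> cq_series (cq_pow (X (a, b))) E ->
  star_exp f (slice_point J a b) = slice_eval J E.
Proof.
  intros Hc Hf HJ HO [S0 [S1 [S2 S3]]].
  assert (P : forall n, star_pow f n (slice_point J a b) = slice_eval J (cq_pow (X (a, b)) n))
    by (intros; now apply (star_pow_induces Omega X f n)).
  destruct (proj1 (imag_unit_coords J) HJ) as [Z _].
  assert (Rl : forall n w, Re (ifact n * w) = / INR (fact n) * Re w)
    by (intros; unfold ifact; apply re_scal_l).
  assert (Il : forall n w, Im (ifact n * w) = / INR (fact n) * Im w)
    by (intros; unfold ifact; apply im_scal_l).
  unfold star_exp. apply quat_ext; rewrite ?q_re_mk, ?q_i_mk, ?q_j_mk, ?q_k_mk.
  - rewrite (Series_lin4 1 0 0 (- q_i J) 0 (- q_j J) 0 (- q_k J) _ _ _ _ _ _ _ _ _ S0 S1 S2 S3).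
    + unfold slice_eval, cq_re, cq_im. qcoord. rewrite Z. ring.
    + intros n. rewrite P, !Rl, !Il. unfold slice_eval, cq_re, cq_im. qcoord. rewrite Z. ring.
  - rewrite (Series_lin4 0 (q_i J) 1 0 0 (- q_k J) 0 (q_j J) _ _ _ _ _ _ _ _ _ S0 S1 S2 S3).
    + unfold slice_eval, cq_re, cq_im. qcoord. rewrite Z. ring.
    + intros n. rewrite P, !Rl, !Il. unfold slice_eval, cq_re, cq_im. qcoord. rewrite Z. ring.
  - rewrite (Series_lin4 0 (q_j J) 0 (q_k J) 1 0 0 (- q_i J) _ _ _ _ _ _ _ _ _ S0 S1 S2 S3).
    + unfold slice_eval, cq_re, cq_im. qcoord. rewrite Z. ring.
    + intros n. rewrite P, !Rl, !Il. unfold slice_eval, cq_re, cq_im. qcoord. rewrite Z. ring.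
  - rewrite (Series_lin4 0 (q_k J) 0 (- q_j J) 0 (q_i J) 1 0 _ _ _ _ _ _ _ _ _ S0 S1 S2 S3).
    + unfold slice_eval, cq_re, cq_im. qcoord. rewrite Z. ring.
    + intros n. rewrite P, !Rl, !Il. unfold slice_eval, cq_re, cq_im. qcoord. rewrite Z. ring.
Qed.

Definition vnorm (X : cquat) : C := (c1 X * c1 X + c2 X * c2 X + c3 X * c3 X)%C.

(** As [V^2 = - n], each power of [f + V] has the form [a + b V] with complex
    [a] and [b]. *)
Fixpoint pow_coef (f n : C) (k : nat) : C * C :=
  match k with
  | O => (RtoC 1, RtoC 0)
  | S k' => let (a, b) := pow_coef f n k' in (f * a - n * b, f * b + a)%C
  end.

Lemma cq_pow_coef X k :
  cq_pow X k = CQ (fst (pow_coef (c0 X) (vnorm X) k)) (snd (pow_coef (c0 X) (vnorm X) k) * c1 X)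
    (snd (pow_coef (c0 X) (vnorm X) k) * c2 X) (snd (pow_coef (c0 X) (vnorm X) k) * c3 X).
Proof.
  induction k as [|k IH].
  - simpl. f_equal; ring.
  - simpl. rewrite IH. destruct (pow_coef (c0 X) (vnorm X) k) as [a b]. 
    unfold cq_mul, vnorm; simpl. f_equal; ring.
Qed.

(** [a] and [b] are the half sum and the divided difference of the powers of
    [f + is] and [f - is], the two eigenvalues of [f + V]. *)
Lemma pow_coef_ev f s k :
  let (a, b) := pow_coef f (s * s) k in
  (a + Ci * s * b = (f + Ci * s) ^ k)%C /\ (a - Ci * s * b = (f - Ci * s) ^ k)%C.
Proof.
  induction k as [|k IH].
  - simpl. split; ring.
  - simpl pow_coef. destruct (pow_coef f (s * s) k) as [a b]. destruct IH as [I1 I2].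
    rewrite !Cpow_S, <- I1, <- I2.
    replace (s * s * b)%C with (- (Ci * Ci) * (s * s * b))%C by (rewrite Ci_Ci; ring).
    split; ring.
Qed.

(** The eigenvalues coincide when [s = 0], and [b] is the derivative of the
    power. *)
Lemma pow_coef_zero f k :
  pow_coef f 0 (S k) = (f ^ S k, RtoC (INR (S k)) * f ^ k)%C.
Proof.
  induction k as [|k IH].
  - simpl. f_equal; ring.
  - change (pow_coef f 0 (S (S k))) with (let (a, b) := pow_coef f 0 (S k) in (f * a - 0 * b, f * b + a)%C).
    rewrite IH. cbv iota beta. rewrite (S_INR (S k)), RtoC_plus, !Cpow_S. f_equal; ring.
Qed.

Lemma pow_coef_series f s :
  cseries (fun k => ifact k * fst (pow_coef f (s * s) k))%C (cexp f * ccos s)%C /\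
  cseries (fun k => ifact k * snd (pow_coef f (s * s) k))%C (cexp f * csinc s)%C.
Proof.
  destruct (Ceq_dec s 0) as [->|N].
  - replace (0 * 0)%C with (RtoC 0) by ring.
    unfold csinc. destruct (Ceq_dec 0 0) as [_|]; [|tauto].
    split.
    + replace (cexp f * ccos 0)%C with (cexp f).
      2:{ unfold ccos. replace (- (Ci * 0))%C with (RtoC 0) by ring.
          replace (Ci * 0)%C with (RtoC 0) by ring. rewrite cexp_0. field. }
      eapply cseries_ext; [|apply cexp_series]. intros [|k]; [reflexivity|].
      now rewrite pow_coef_zero.
    + replace (cexp f * 1)%C with (cexp f) by ring.
      assert (Sh : forall k, (ifact (S k) * snd (pow_coef f 0 (S k)))%C = (ifact k * f ^ k)%C).
      { intros k. rewrite pow_coef_zero. unfold snd, ifact.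
        rewrite Cmult_assoc, <- RtoC_mult. do 2 f_equal.
        rewrite fact_simpl, mult_INR. field. split; [apply INR_fact_neq_0|]. apply not_0_INR; lia. }
      destruct (cexp_series f) as [S1 S2]. split.
      * apply (is_series_decr_1 (V:=R_NormedModule)).
        match goal with |- is_series _ ?l => replace l with (Re (cexp f)) end.
        -- eapply is_series_ext; [|exact S1]. intros k. cbv beta. now rewrite Sh.
        -- cbn -[cexp]. unfold plus, opp; simpl. unfold Re; ring.
      * apply (is_series_decr_1 (V:=R_NormedModule)).
        match goal with |- is_series _ ?l => replace l with (Im (cexp f)) end.
        -- eapply is_series_ext; [|exact S2]. intros k. cbv beta. now rewrite Sh.
        -- cbn -[cexp]. unfold plus, opp; simpl. unfold Im; ring.
  - assert (E1 := cexp_series (f + Ci * s)). assert (E2 := cexp_series (f - Ci * s)).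
    rewrite cexp_add in E1. unfold Cminus in E2. rewrite cexp_add in E2.
    split.
    + replace (cexp f * ccos s)%C with (/ 2 * (cexp f * cexp (Ci * s) + cexp f * cexp (- (Ci * s))))%C
        by (unfold ccos; field).
      eapply cseries_ext; [|apply cseries_scal, cseries_plus; [exact E1|exact E2]].
      intros k. cbv beta. assert (K := pow_coef_ev f s k).
      destruct (pow_coef f (s * s) k) as [a b]. destruct K as [K1 K2].
      unfold Cminus in K2. rewrite <- K1, <- K2. unfold fst. field.
    + assert (Ns : (RtoC 2 * Ci * s)%C <> 0%C) by (repeat apply Cmult_neq_0; auto using Ci_nz, C2_nz).
      replace (cexp f * csinc s)%C with
        (/ (2 * Ci * s) * (cexp f * cexp (Ci * s) + (- (1)) * (cexp f * cexp (- (Ci * s)))))%C.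
      2:{ unfold csinc. destruct (Ceq_dec s 0); [tauto|]. field. repeat split; auto using Ci_nz. }
      eapply cseries_ext; [|apply cseries_scal, cseries_plus; [exact E1|apply cseries_scal; exact E2]].
      intros k. cbv beta. assert (K := pow_coef_ev f s k).
      destruct (pow_coef f (s * s) k) as [a b]. destruct K as [K1 K2].
      unfold Cminus in K2. rewrite <- K1, <- K2. unfold snd. field. repeat split; auto using Ci_nz.
Qed.

(** [e^f (cos s + (sin s / s) V)], to be used with [s] a square root of
    [vnorm X]. *)
Definition cq_exp (X : cquat) (s : C) : cquat :=
  CQ (cexp (c0 X) * ccos s) (cexp (c0 X) * csinc s * c1 X)
     (cexp (c0 X) * csinc s * c2 X) (cexp (c0 X) * csinc s * c3 X).

Lemma cq_exp_series X s : (s * s)%C = vnorm X -> cq_series (cq_pow X) (cq_exp X s).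
Proof.
  intros Hs. destruct (pow_coef_series (c0 X) s) as [S1 S2].
  rewrite Hs in S1, S2.
  assert (V : forall v : C, cseries (fun n => ifact n * (snd (pow_coef (c0 X) (vnorm X) n) * v))%C
                 (cexp (c0 X) * csinc s * v)%C).
  { intros v. rewrite (Cmult_comm _ v).
    eapply cseries_ext; [|apply (cseries_scal v); exact S2]. intros n. cbv beta. ring. }
  assert (P : forall pr k, (forall n, pr (cq_pow X n) = k n) ->
             forall l, cseries (fun n => ifact n * k n)%C l -> cseries (fun n => ifact n * pr (cq_pow X n))%C l).
  { intros pr k Hk l. apply cseries_ext. intros n. now rewrite Hk. }
  split; [|split; [|split]].
  - apply (P c0 _ (fun n => f_equal c0 (cq_pow_coef X n))). exact S1.
  - apply (P c1 _ (fun n => f_equal c1 (cq_pow_coef X n))). exact (V (c1 X)).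
  - apply (P c2 _ (fun n => f_equal c2 (cq_pow_coef X n))). exact (V (c2 X)).
  - apply (P c3 _ (fun n => f_equal c3 (cq_pow_coef X n))). exact (V (c3 X)).
Qed.

(** * From partial derivatives to holomorphy *)

Section QuatCoord.
Context {T : UniformSpace}.
Lemma continuous_quat_coords (f : T -> quat) x : continuous f x ->
  continuous (fun y => q_re (f y)) x /\ continuous (fun y => q_i (f y)) x /\
  continuous (fun y => q_j (f y)) x /\ continuous (fun y => q_k (f y)) x.
Proof.
  intros H.
  assert (H1 : continuous (fun y => fst (f y)) x).
  { apply (continuous_comp f fst); auto. destruct (f x); apply continuous_fst. }
  assert (H2 : continuous (fun y => fst (fst (f y))) x).
  { apply (continuous_comp (fun y => fst (f y)) fst); auto. destruct (fst (f x)); apply continuous_fst. }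
  repeat split.
  - apply (continuous_comp (fun y => fst (fst (f y))) fst); auto.
    destruct (fst (fst (f x))); apply continuous_fst.
  - apply (continuous_comp (fun y => fst (fst (f y))) snd); auto.
    destruct (fst (fst (f x))); apply continuous_snd.
  - apply (continuous_comp (fun y => fst (f y)) snd); auto.
    destruct (fst (f x)); apply continuous_snd.
  - apply (continuous_comp f snd); auto. destruct (f x); apply continuous_snd.
Qed.

Lemma continuous_mkq (a b c d : T -> R) x :
  continuous a x -> continuous b x -> continuous c x -> continuous d x ->
  continuous (fun y => mkq (a y) (b y) (c y) (d y)) x.
Proof.
  intros Ha Hb Hc Hd. unfold mkq.
  apply (continuous_pair (U := prod_UniformSpace (prod_UniformSpace R_UniformSpace R_UniformSpace) R_UniformSpace)
           (V := R_UniformSpace)); auto.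
  apply (continuous_pair (U := prod_UniformSpace R_UniformSpace R_UniformSpace)
           (V := R_UniformSpace)); auto.
  apply (continuous_pair (U := R_UniformSpace) (V := R_UniformSpace)); auto.
Qed.
End QuatCoord.

Lemma is_derive_fst {U V : NormedModule R_AbsRing} (f : R -> U * V) t l :
  is_derive f t l -> is_derive (fun u => fst (f u)) t (fst l).
Proof.
  intros H. unfold is_derive in *.
  apply (filterdiff_ext_lin _ (fun y : R_AbsRing => fst (scal y l))).
  - apply (filterdiff_comp' f (fun t : U * V => fst t) t _ (fun t : U * V => fst t)); auto.
    apply filterdiff_linear, is_linear_fst.
  - reflexivity.
Qed.

Lemma is_derive_snd {U V : NormedModule R_AbsRing} (f : R -> U * V) t l :
  is_derive f t l -> is_derive (fun u => snd (f u)) t (snd l).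
Proof.
  intros H. unfold is_derive in *.
  apply (filterdiff_ext_lin _ (fun y : R_AbsRing => snd (scal y l))).
  - apply (filterdiff_comp' f (fun t : U * V => snd t) t _ (fun t : U * V => snd t)); auto.
    apply filterdiff_linear, is_linear_snd.
  - reflexivity.
Qed.

Lemma is_derive_quat_coords (f : R -> quat) t (l : quat) : is_derive f t l ->
  is_derive (fun u => q_re (f u)) t (q_re l) /\ is_derive (fun u => q_i (f u)) t (q_i l) /\
  is_derive (fun u => q_j (f u)) t (q_j l) /\ is_derive (fun u => q_k (f u)) t (q_k l).
Proof.
  intros H. assert (H1 := is_derive_fst _ _ _ H). assert (H2 := is_derive_fst _ _ _ H1).
  split; [|split; [|split]].
  - exact (is_derive_fst _ _ _ H2).
  - exact (is_derive_snd _ _ _ H2).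
  - exact (is_derive_snd _ _ _ H1).
  - exact (is_derive_snd _ _ _ H).
Qed.

(** Expanding on the basis [1, i, j, k] reduces the claim to sums and scalings. *)
Lemma is_derive_mkq (a b c d : R -> R) t a' b' c' d' :
  is_derive a t a' -> is_derive b t b' -> is_derive c t c' -> is_derive d t d' ->
  is_derive (fun u => mkq (a u) (b u) (c u) (d u)) t (mkq a' b' c' d').
Proof.
  intros Ha Hb Hc Hd.
  assert (E : forall x y z w, mkq x y z w =
     plus (plus (scal x (qreal 1)) (scal y qi)) (plus (scal z qj) (scal w qk))).
  { intros x y z w.
    change (mkq x y z w = ((qscal x (qreal 1) + qscal y qi) + (qscal z qj + qscal w qk))%quat). qring. }
  rewrite E.
  apply (is_derive_ext (fun u => plus (plus (scal (a u) (qreal 1)) (scal (b u) qi)) (plus (scal (c u) qj) (scal (d u) qk)))).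
  { intros u. symmetry. apply E. }
  set (Q := prod_NormedModule R_AbsRing (prod_NormedModule R_AbsRing
         (prod_NormedModule R_AbsRing R_NormedModule R_NormedModule) R_NormedModule) R_NormedModule).
  apply (is_derive_plus (V:=Q)
    (fun u => plus (scal (a u) (qreal 1 : Q)) (scal (b u) (qi : Q)))
    (fun u => plus (scal (c u) (qj : Q)) (scal (d u) (qk : Q)))).
  - apply (is_derive_plus (V:=Q) (fun u => scal (a u) (qreal 1 : Q)) (fun u => scal (b u) (qi : Q)));
      apply (is_derive_scal_l (K:=R_AbsRing) (V:=Q)); assumption.
  - apply (is_derive_plus (V:=Q) (fun u => scal (c u) (qj : Q)) (fun u => scal (d u) (qk : Q)));
      apply (is_derive_scal_l (K:=R_AbsRing) (V:=Q)); assumption.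
Qed.

Lemma cderiv_eps f z l :
  (forall eps, 0 < eps -> locally z (fun w => Cmod (f w - f z - l * (w - z)) <= eps * Cmod (w - z))) ->
  cderiv f z l.
Proof.
  intros H. exists (fun w => if Ceq_dec w z then l else (f w - f z) / (w - z))%C.
  split; [|split].
  - intros P HP. destruct (Ceq_dec z z) as [_|]; [|tauto].
    apply locally_disk in HP as [e [He HP]].
    generalize (H (e / 2) ltac:(lra)). unfold filtermap. apply filter_imp. overC. intros w Hw.
    apply HP. unfold disk. destruct (Ceq_dec w z) as [_|N].
    + replace (l - l)%C with (RtoC 0) by ring. now rewrite Cmod_0.
    + assert (N' : (w - z)%C <> 0%C) by now apply Cminus_eq_contra.
      assert (P' : 0 < Cmod (w - z)) by now apply Cmod_gt_0.
      replace ((f w - f z) / (w - z) - l)%C with ((f w - f z - l * (w - z)) / (w - z))%C by (field; auto).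
      rewrite Cmod_div by auto. apply Rle_lt_trans with (e / 2); [|lra].
      apply Rle_div_l; auto.
  - destruct (Ceq_dec z z); tauto.
  - intros w. destruct (Ceq_dec w z) as [->|N]; [ring|]. field. now apply Cminus_eq_contra.
Qed.

Lemma Cmod_parts_le (a b : R) : Cmod (a, b) <= Rabs a + Rabs b.
Proof.
  replace ((a, b) : C) with (RtoC a + Ci * RtoC b)%C by (apply C_ext; simpl; ring).
  eapply Rle_trans; [apply Cmod_triangle|]. rewrite Cmod_mult, !Cmod_R.
  rewrite Cmod_Ci. lra.
Qed.

Lemma im_le_Cmod (c : C) : Rabs (Im c) <= Cmod c.
Proof. eapply Rle_trans; [|apply Rmax_Cmod]. apply Rmax_r. Qed.

(** Go from [z] to [w] along a vertical and then a horizontal segment and apply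
    the mean value theorem on each. *)
Lemma partials_eps (u ua ub : C -> R) (z : C) (e : R) : 0 < e ->
  locally z (fun w => is_derive (fun t => u (t, Im w)) (Re w) (ua w) /\
                      is_derive (fun t => u (Re w, t)) (Im w) (ub w)) ->
  continuous ua z -> continuous ub z ->
  locally z (fun w => Rabs (u w - u z - (ua z * Re (w - z) + ub z * Im (w - z))) <= 2 * e * Cmod (w - z)).
Proof.
  intros He H Ca Cb.
  assert (La : locally z (fun w => Rabs (ua w - ua z) < e)).
  { apply (Ca (fun r => Rabs (r - ua z) < e)). exists (mkposreal e He). intros y Hy. exact Hy. }
  assert (Lb : locally z (fun w => Rabs (ub w - ub z) < e)).
  { apply (Cb (fun r => Rabs (r - ub z) < e)). exists (mkposreal e He). intros y Hy. exact Hy. }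
  destruct (filter_and _ _ H (filter_and _ _ La Lb)) as [d Hd].
  exists d. intros [a' b'] Hw. destruct z as [a b].
  assert (Ha : Rabs (a' - a) < d) by exact (proj1 Hw).
  assert (Hb : Rabs (b' - b) < d) by exact (proj2 Hw).
  assert (InB : forall x y, Rmin a a' <= x <= Rmax a a' -> Rmin b b' <= y <= Rmax b b' ->
             ball ((a, b) : C) d ((x, y) : C)).
  { assert (BB : forall p p' x, Rmin p p' <= x <= Rmax p p' -> Rabs (p' - p) < d -> Rabs (x - p) < d).
    { intros p p' x. unfold Rmin, Rmax. destruct (Rle_dec p p'); intros Hx Hp;
      apply Rabs_def2 in Hp; apply Rabs_def1; lra. }
    intros x y Hx Hy. split; simpl.
    - exact (BB a a' x Hx Ha).
    - exact (BB b b' y Hy Hb). }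
  assert (Rab : forall p p', Rmin p p' <= p <= Rmax p p' /\ Rmin p p' <= p' <= Rmax p p').
  { intros p p'. unfold Rmin, Rmax. destruct (Rle_dec p p'); lra. }
  destruct (MVT_gen (fun t => u (t, b')) a a' (fun t => ua (t, b'))) as [x [Hx Ex]].
  { intros x Hx. apply (Hd (x, b')). apply InB; [lra|apply Rab]. }
  { intros x Hx. apply (proj2 (continuity_pt_filterlim _ _)).
    apply (ex_derive_continuous (K:=R_AbsRing) (V:=R_NormedModule)). eexists.
    apply (Hd (x, b')). apply InB; [lra|apply Rab]. }
  destruct (MVT_gen (fun t => u (a, t)) b b' (fun t => ub (a, t))) as [y [Hy Ey]].
  { intros y Hy. apply (Hd (a, y)). apply InB; [apply Rab|lra]. }
  { intros y Hy. apply (proj2 (continuity_pt_filterlim _ _)).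
    apply (ex_derive_continuous (K:=R_AbsRing) (V:=R_NormedModule)). eexists.
    apply (Hd (a, y)). apply InB; [apply Rab|lra]. }
  assert (Ux : Rabs (ua (x, b') - ua (a, b)) < e) by (apply (Hd (x, b')); apply InB; [lra|apply Rab]).
  assert (Uy : Rabs (ub (a, y) - ub (a, b)) < e) by (apply (Hd (a, y)); apply InB; [apply Rab|lra]).
  simpl. 
  replace (u (a', b') - u (a, b) - (ua (a, b) * (a' + - a) + ub (a, b) * (b' + - b)))
    with ((ua (x, b') - ua (a, b)) * (a' - a) + (ub (a, y) - ub (a, b)) * (b' - b)) by lra.
  assert (M1 := re_le_Cmod ((a', b') - (a, b))%C). assert (M2 := im_le_Cmod ((a', b') - (a, b))%C).
  simpl in M1, M2. fold (a' - a) in M1. fold (b' - b) in M2.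
  eapply Rle_trans; [apply Rabs_triang|]. rewrite !Rabs_mult.
  set (m := Cmod _) in *. clearbody m.
  assert (P1 := Rabs_pos (a' - a)). assert (P2 := Rabs_pos (b' - b)).
  assert (Rabs (ua (x, b') - ua (a, b)) * Rabs (a' - a) <= e * m).
  { apply Rmult_le_compat; auto using Rabs_pos; lra. }
  assert (Rabs (ub (a, y) - ub (a, b)) * Rabs (b' - b) <= e * m).
  { apply Rmult_le_compat; auto using Rabs_pos; lra. }
  lra.
Qed.

Lemma hol_of_partials (u v ua ub va vb : C -> R) (z : C) :
  locally z (fun w => is_derive (fun t => u (t, Im w)) (Re w) (ua w) /\
                      is_derive (fun t => u (Re w, t)) (Im w) (ub w) /\
                      is_derive (fun t => v (t, Im w)) (Re w) (va w) /\
                      is_derive (fun t => v (Re w, t)) (Im w) (vb w) /\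
                      continuous ua w /\ continuous ub w /\ continuous va w /\ continuous vb w /\
                      ua w = vb w /\ ub w = - va w) ->
  hol (fun w => (u w, v w)) z.
Proof.
  intros H. apply hol_intro with (fun w => (ua w, va w) : C).
  2:{ apply locally_singleton in H. apply continuous_of_parts; simpl; tauto. }
  apply locally_locally in H. revert H. apply filter_imp. clear z. overC. intros z H.
  apply cderiv_eps. intros e He.
  destruct (locally_singleton _ _ H) as [_ [_ [_ [_ [Ca [Cb [Cva [Cvb [E1 E2]]]]]]]]].
  assert (U := partials_eps u ua ub z (e / 4) ltac:(lra)).
  assert (V := partials_eps v va vb z (e / 4) ltac:(lra)).
  assert (U' := U (filter_imp _ _ (fun w K => conj (proj1 K) (proj1 (proj2 K))) H) Ca Cb).
  assert (V' := V (filter_imp _ _ (fun w K => conj (proj1 (proj2 (proj2 K))) (proj1 (proj2 (proj2 (proj2 K))))) H) Cva Cvb).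
  generalize (filter_and _ _ U' V'). apply filter_imp. overC. intros w [Ku Kv].
  replace ((u w, v w) - (u z, v z) - (ua z, va z) * (w - z))%C with
    ((u w - u z - (ua z * Re (w - z) + ub z * Im (w - z)),
      v w - v z - (va z * Re (w - z) + vb z * Im (w - z))) : C).
  2:{ rewrite E2, <- E1. apply C_ext; simpl; ring. }
  eapply Rle_trans; [apply Cmod_parts_le|]. lra.
Qed.

(** * The stem domain and the identity principle *)

Lemma stem_domain_slice Omega J z : circular Omega -> imag_unit J ->
  stem_domain Omega z <-> Omega (slice_point J (Re z) (Im z)).
Proof.
  intros Hc HJ. split.
  - intros [J' [HJ' HO]]. now apply (circular_slice Omega J').
  - intros HO. now exists J.
Qed.

Lemma stem_domain_conj Omega z : stem_domain Omega z -> stem_domain Omega (Cconj z).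
Proof.
  intros [J [HJ HO]]. exists (- J)%quat. split; [now apply imag_unit_opp|].
  rewrite slice_point_opp. simpl. now rewrite Ropp_involutive.
Qed.

Lemma continuous_slice_point J (z : C) : continuous (fun w : C => slice_point J (Re w) (Im w)) z.
Proof.
  apply (continuous_ext (fun w : C => mkq (Re w - q_re J * 0 + q_re J * Im w)
     (q_i J * Im w) (q_j J * Im w) (q_k J * Im w))).
  { intros w. qring. }
  assert (A := continuous_Re_part (fun w : C => w) z (continuous_id z)).
  assert (B := continuous_Im_part (fun w : C => w) z (continuous_id z)).
  apply continuous_mkq.
  - apply (continuous_Rplus (fun w : C => Re w - q_re J * 0)).
    + apply (continuous_Rminus (fun w : C => Re w)); [exact A|apply continuous_const].
    + apply (continuous_Rmult (fun _ : C => q_re J)); [apply continuous_const|exact B].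
  - apply (continuous_Rmult (fun _ : C => q_i J)); [apply continuous_const|exact B].
  - apply (continuous_Rmult (fun _ : C => q_j J)); [apply continuous_const|exact B].
  - apply (continuous_Rmult (fun _ : C => q_k J)); [apply continuous_const|exact B].
Qed.

Lemma stem_domain_open Omega z : open Omega -> stem_domain Omega z -> locally z (stem_domain Omega).
Proof.
  intros Ho [J [HJ HO]].
  generalize (continuous_slice_point J z Omega (Ho _ HO)). unfold filtermap.
  apply filter_imp. intros w Hw. now exists J.
Qed.

(** The point of the closed upper half-plane that represents the sphere of
    [q]. *)
Definition profile (q : quat) : C := (q_re q, qnorm (qvec q)).

Lemma continuous_profile (q : quat) : continuous profile q.
Proof.
  destruct (continuous_quat_coords (fun q : quat => q) q (continuous_id q)) as [H0 [H1 [H2 H3]]].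
  apply continuous_of_parts; simpl; [exact H0|].
  unfold qnorm, qvec.
  apply (continuous_comp (fun y : quat => 0 ^ 2 + q_i y ^ 2 + q_j y ^ 2 + q_k y ^ 2) sqrt).
  - exact (continuous_Rplus _ _ q (continuous_Rplus _ _ q (continuous_Rplus _ _ q
      (continuous_const (0 ^ 2) q) (continuous_Rsqr _ q H1)) (continuous_Rsqr _ q H2)) (continuous_Rsqr _ q H3)).
  - apply (proj1 (continuity_pt_filterlim _ _)). apply continuity_pt_sqrt. nra.
Qed.

Lemma profile_slice J a b : imag_unit J -> 0 <= b -> profile (slice_point J a b) = (a, b).
Proof.
  intros HJ Hb. unfold profile. rewrite slice_point_re, slice_point_vec_norm by auto.
  now rewrite Rabs_pos_eq.
Qed.

Lemma profile_domain Omega q : Omega q -> stem_domain Omega (profile q).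
Proof.
  intros HO. destruct (slice_decomp q) as [J [b [HJ [Hb E]]]]. exists J. split; auto.
  rewrite E in HO |- *. rewrite profile_slice by auto. exact HO.
Qed.

Definition locally_constant_on (D P : C -> Prop) : Prop :=
  forall z, D z -> (P z -> locally z P) /\ (~ P z -> locally z (fun w => ~ P w)).

(** [profile] is continuous and maps the domain onto the upper half of the stem
    domain, so that a partition of the latter into open sets pulls back. *)
Lemma connected_upper Omega P : slice_domain Omega -> circular Omega ->
  locally_constant_on (stem_domain Omega) P ->
  forall z w, stem_domain Omega z -> stem_domain Omega w -> 0 <= Im z -> 0 <= Im w -> P z -> P w.
Proof.
  intros [[_ [Hconn Hopen]] _] Hc HP z w Dz Dw Iz Iw Pz. apply NNPP. intros Nw.
  assert (Hopen2 : forall Q : C -> Prop, (forall z, stem_domain Omega z -> Q z -> locally z Q) ->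
            open (fun q => Omega q /\ Q (profile q))).
  { intros Q HQ q [HO Hq]. apply filter_and; [now apply Hopen|].
    apply (continuous_profile q Q). apply HQ; auto. now apply profile_domain. }
  destruct (Hconn (fun q => Omega q /\ P (profile q)) (fun q => Omega q /\ ~ P (profile q)))
    as [q [_ [[_ A] [_ B]]]].
  - apply Hopen2. intros v Dv. apply (HP v Dv).
  - apply (Hopen2 (fun v => ~ P v)). intros v Dv. apply (HP v Dv).
  - intros q HO. destruct (classic (P (profile q))); tauto.
  - apply (stem_domain_slice Omega qi z Hc imag_unit_qi) in Dz.
    exists (slice_point qi (Re z) (Im z)). split; auto. split; auto.
    rewrite profile_slice, C_eta by auto using imag_unit_qi. exact Pz.
  - apply (stem_domain_slice Omega qi w Hc imag_unit_qi) in Dw.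
    exists (slice_point qi (Re w) (Im w)). split; auto. split; auto.
    rewrite profile_slice, C_eta by auto using imag_unit_qi. exact Nw.
  - exact (B A).
Qed.

Lemma continuous_Cconj (z : C) : continuous Cconj z.
Proof.
  apply continuous_of_parts; simpl.
  - apply (continuous_Re_part (fun w : C => w)), continuous_id.
  - apply (continuous_Ropp (fun w : C => Im w)). apply (continuous_Im_part (fun w : C => w)), continuous_id.
Qed.

(** The upper half and its mirror image share the real points, and there are real
    points because the domain is a slice domain. *)
Lemma connected_stem_domain Omega P : slice_domain Omega -> circular Omega ->
  locally_constant_on (stem_domain Omega) P ->
  forall z w, stem_domain Omega z -> stem_domain Omega w -> P z -> P w.
Proof.
  intros Hs Hc HP z w Dz Dw Pz.
  destruct (proj2 Hs) as [q [HO [x Hx]]].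
  set (x0 := (x, 0) : C).
  assert (D0 : stem_domain Omega x0).
  { apply (stem_domain_slice Omega qi x0 Hc imag_unit_qi).
    replace (slice_point qi (Re x0) (Im x0)) with q; auto. rewrite Hx. simpl. qring. }
  assert (HP' : locally_constant_on (stem_domain Omega) (fun v => P (Cconj v))).
  { intros v Dv. apply stem_domain_conj in Dv. destruct (HP _ Dv) as [A B]. split; intros H.
    - exact (continuous_Cconj v _ (A H)).
    - exact (continuous_Cconj v _ (B H)). }
  assert (E0 : Cconj x0 = x0) by (apply C_ext; simpl; ring).
  assert (P0 : P x0).
  { destruct (Rle_dec 0 (Im z)) as [Iz|Iz].
    - apply (connected_upper Omega P Hs Hc HP z x0); auto. simpl; lra.
    - rewrite <- E0. apply (connected_upper Omega _ Hs Hc HP' (Cconj z) x0); auto.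
      + now apply stem_domain_conj.
      + rewrite im_conj. lra.
      + simpl; lra.
      + now rewrite Cconj_conj. }
  destruct (Rle_dec 0 (Im w)) as [Iw|Iw].
  - apply (connected_upper Omega P Hs Hc HP x0 w); auto. simpl; lra.
  - rewrite <- (Cconj_conj w). apply (connected_upper Omega _ Hs Hc HP' x0 (Cconj w)); auto.
    + now apply stem_domain_conj.
    + simpl; lra.
    + rewrite im_conj. lra.
    + now rewrite E0.
Qed.

(** Vanishing near a point is an open condition.  It is also closed in the domain:
    if it held at points [w] arbitrarily near [z], a disk around one of them would lie in
    the domain and contain [z]. *)
Lemma identity_principle Omega f z : slice_domain Omega -> circular Omega ->
  (forall w, stem_domain Omega w -> hol f w) -> stem_domain Omega z ->
  locally z (fun w => f w = 0%C) -> forall w, stem_domain Omega w -> f w = 0%C.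
Proof.
  intros Hs Hc Hf Dz Hz w Dw.
  apply (locally_singleton w (fun v => f v = 0%C)).
  apply (connected_stem_domain Omega (fun v => locally v (fun u => f u = 0%C)) Hs Hc) with z; auto.
  clear z Dz Hz w Dw. intros z Dz. split.
  - apply locally_locally.
  - intros N. destruct (proj1 (locally_disk _ _) (stem_domain_open Omega z (proj2 (proj2 (proj1 Hs))) Dz))
      as [r [Hr Hd]].
    apply locally_disk. exists (r / 3). split; [lra|]. intros w Hw Lw. apply N.
    unfold disk in Hw.
    assert (Sub : forall v, disk w (2 * r / 3) v -> disk z r v).
    { intros v Hv. unfold disk in *. assert (T := Cmod_triangle (v - w) (w - z)).
      replace (v - w + (w - z))%C with (v - z)%C in T by ring. lra. }
    assert (Z : forall v, disk w (2 * r / 3) v -> f v = 0%C).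
    { apply hol_zero_disk; auto. }
    apply filter_imp with (disk w (2 * r / 3)); [exact Z|].
    apply disk_open. unfold disk. rewrite <- Cmod_opp.
    replace (- (z - w))%C with (w - z)%C by ring. lra.
Qed.

(** * Stems of slice regular functions *)

Definition hol_cquat (X : C -> cquat) (z : C) : Prop :=
  hol (fun w => c0 (X w)) z /\ hol (fun w => c1 (X w)) z /\
  hol (fun w => c2 (X w)) z /\ hol (fun w => c3 (X w)) z.

Definition cq_conj (X : cquat) : cquat :=
  CQ (Cconj (c0 X)) (Cconj (c1 X)) (Cconj (c2 X)) (Cconj (c3 X)).

Definition regular_stem (D : C -> Prop) (X : C -> cquat) : Prop :=
  (forall z, D z -> hol_cquat X z) /\ (forall z, D z -> X (Cconj z) = cq_conj (X z)).

Lemma quat_eq_coords (p q : quat) : p = q ->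
  q_re p = q_re q /\ q_i p = q_i q /\ q_j p = q_j q /\ q_k p = q_k q.
Proof. now intros ->. Qed.

(** The [C^1] condition and the Cauchy-Riemann equations provide their own
    partial derivatives; uniqueness of derivatives identifies them. *)
Lemma regular_stem_of_holomorphic (D : C -> Prop) F0 F1 : (forall z, D z -> locally z D) ->
  holomorphic_stem D F0 F1 -> regular_stem D (stem F0 F1).
Proof.
  intros HD [[A0 [B0 H0]] [[A1 [B1 H1]] [S0 [S1 HCR]]]]. split.
  - intros z Dz.
    assert (CR : forall w, D w -> A0 w = B1 w /\ B0 w = (- A1 w)%quat).
    { intros w Dw. destruct (H0 w Dw) as [a0 [b0 _]]. destruct (H1 w Dw) as [a1 [b1 _]].
      destruct (HCR w Dw) as [l [m [La [Lb [Ma Mb]]]]].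
      assert (U : forall (f : R -> quat) t l l', is_derive f t l -> is_derive f t l' -> l = l').
      { intros f t l1 l2 K1 K2. 
        apply is_derive_quat_coords in K1, K2.
        destruct K1 as [K1a [K1b [K1c K1d]]], K2 as [K2a [K2b [K2c K2d]]].
        apply is_derive_unique in K1a, K1b, K1c, K1d, K2a, K2b, K2c, K2d.
        apply quat_ext; congruence. }
      split.
      - rewrite (U _ _ _ _ a0 La). symmetry. exact (U _ _ _ _ b1 Lb).
      - rewrite (U _ _ _ _ b0 Ma), (U _ _ _ _ a1 Mb). qring. }
    assert (K : forall w, D w -> forall pr : quat -> R,
      (forall (f : R -> quat) t l, is_derive f t l -> is_derive (fun u => pr (f u)) t (pr l)) ->
      (forall (f : C -> quat) z, continuous f z -> continuous (fun u => pr (f u)) z) ->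
      (forall q, pr (- q)%quat = - pr q) ->
      hol (fun w => (pr (F0 w), pr (F1 w))) w).
    { intros w Dw pr Hd Hcont Hopp.
      apply (hol_of_partials (fun w => pr (F0 w)) (fun w => pr (F1 w)) (fun w => pr (A0 w))
          (fun w => pr (B0 w)) (fun w => pr (A1 w)) (fun w => pr (B1 w))).
      generalize (HD w Dw). apply filter_imp. clear w Dw. intros w Dw.
      destruct (H0 w Dw) as [a0 [b0 [ca0 cb0]]]. destruct (H1 w Dw) as [a1 [b1 [ca1 cb1]]].
      destruct (CR w Dw) as [E1 E2].
      repeat match goal with |- _ /\ _ => split end.
      - exact (Hd _ _ _ a0). - exact (Hd _ _ _ b0). - exact (Hd _ _ _ a1). - exact (Hd _ _ _ b1).
      - now apply Hcont. - now apply Hcont. - now apply Hcont. - now apply Hcont.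
      - now rewrite E1.
      - now rewrite E2, Hopp. }
    repeat match goal with |- _ /\ _ => split | |- hol_cquat _ _ => split end.
    + exact (K z Dz q_re (fun f t l H => (proj1 (is_derive_quat_coords f t l H)))
        (fun f w H => (proj1 (continuous_quat_coords f w H))) (fun q => eq_refl)).
    + exact (K z Dz q_i (fun f t l H => (proj1 (proj2 (is_derive_quat_coords f t l H))))
        (fun f w H => (proj1 (proj2 (continuous_quat_coords f w H)))) (fun q => eq_refl)).
    + exact (K z Dz q_j (fun f t l H => (proj1 (proj2 (proj2 (is_derive_quat_coords f t l H)))))
        (fun f w H => (proj1 (proj2 (proj2 (continuous_quat_coords f w H))))) (fun q => eq_refl)).
    + exact (K z Dz q_k (fun f t l H => (proj2 (proj2 (proj2 (is_derive_quat_coords f t l H)))))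
        (fun f w H => (proj2 (proj2 (proj2 (continuous_quat_coords f w H))))) (fun q => eq_refl)).
  - intros z Dz. unfold stem, cq_conj. simpl. rewrite S0, S1 by auto. reflexivity.
Qed.

Lemma rderiv_row f z : hol f z -> 
  rderiv (fun t => f (t, Im z)) (Re z) (Cder f z) /\
  rderiv (fun t => f (Re z, t)) (Im z) (Ci * Cder f z)%C.
Proof.
  intros H. apply hol_cderiv in H. rewrite <- (C_eta z) in H at 1. split.
  - eapply rderiv_eq; [apply (rderiv_comp f (fun t => (t, Im z) : C)); [exact H|apply rderiv_horizontal]|ring].
  - eapply rderiv_eq; [apply (rderiv_comp f (fun t => (Re z, t) : C)); [exact H|apply rderiv_vertical]|ring].
Qed.

Lemma holomorphic_of_regular_stem (D : C -> Prop) X : regular_stem D X ->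
  holomorphic_stem D (fun z => cq_re (X z)) (fun z => cq_im (X z)).
Proof.
  intros [HX HS].
  set (DX := fun z => CQ (Cder (fun w => c0 (X w)) z) (Cder (fun w => c1 (X w)) z)
                (Cder (fun w => c2 (X w)) z) (Cder (fun w => c3 (X w)) z)).
  assert (Dal : forall z, D z -> is_dalpha (fun z => cq_re (X z)) z (cq_re (DX z)) /\
      is_dalpha (fun z => cq_im (X z)) z (cq_im (DX z)) /\
      is_dbeta (fun z => cq_re (X z)) z (- cq_im (DX z))%quat /\
      is_dbeta (fun z => cq_im (X z)) z (cq_re (DX z))).
  { intros z Dz. destruct (HX z Dz) as [K0 [K1 [K2 K3]]].
    destruct (rderiv_row _ _ K0) as [[a0 b0] [d0 e0]].
    destruct (rderiv_row _ _ K1) as [[a1 b1] [d1 e1]].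
    destruct (rderiv_row _ _ K2) as [[a2 b2] [d2 e2]].
    destruct (rderiv_row _ _ K3) as [[a3 b3] [d3 e3]].
    assert (RI : forall w, Re (Ci * w) = - Im w) by (intros; unfold Re, Im; simpl; ring).
    assert (II : forall w, Im (Ci * w) = Re w) by (intros; unfold Re, Im; simpl; ring).
    rewrite RI in d0, d1, d2, d3. rewrite II in e0, e1, e2, e3.
    split; [|split; [|split]].
    - apply is_derive_mkq; assumption.
    - apply is_derive_mkq; assumption.
    - replace (- cq_im (DX z))%quat with
        (mkq (- Im (c0 (DX z))) (- Im (c1 (DX z))) (- Im (c2 (DX z))) (- Im (c3 (DX z)))) by (unfold cq_im; qring).
      apply is_derive_mkq; assumption.
    - apply is_derive_mkq; assumption. }
  assert (Cre : forall z, D z -> continuous (fun z => cq_re (DX z)) z).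
  { intros z Dz. destruct (HX z Dz) as [[_ K0] [[_ K1] [[_ K2] [_ K3]]]].
    apply continuous_mkq; apply continuous_Re_part; assumption. }
  assert (Cim : forall z, D z -> continuous (fun z => cq_im (DX z)) z).
  { intros z Dz. destruct (HX z Dz) as [[_ K0] [[_ K1] [[_ K2] [_ K3]]]].
    apply continuous_mkq; apply continuous_Im_part; assumption. }
  assert (Cimo : forall z, D z -> continuous (fun z => - cq_im (DX z))%quat z).
  { intros z Dz. destruct (HX z Dz) as [[_ K0] [[_ K1] [[_ K2] [_ K3]]]].
    apply (continuous_ext (fun z => mkq (- Im (c0 (DX z))) (- Im (c1 (DX z))) (- Im (c2 (DX z))) (- Im (c3 (DX z))))).
    { intros w. unfold cq_im. qring. }
    apply continuous_mkq; apply continuous_Ropp; apply continuous_Im_part; assumption. }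
  split; [|split; [|split; [|split]]].
  - exists (fun z => cq_re (DX z)), (fun z => - cq_im (DX z))%quat. intros z Dz.
    destruct (Dal z Dz) as [P1 [P2 [P3 P4]]]. auto.
  - exists (fun z => cq_im (DX z)), (fun z => cq_re (DX z))%quat. intros z Dz.
    destruct (Dal z Dz) as [P1 [P2 [P3 P4]]]. auto.
  - intros z Dz. rewrite HS by auto. reflexivity.
  - intros z Dz. rewrite HS by auto. apply quat_ext; reflexivity.
  - intros z Dz. destruct (Dal z Dz) as [P1 [P2 [P3 P4]]].
    exists (cq_re (DX z)), (- cq_im (DX z))%quat. 
    split; [exact P1|]. split; [exact P4|]. split; [exact P3|].
    replace (- - cq_im (DX z))%quat with (cq_im (DX z)) by qring. exact P2.
Qed.

Lemma induces_unique Omega X Y f z : circular Omega -> stem_domain Omega z ->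
  induces Omega X f -> induces Omega Y f -> X z = Y z.
Proof.
  intros Hc Dz HX HY. destruct z as [a b].
  assert (E : forall J, imag_unit J -> slice_eval J (X (a, b)) = slice_eval J (Y (a, b))).
  { intros J HJ. assert (HO := proj1 (stem_domain_slice Omega J (a, b) Hc HJ) Dz).
    now rewrite <- (HX J a b HJ HO), <- (HY J a b HJ HO). }
  apply (slice_eval_inj _ _ qi imag_unit_qi); apply E; auto using imag_unit_qi, imag_unit_opp.
Qed.

Definition cq_scalar (d : C) : cquat := CQ d 0 0 0.

(** The values at [J] and [- J] both lie in the plane of [J], hence so do the two
    components of the stem.  Only the reals lie in the planes of both [i] and [j]. *)
Lemma slice_preserving_stem Omega f X : circular Omega ->
  induces Omega X f -> slice_preserving Omega f ->
  forall z, stem_domain Omega z -> X z = cq_scalar (c0 (X z)).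
Proof.
  intros Hc HX [_ Hf] [a b] Dz.
  assert (K : forall J, imag_unit J -> exists x y x' y',
     cq_re (X (a, b)) = (qreal x + J * qreal y)%quat /\ cq_im (X (a, b)) = (qreal x' + J * qreal y')%quat).
  { intros J HJ. assert (HJ' := imag_unit_opp J HJ).
    assert (O1 := proj1 (stem_domain_slice Omega J (a, b) Hc HJ) Dz).
    assert (O2 := proj1 (stem_domain_slice Omega _ (a, b) Hc HJ') Dz). simpl in O1, O2.
    destruct (Hf J HJ _ O1) as [x [y E1]]; [now exists a, b|].
    destruct (Hf _ HJ' _ O2) as [x' [y' E2]]; [now exists a, b|].
    rewrite (HX _ _ _ HJ O1) in E1. rewrite (HX _ _ _ HJ' O2) in E2.
    exists ((x + x') / 2), ((y - y') / 2), ((y + y') / 2), (- ((x - x') / 2)).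
    assert (JJ : (J * J)%quat = qreal (-1)) by exact HJ.
    apply (two_slices _ _ _ _ J HJ).
    - unfold slice_eval in E1. rewrite E1. unfold slice_point.
      transitivity (qreal ((x + x') / 2) + J * qreal ((y - y') / 2) + J * qreal ((y + y') / 2) +
                     (J * J) * qreal (- ((x - x') / 2)))%quat; [|qring].
      rewrite JJ. apply quat_ext; qcoord; field.
    - unfold slice_eval in E2. rewrite E2. unfold slice_point.
      transitivity (qreal ((x + x') / 2) + J * qreal ((y - y') / 2) - J * qreal ((y + y') / 2) -
                     (J * J) * qreal (- ((x - x') / 2)))%quat; [|qring].
      rewrite JJ. apply quat_ext; qcoord; field. }
  assert (Hqj : imag_unit qj) by (apply imag_unit_coords; qcoord; split; ring).
  destruct (K qi imag_unit_qi) as [x1 [y1 [x1' [y1' [A1 B1]]]]].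
  destruct (K qj Hqj) as [x2 [y2 [x2' [y2' [A2 B2]]]]].
  apply quat_eq_coords in A1, B1, A2, B2. revert A1 B1 A2 B2. unfold cq_re, cq_im. qcoord.
  intros A1 B1 A2 B2. unfold cq_scalar.
  apply cquat_ext; [reflexivity|..]; apply C_ext; cbn [c1 c2 c3]; simpl Re; simpl Im; unfold Re, Im in *; simpl; lra.
Qed.

Definition cq_vec (X : cquat) : cquat := CQ 0 (c1 X) (c2 X) (c3 X).

Lemma slice_eval_add_basis J p0 p1 p2 p3 :
  slice_eval J (CQ p0 p1 p2 p3) =
  (slice_eval J (cq_scalar p0) + slice_eval J (cq_scalar p1) * qi + slice_eval J (cq_scalar p2) * qj + slice_eval J (cq_scalar p3) * qk)%quat.
Proof.
  unfold slice_eval, cq_scalar, cq_re, cq_im. apply quat_ext; qcoord; simpl; ring.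
Qed.

Lemma slice_regular_stem Omega f : open Omega -> slice_regular Omega f ->
  exists X, regular_stem (stem_domain Omega) X /\ induces Omega X f.
Proof.
  intros Ho [F0 [F1 [HF HI]]]. exists (stem F0 F1). split.
  - apply regular_stem_of_holomorphic; auto. intros z Dz. now apply stem_domain_open.
  - now apply induced_induces.
Qed.

(** The decomposition on the basis [1, i, j, k] has stems with complex scalar
    values, which by uniqueness are the coordinates of [X]; subtracting [f0] removes the
    scalar one. *)
Lemma vector_part_induces Omega f fv X : open Omega -> circular Omega ->
  induces Omega X f -> vector_part Omega f fv -> induces Omega (fun z => cq_vec (X z)) fv.
Proof.
  intros Ho Hc HX [f0 [f1 [f2 [f3 [P0 [P1 [P2 [P3 [Hf Hv]]]]]]]]].
  destruct (slice_regular_stem _ _ Ho (proj1 P0)) as [X0 [_ I0]].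
  destruct (slice_regular_stem _ _ Ho (proj1 P1)) as [X1 [_ I1]].
  destruct (slice_regular_stem _ _ Ho (proj1 P2)) as [X2 [_ I2]].
  destruct (slice_regular_stem _ _ Ho (proj1 P3)) as [X3 [_ I3]].
  assert (S0 := slice_preserving_stem Omega f0 X0 Hc I0 P0).
  assert (S1 := slice_preserving_stem Omega f1 X1 Hc I1 P1).
  assert (S2 := slice_preserving_stem Omega f2 X2 Hc I2 P2).
  assert (S3 := slice_preserving_stem Omega f3 X3 Hc I3 P3).
  assert (HE : induces Omega (fun z => CQ (c0 (X0 z)) (c0 (X1 z)) (c0 (X2 z)) (c0 (X3 z))) f).
  { intros J a b HJ HO. assert (Dz := proj2 (stem_domain_slice Omega J (a, b) Hc HJ) HO).
    rewrite slice_eval_add_basis, <- S0, <- S1, <- S2, <- S3 by auto. rewrite (Hf _ HO).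
    now rewrite (I0 J a b HJ HO), (I1 J a b HJ HO), (I2 J a b HJ HO), (I3 J a b HJ HO). }
  intros J a b HJ HO. assert (Dz := proj2 (stem_domain_slice Omega J (a, b) Hc HJ) HO).
  rewrite (Hv _ HO), (HX J a b HJ HO), (I0 J a b HJ HO), (S0 _ Dz).
  rewrite (induces_unique Omega X _ f (a, b) Hc Dz HX HE).
  unfold slice_eval, cq_scalar, cq_vec, cq_re, cq_im. apply quat_ext; qcoord; simpl; ring.
Qed.

(** The stem of [Delta p]; its zeros are the two points that represent the sphere
    of [p]. *)
Definition delta (p : quat) (z : C) : C := ((z - profile p) * (z - Cconj (profile p)))%C.

Lemma Delta_induces Omega p : circular Omega -> induces Omega (fun z => cq_scalar (delta p z)) (Delta p).
Proof.
  intros Hc J a b HJ HO. 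
  assert (N : qnorm p ^ 2 = q_re p ^ 2 + qnorm (qvec p) ^ 2).
  { rewrite !qnorm_sq. unfold qvec. qcoord. ring. }
  assert (JJ : (J * J)%quat = qreal (-1)) by exact HJ.
  unfold Delta, slice_point.
  transitivity ((qreal (a * a - 2 * a * q_re p + qnorm p ^ 2) + J * qreal (2 * a * b - 2 * b * q_re p)
                + (J * J) * qreal (b * b))%quat); [qring|].
  rewrite JJ, N. unfold slice_eval, cq_scalar, delta, profile, cq_re, cq_im. apply quat_ext; qcoord; simpl; ring.
Qed.

Definition cq_scale (d : C) (X : cquat) : cquat := CQ (d * c0 X) (d * c1 X) (d * c2 X) (d * c3 X).

Lemma slice_eval_scalar_mul J d X : imag_unit J -> (slice_eval J (cq_scalar d) * slice_eval J X)%quat = slice_eval J (cq_scale d X).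
Proof.
  intros HJ. assert (JJ : (J * J)%quat = qreal (-1)) by exact HJ.
  unfold slice_eval. 
  replace (cq_re (cq_scalar d)) with (qreal (Re d)) by (apply quat_ext; reflexivity).
  replace (cq_im (cq_scalar d)) with (qreal (Im d)) by (apply quat_ext; reflexivity).
  transitivity (qscal (Re d) (cq_re X) + J * (qscal (Re d) (cq_im X) + qscal (Im d) (cq_re X)) +
     (J * J) * qscal (Im d) (cq_im X))%quat; [qring|].
  rewrite JJ. unfold cq_scale, cq_re, cq_im. apply quat_ext; qcoord; simpl; unfold Re, Im; ring.
Qed.

Lemma Delta_pow_mul_induces Omega p m g G : circular Omega -> induces Omega G g ->
  induces Omega (fun z => cq_scale (delta p z ^ m) (G z)) (fun q => qpow (Delta p q) m * g q)%quat.
Proof.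
  intros Hc HG J a b HJ HO. induction m as [|m IH].
  - simpl qpow. rewrite qmul_1_l, (HG J a b HJ HO). f_equal. unfold cq_scale.
    apply cquat_ext; cbn [c0 c1 c2 c3]; rewrite Cmult_1_l; reflexivity.
  - simpl qpow. rewrite <- qmul_assoc, IH, (Delta_induces Omega p Hc J a b HJ HO), slice_eval_scalar_mul by auto.
    f_equal. unfold cq_scale. cbn [c0 c1 c2 c3]. rewrite Cpow_S. f_equal; ring.
Qed.

(** A unit [J] such that [q] lies in the plane of [J] with a nonnegative
    coordinate; arbitrary for real [q]. *)
Definition qdir (q : quat) : quat :=
  if Req_EM_T (qnorm (qvec q)) 0 then qi else qscal (/ qnorm (qvec q)) (qvec q).

(** The symmetry of the stem makes the value independent of the unit: for [b < 0]
    the opposite unit is used at the conjugate point, and for [b = 0] the coefficient of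
    the unit vanishes. *)
Lemma regular_stem_realised Omega X : circular Omega -> regular_stem (stem_domain Omega) X ->
  exists f, slice_regular Omega f /\ induces Omega X f.
Proof.
  intros Hc HX. set (f := fun q => slice_eval (qdir q) (X (profile q))).
  assert (Hf : induces Omega X f).
  { intros J a b HJ HO. assert (Dz := proj2 (stem_domain_slice Omega J (a, b) Hc HJ) HO).
    assert (Conj : X (a, - b) = cq_conj (X (a, b))) by exact (proj2 HX _ Dz).
    unfold f, profile, qdir. rewrite slice_point_re, slice_point_vec_norm by auto.
    assert (V : qvec (slice_point J a b) = qscal b J).
    { destruct (proj1 (imag_unit_coords J) HJ) as [Z _]. unfold qvec.
      apply quat_ext; qcoord; rewrite ?Z; ring. }
    rewrite V. destruct (Req_EM_T (Rabs b) 0) as [B0|B0].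
    - assert (b = 0) by (destruct (Req_dec b 0); [auto|exfalso; now apply (Rabs_no_R0 b)]). subst b.
      rewrite Rabs_R0. rewrite Ropp_0 in Conj.
      assert (Z : cq_im (X (a, 0)) = qreal 0).
      { apply (f_equal cq_im) in Conj. apply quat_eq_coords in Conj. revert Conj.
        unfold cq_im, cq_conj. qcoord. cbn [c0 c1 c2 c3]. rewrite !im_conj.
        intros [K0 [K1 [K2 K3]]]. apply quat_ext; qcoord; lra. }
      unfold slice_eval. rewrite Z. qring.
    - destruct (Rle_dec 0 b) as [Pb|Nb].
      + rewrite Rabs_pos_eq in * by auto. f_equal. apply quat_ext; qcoord; field; auto.
      + rewrite Rabs_left in * by lra.
        replace (qscal (/ - b) (qscal b J)) with (- J)%quat.
        2:{ apply quat_ext; qcoord; field; lra. }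
        rewrite Conj. unfold slice_eval, cq_conj, cq_re, cq_im.
        apply quat_ext; qcoord; cbn [c0 c1 c2 c3]; rewrite ?re_conj, ?im_conj; ring. }
  exists f. split; auto.
  exists (fun z => cq_re (X z)), (fun z => cq_im (X z)). split.
  - now apply holomorphic_of_regular_stem.
  - exact Hf.
Qed.

(** * Dividing by Delta *)

Lemma hol_divide (D : C -> Prop) f z0 : (forall z, D z -> locally z D) ->
  (forall z, D z -> hol f z) -> D z0 -> f z0 = 0%C ->
  exists q, (forall z, D z -> hol q z) /\ (forall z, D z -> f z = ((z - z0) * q z)%C).
Proof.
  intros HD Hf D0 F0.
  destruct (hol_divide_local f z0) as [q0 [Hq Eq]]; auto.
  { generalize (HD z0 D0). apply filter_imp. exact Hf. }
  set (q := fun z => if Ceq_dec z z0 then q0 z0 else (f z / (z - z0))%C).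
  assert (Near : locally z0 (fun z => q0 z = q z)).
  { revert Eq. apply filter_imp. overC. intros z E. unfold q. destruct (Ceq_dec z z0) as [->|N]; auto.
    rewrite E. field. now apply Cminus_eq_contra. }
  exists q. split.
  - intros z Dz. destruct (Ceq_dec z z0) as [->|N].
    + apply (hol_ext_loc q0); auto. exact (locally_singleton _ _ Hq).
    + assert (Hn : hol (fun z => (z - z0)%C) z) by (apply hol_minus; [apply hol_id|apply hol_const]).
      apply (hol_ext_loc (fun z => f z / (z - z0))%C).
      * generalize (locally_neq0 _ _ (hol_continuous _ _ Hn) (Cminus_eq_contra _ _ N)).
        apply filter_imp. overC. intros w Hw. unfold q. destruct (Ceq_dec w z0) as [->|]; auto.
        exfalso. apply Hw. ring.
      * apply hol_mult; auto. apply hol_inv; auto. now apply Cminus_eq_contra.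
  - intros z Dz. unfold q. destruct (Ceq_dec z z0) as [->|N].
    + rewrite F0. ring.
    + field. now apply Cminus_eq_contra.
Qed.

Lemma delta_neq0 p z : z <> profile p -> z <> Cconj (profile p) -> delta p z <> 0%C.
Proof. intros A B. apply Cmult_neq_0; now apply Cminus_eq_contra. Qed.

Lemma delta_conj p z : delta p (Cconj z) = Cconj (delta p z).
Proof. unfold delta. rewrite Cmult_conj, !Cminus_conj, Cconj_conj. ring. Qed.

(** Divide at the zero and then at its conjugate, where the first quotient vanishes
    because [f] does.  The symmetry of the final quotient holds off the zeros of [delta],
    and at those by continuity. *)
Lemma hol_conj_divide (D : C -> Prop) f p : (forall z, D z -> locally z D) ->
  (forall z, D z -> D (Cconj z)) -> (forall z, D z -> hol f z) ->
  (forall z, D z -> f (Cconj z) = Cconj (f z)) -> D (profile p) -> Im (profile p) <> 0 ->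
  f (profile p) = 0%C ->
  exists q, (forall z, D z -> hol q z) /\ (forall z, D z -> q (Cconj z) = Cconj (q z)) /\
    (forall z, D z -> f z = (delta p z * q z)%C).
Proof.
  intros HD HDc Hf Hc Dp Np Fp. set (z0 := profile p) in *.
  destruct (hol_divide D f z0) as [q1 [H1 E1]]; auto.
  assert (Q0 : q1 (Cconj z0) = 0%C).
  { assert (E := E1 _ (HDc _ Dp)). rewrite Hc, Fp in E by auto.
    replace (Cconj 0) with (RtoC 0) in E by (apply C_ext; simpl; ring).
    apply NNPP. intros N. assert (N2 : (Cconj z0 - z0)%C <> 0%C).
    { intros K. apply (f_equal Im) in K. unfold Cminus in K. rewrite im_plus, im_opp, im_conj in K. change (Im (RtoC 0)) with 0 in K. lra. }
    exact (Cmult_neq_0 _ _ N2 N (eq_sym E)). }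
  destruct (hol_divide D q1 (Cconj z0)) as [q [H2 E2]]; auto.
  assert (Ed : forall z, D z -> f z = (delta p z * q z)%C).
  { intros z Dz. rewrite (E1 z Dz), (E2 z Dz). unfold delta. fold z0. ring. }
  exists q. split; [auto|]. split; [|auto].
  intros z Dz.
  apply (continuous_punctured_eq (fun w => q (Cconj w)) (fun w => Cconj (q w))).
  - apply (continuous_comp Cconj q); [apply continuous_Cconj|]. apply hol_continuous; auto.
  - apply (continuous_comp q Cconj); [apply hol_continuous; auto|apply continuous_Cconj].
  (* near [z] the only possible zero of [delta] is [z] itself *)
  - assert (L : forall c : C, locally z (fun w => w <> z -> w <> c)).
    { intros c. destruct (Ceq_dec z c) as [->|N]; [apply filter_forall; auto|].
      assert (Hn : hol (fun z => (z - c)%C) z) by (apply hol_minus; [apply hol_id|apply hol_const]).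
      generalize (locally_neq0 _ _ (hol_continuous _ _ Hn) (Cminus_eq_contra _ _ N)).
      apply filter_imp. overC. intros w Hw _ ->. apply Hw. ring. }
    generalize (filter_and _ _ (HD z Dz) (filter_and _ _ (L z0) (L (Cconj z0)))).
    apply filter_imp. overC. intros w [Dw [N1 N2]] Nw.
    assert (Nd : delta p w <> 0%C) by (apply delta_neq0; auto).
    assert (A := Ed _ (HDc _ Dw)). assert (B := f_equal Cconj (Ed _ Dw)).
    rewrite (Hc w Dw), B, Cmult_conj, delta_conj in A.
    assert (Nd' : Cconj (delta p w) <> 0%C).
    { intros K. apply Nd. rewrite <- (Cconj_conj (delta p w)), K. apply C_ext; simpl; ring. }
    replace (q (Cconj w)) with (/ Cconj (delta p w) * (Cconj (delta p w) * q (Cconj w)))%C by (field; auto).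
    rewrite <- A. field; auto.
Qed.

Lemma regular_stem_divide Omega X p : open Omega -> circular Omega ->
  regular_stem (stem_domain Omega) X -> Omega p -> Im (profile p) <> 0 -> X (profile p) = CQ 0 0 0 0 ->
  exists Y, regular_stem (stem_domain Omega) Y /\
    forall z, stem_domain Omega z -> X z = cq_scale (delta p z) (Y z).
Proof.
  intros Ho Hc [HX HS] Op Np X0.
  assert (HD : forall z, stem_domain Omega z -> locally z (stem_domain Omega)) by (intros; now apply stem_domain_open).
  assert (HDc := stem_domain_conj Omega).
  assert (Dp := profile_domain Omega p Op).
  destruct (hol_conj_divide _ (fun z => c0 (X z)) p HD HDc) as [q0 [A0 [B0 E0]]]; auto.
  { intros z Dz; apply (HX z Dz). } { intros z Dz. now rewrite (HS z Dz). } { now rewrite X0. }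
  destruct (hol_conj_divide _ (fun z => c1 (X z)) p HD HDc) as [q1 [A1 [B1 E1]]]; auto.
  { intros z Dz; apply (HX z Dz). } { intros z Dz. now rewrite (HS z Dz). } { now rewrite X0. }
  destruct (hol_conj_divide _ (fun z => c2 (X z)) p HD HDc) as [q2 [A2 [B2 E2]]]; auto.
  { intros z Dz; apply (HX z Dz). } { intros z Dz. now rewrite (HS z Dz). } { now rewrite X0. }
  destruct (hol_conj_divide _ (fun z => c3 (X z)) p HD HDc) as [q3 [A3 [B3 E3]]]; auto.
  { intros z Dz; apply (HX z Dz). } { intros z Dz. now rewrite (HS z Dz). } { now rewrite X0. }
  exists (fun z => CQ (q0 z) (q1 z) (q2 z) (q3 z)). split; [split|].
  - intros z Dz. exact (conj (A0 z Dz) (conj (A1 z Dz) (conj (A2 z Dz) (A3 z Dz)))).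
  - intros z Dz. unfold cq_conj. simpl. now rewrite B0, B1, B2, B3.
  - intros z Dz. unfold cq_scale. apply cquat_ext; simpl; auto.
Qed.

(** * Comparison of two star exponentials *)

(** The multiplicative norm of [H (x) C], which has zero divisors. *)
Definition cnorm4 (X : cquat) : C := (c0 X * c0 X + c1 X * c1 X + c2 X * c2 X + c3 X * c3 X)%C.

(** If [A + J B = 0], then in [H (x) C] the element is [(i - J) B], where [i] is
    the central unit, and [i - J] has norm [i^2 + 1 = 0]. *)
Lemma slice_eval_zero_norm J X : imag_unit J -> slice_eval J X = qreal 0 -> cnorm4 X = 0%C.
Proof.
  intros HJ E. destruct (proj1 (imag_unit_coords J) HJ) as [Z N].
  apply quat_eq_coords in E. revert E. unfold slice_eval. qcoord. rewrite Z. unfold cq_re, cq_im. qcoord.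
  destruct X as [[x0 y0] [x1 y1] [x2 y2] [x3 y3]]. cbn [c0 c1 c2 c3 Re Im fst snd].
  set (a := q_i J) in *. set (b := q_j J) in *. set (c := q_k J) in *.
  intros [E0 [E1 [E2 E3]]].
  assert (X0 : x0 = a * y1 + b * y2 + c * y3) by lra.
  assert (X1 : x1 = - (a * y0 + b * y3 - c * y2)) by lra.
  assert (X2 : x2 = - (- a * y3 + b * y0 + c * y1)) by lra.
  assert (X3 : x3 = - (a * y2 - b * y1 + c * y0)) by lra.
  clear E0 E1 E2 E3. clearbody a b c. subst x0 x1 x2 x3. unfold cnorm4; cbn [c0 c1 c2 c3].
  apply C_ext; simpl.
  - transitivity ((a ^ 2 + b ^ 2 + c ^ 2 - 1) * (y0 ^ 2 + y1 ^ 2 + y2 ^ 2 + y3 ^ 2)); [ring|].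
    rewrite N. ring.
  - ring.
Qed.

(** The norm of [cos s + (sin s / s) V] is [cos^2 s + sin^2 s]. *)
Lemma cq_exp_norm X s : (s * s)%C = vnorm X -> cnorm4 (cq_exp X s) = (cexp (c0 X) * cexp (c0 X))%C.
Proof.
  intros Hs. unfold cnorm4, cq_exp; cbn [c0 c1 c2 c3].
  transitivity (cexp (c0 X) * cexp (c0 X) * (ccos s * ccos s + vnorm X * (csinc s * csinc s)))%C.
  - unfold vnorm. ring.
  - rewrite <- Hs, cos2_sin2. ring.
Qed.

Lemma star_exp_eq_stems Omega f g X Y z s t : circular Omega -> stem_domain Omega z ->
  induces Omega X f -> induces Omega Y g ->
  (forall q, Omega q -> star_exp f q = star_exp g q) ->
  (s * s)%C = vnorm (X z) -> (t * t)%C = vnorm (Y z) -> cq_exp (X z) s = cq_exp (Y z) t.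
Proof.
  intros Hc Dz HX HY E Hs Ht. destruct z as [a b].
  assert (K : forall J, imag_unit J -> slice_eval J (cq_exp (X (a, b)) s) = slice_eval J (cq_exp (Y (a, b)) t)).
  { intros J HJ. assert (HO := proj1 (stem_domain_slice Omega J (a, b) Hc HJ) Dz).
    rewrite <- (star_exp_value Omega X f J a b _ Hc HX HJ HO (cq_exp_series _ _ Hs)).
    rewrite <- (star_exp_value Omega Y g J a b _ Hc HY HJ HO (cq_exp_series _ _ Ht)).
    now apply E. }
  apply (slice_eval_inj _ _ qi imag_unit_qi); apply K; auto using imag_unit_qi, imag_unit_opp.
Qed.

Lemma cexp_square_eq_small a b : (cexp a * cexp a = cexp b * cexp b)%C -> Cmod (a - b) < 1 -> a = b.
Proof.
  intros E H. rewrite <- !cexp_add in E. destruct (cexp_eq _ _ E) as [k Hk].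
  assert (D : (a - b)%C = (Ci * RtoC (PI * IZR k))%C).
  { replace (a - b)%C with ((a + a - (b + b)) / RtoC 2)%C by field. rewrite Hk, !RtoC_mult. field. }
  rewrite D, Cmod_mult, Cmod_R, Rabs_mult, (Rabs_pos_eq PI) in H by (generalize PI_RGT_0; lra).
  rewrite Cmod_Ci in H.
  destruct (Z.eq_dec k 0) as [->|Nk].
  - apply Ceq_minus. rewrite D, Rmult_0_r. ring.
  - assert (K := IZR_abs_ge_1 k Nk). assert (P := PI2_1). nra.
Qed.

Lemma cexp_square_eq_real a b : (cexp a * cexp a = cexp b * cexp b)%C -> Im a = 0 -> Im b = 0 -> a = b.
Proof.
  intros E Ia Ib. rewrite <- !cexp_add in E. apply (f_equal Cmod) in E.
  rewrite !Cmod_cexp, !re_plus in E. apply exp_inv in E. apply C_ext; lra.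
Qed.

(** The norms of the two exponentials give equal squares of [e^x] and [e^y].  This
    determines [x] up to [i pi Z], hence exactly on the real axis, where both are real, and
    locally constantly elsewhere. *)
Lemma scalar_parts_eq Omega f g X Y : slice_domain Omega -> circular Omega ->
  regular_stem (stem_domain Omega) X -> regular_stem (stem_domain Omega) Y ->
  induces Omega X f -> induces Omega Y g ->
  (forall q, Omega q -> star_exp f q = star_exp g q) ->
  forall z, stem_domain Omega z -> c0 (X z) = c0 (Y z).
Proof.
  intros Hs Hc RX RY HX HY E.
  assert (Sq : forall z, stem_domain Omega z -> (cexp (c0 (X z)) * cexp (c0 (X z)) = cexp (c0 (Y z)) * cexp (c0 (Y z)))%C).
  { intros z Dz. destruct (Csqrt_exists (vnorm (X z))) as [s Es]. destruct (Csqrt_exists (vnorm (Y z))) as [t Et].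
    rewrite <- (cq_exp_norm _ s Es), <- (cq_exp_norm _ t Et).
    now rewrite (star_exp_eq_stems Omega f g X Y z s t). }
  assert (Hopen : open Omega) by apply Hs.
  assert (Cd : forall z, stem_domain Omega z -> continuous (fun w => c0 (X w) - c0 (Y w))%C z).
  { intros z Dz. apply continuous_Cminus; apply hol_continuous; [apply (proj1 RX z Dz)|apply (proj1 RY z Dz)]. }
  destruct (proj2 Hs) as [q [HO [x Hx]]].
  assert (D0 : stem_domain Omega (x, 0)).
  { apply (stem_domain_slice Omega qi (x, 0) Hc imag_unit_qi).
    replace (slice_point qi (Re (x, 0)) (Im (x, 0))) with q; auto. rewrite Hx. simpl. qring. }
  intros z Dz.
  apply (connected_stem_domain Omega (fun z => c0 (X z) = c0 (Y z)) Hs Hc) with (x, 0); auto.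
  - intros w Dw. split; intros Hw.
    + assert (L : locally w (fun v => Cmod (c0 (X v) - c0 (Y v)) < 1)).
      { apply (locally_lt (fun v => Cmod (c0 (X v) - c0 (Y v))) (fun _ => 1)).
        - apply continuous_Cmod. now apply Cd.
        - apply continuous_const.
        - rewrite Hw. replace (c0 (Y w) - c0 (Y w))%C with (RtoC 0) by ring. rewrite Cmod_0; lra. }
      generalize (filter_and _ _ L (stem_domain_open Omega w Hopen Dw)). apply filter_imp.
      intros v [Lv Dv]. apply cexp_square_eq_small; auto.
    + generalize (locally_neq0 _ _ (Cd w Dw) (Cminus_eq_contra _ _ Hw)). apply filter_imp.
      intros v Nv Ev. apply Nv. rewrite Ev. ring.
  (* the symmetry of a stem makes it real on the real axis *)
  - assert (Rl : forall Z : C -> cquat, regular_stem (stem_domain Omega) Z -> Im (c0 (Z (x, 0))) = 0).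
    { intros Z [_ HZ]. assert (K := HZ _ D0).
      replace (Cconj (x, 0)) with ((x, 0) : C) in K by (apply C_ext; simpl; ring).
      apply (f_equal c0) in K. apply (f_equal Im) in K. cbn [c0 cq_conj] in K. rewrite im_conj in K. lra. }
    apply cexp_square_eq_real; auto.
Qed.

(** Squared, the excluded bound reads [|d|^(2m) |G|^2 <= |d|^(2m) |n| |U|^2]. *)
Lemma no_contraction_near_isolated_zero (V U : C) (d : C) (m : nat) (G n s : C) :
  (s * s)%C = (d ^ m * d ^ m * n)%C -> V = (d ^ m * G)%C -> d <> 0%C ->
  Cmod n * Cmod U ^ 2 < Cmod G ^ 2 -> ~ Cmod V <= Cmod s * Cmod U.
Proof.
  intros Hs -> Nd Hlt Hle. apply (f_equal Cmod) in Hs. rewrite !Cmod_mult in *.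
  set (D := Cmod (d ^ m)) in *.
  assert (PD : 0 < D) by (apply Cmod_gt_0, Cpow_nz; auto).
  assert (0 <= D * Cmod G) by (apply Rmult_le_pos; [lra|apply Cmod_ge_0]).
  assert (H2 : (D * Cmod G) ^ 2 <= (Cmod s * Cmod U) ^ 2) by (apply pow_incr; auto).
  replace ((Cmod s * Cmod U) ^ 2) with (D ^ 2 * (Cmod n * Cmod U ^ 2)) in H2.
  2:{ transitivity ((Cmod s * Cmod s) * Cmod U ^ 2); [|ring]. rewrite Hs. ring. }
  replace ((D * Cmod G) ^ 2) with (D ^ 2 * Cmod G ^ 2) in H2 by ring.
  assert (0 < D ^ 2) by now apply pow_lt. nra.
Qed.

Lemma Cmod_sq_lt_1 s : Cmod (s * s) < 1 -> Cmod s < 1.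
Proof. rewrite Cmod_mult. generalize (Cmod_ge_0 s). nra. Qed.

Lemma vnorm_scale V d m G : cq_vec V = cq_scale (d ^ m) G -> vnorm V = (d ^ m * d ^ m * cnorm4 G)%C.
Proof.
  intros E. assert (E0 := f_equal c0 E). assert (E1 := f_equal c1 E).
  assert (E2 := f_equal c2 E). assert (E3 := f_equal c3 E). cbn [cq_vec cq_scale c0 c1 c2 c3] in *.
  unfold vnorm, cnorm4. rewrite E1, E2, E3.
  transitivity (d ^ m * c0 G * (d ^ m * c0 G) +
    (d ^ m * c1 G * (d ^ m * c1 G) + d ^ m * c2 G * (d ^ m * c2 G) + d ^ m * c3 G * (d ^ m * c3 G)))%C.
  - rewrite <- E0. ring.
  - ring.
Qed.

Lemma profile_im_pos p : ~ is_real p -> 0 < Im (profile p).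
Proof.
  intros N. simpl. assert (S := qnorm_sq (qvec p)).
  assert (0 <= qnorm (qvec p)) by apply sqrt_pos.
  destruct (Req_dec (qnorm (qvec p)) 0) as [Z|]; [|lra]. exfalso. apply N.
  exists (q_re p). rewrite Z in S. revert S. unfold qvec. qcoord. intros S.
  apply quat_ext; qcoord; nra.
Qed.

(** The last claim is the maximality of [m]: if [G] vanished at the point of the
    sphere, it would be [delta] times another regular stem, giving a factorisation with
    exponent [m + 1]. *)
Lemma isolated_zero_stem Omega f p V : open Omega -> circular Omega -> induces Omega V f ->
  nonreal_isolated_zero Omega f p ->
  exists m G, (forall z, stem_domain Omega z -> hol_cquat G z) /\
    (forall z, stem_domain Omega z -> V z = cq_scale (delta p z ^ m) (G z)) /\
    cnorm4 (G (profile p)) = 0%C /\ G (profile p) <> CQ 0 0 0 0.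
Proof.
  intros Ho Hc HV [Op [Np [_ [m [g [[Hg Hfg] [Hmax Hgp]]]]]]].
  destruct (slice_regular_stem _ _ Ho Hg) as [G [RG IG]].
  exists m, G. split; [apply RG|]. split; [|split].
  - intros z Dz. apply (induces_unique Omega V (fun z => cq_scale (delta p z ^ m) (G z)) f z Hc Dz HV).
    intros J a b HJ HO. rewrite Hfg by auto.
    now apply (Delta_pow_mul_induces Omega p m g G Hc IG).
  - destruct (slice_decomp p) as [J [b [HJ [Hb E]]]]. apply (slice_eval_zero_norm J); auto.
    rewrite E at 1. rewrite profile_slice by auto.
    rewrite <- (IG J (q_re p) b HJ); rewrite <- E; auto.
  - intros G0. assert (Ip := profile_im_pos p Np).
    destruct (regular_stem_divide Omega G p Ho Hc RG Op) as [Y [RY EY]]; [lra|auto|].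
    destruct (regular_stem_realised Omega Y Hc RY) as [g' [Hg' IY]].
    assert (L : (S m <= m)%nat).
    { apply (Hmax (S m) g'). split; auto. intros q HO.
      destruct (slice_decomp q) as [J [b [HJ [Hb E]]]]. rewrite E in HO |- *.
      rewrite Hfg by auto. set (a := q_re q) in *.
      assert (Dz := proj2 (stem_domain_slice Omega J (a, b) Hc HJ) HO).
      rewrite (Delta_pow_mul_induces Omega p m g G Hc IG J a b HJ HO).
      rewrite (Delta_pow_mul_induces Omega p (S m) g' Y Hc IY J a b HJ HO).
      rewrite (EY _ Dz). f_equal. unfold cq_scale. cbn [c0 c1 c2 c3]. rewrite Cpow_S. f_equal; ring. }
    lia.
Qed.

Lemma continuous_cnorm4 (G : C -> cquat) z : hol_cquat G z -> continuous (fun w => cnorm4 (G w)) z.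
Proof.
  intros [H0 [H1 [H2 H3]]]. apply hol_continuous in H0, H1, H2, H3. unfold cnorm4. cont.
Qed.

Lemma nonzero_coordinate (G : cquat) : G <> CQ 0 0 0 0 ->
  exists pr : cquat -> C, pr G <> 0%C /\
    (pr = c0 \/ pr = c1 \/ pr = c2 \/ pr = c3).
Proof.
  intros N.
  destruct (Ceq_dec (c0 G) 0) as [E0|]; [|now exists c0; auto].
  destruct (Ceq_dec (c1 G) 0) as [E1|]; [|now exists c1; auto].
  destruct (Ceq_dec (c2 G) 0) as [E2|]; [|now exists c2; auto].
  destruct (Ceq_dec (c3 G) 0) as [E3|]; [|now exists c3; auto].
  exfalso. apply N. now apply cquat_ext.
Qed.

Lemma cexp_cancel a x y : (cexp a * x = cexp a * y)%C -> x = y.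
Proof.
  intros E. assert (N := cexp_neq0 a).
  replace x with (/ cexp a * (cexp a * x))%C by (field; auto). rewrite E. field; auto.
Qed.

(** The hypothesis on [cq_exp] holds for any choice of square roots, so it can be
    used pointwise, without a continuous choice of root.  Continuity at [z0] makes [|s|]
    small and the norm of [G] small against one of its coordinates, which excludes the second
    alternative of [sinc_compare]. *)
Lemma vector_parts_eq_near (D : C -> Prop) (X Y G : C -> cquat) (d : C -> C) (m : nat) (z0 : C) :
  (forall z, D z -> locally z D) -> D z0 ->
  (forall z, D z -> hol_cquat X z) -> (forall z, D z -> hol_cquat Y z) -> (forall z, D z -> hol_cquat G z) ->
  (forall z, D z -> cq_vec (X z) = cq_scale (d z ^ m) (G z)) ->
  continuous d z0 -> locally z0 (fun z => z <> z0 -> d z <> 0%C) ->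
  cnorm4 (G z0) = 0%C -> G z0 <> CQ 0 0 0 0 ->
  (forall z s t, D z -> (s * s)%C = vnorm (X z) -> (t * t)%C = vnorm (Y z) ->
     cq_exp (X z) s = cq_exp (Y z) t) ->
  (forall z, D z -> c0 (X z) = c0 (Y z)) ->
  locally z0 (fun z => z <> z0 -> cq_vec (X z) = cq_vec (Y z)).
Proof.
  intros HD D0 HX HY HG Hfac Cd Nd N0 NG Hexp Hsc.
  destruct (nonzero_coordinate _ NG) as [pr [Npr Hpr]].
  assert (PrC : forall F : C -> cquat, (forall z, D z -> hol_cquat F z) -> continuous (fun z => pr (F z)) z0).
  { intros F HF. destruct (HF z0 D0) as [K0 [K1 [K2 K3]]].
    destruct Hpr as [->|[->|[->| ->]]];
      solve [apply continuous_const | now apply hol_continuous]. }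
  assert (PrV : continuous (fun z => pr (cq_vec (Y z))) z0).
  { destruct (HY z0 D0) as [K0 [K1 [K2 K3]]].
    destruct Hpr as [->|[->|[->| ->]]]; cbn [cq_vec c0 c1 c2 c3];
      solve [apply continuous_const | now apply hol_continuous]. }
  assert (CN := continuous_cnorm4 G z0 (HG z0 D0)).
  assert (L1 : locally z0 (fun z => Cmod (cnorm4 (G z)) * Cmod (pr (cq_vec (Y z))) ^ 2 < Cmod (pr (G z)) ^ 2)).
  { apply (locally_lt (fun z => Cmod (cnorm4 (G z)) * Cmod (pr (cq_vec (Y z))) ^ 2)
              (fun z => Cmod (pr (G z)) ^ 2)).
    - apply (continuous_Rmult (fun z => Cmod (cnorm4 (G z)))); [now apply continuous_Cmod|].
      simpl. apply continuous_Rmult; [now apply continuous_Cmod|].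
      apply continuous_Rmult; [now apply continuous_Cmod|apply continuous_const].
    - simpl. apply continuous_Rmult; [now apply continuous_Cmod, PrC|].
      apply continuous_Rmult; [now apply continuous_Cmod, PrC|apply continuous_const].
    - rewrite N0, Cmod_0, Rmult_0_l. apply pow_lt. now apply Cmod_gt_0. }
  assert (L2 : locally z0 (fun z => Cmod (d z ^ m * d z ^ m * cnorm4 (G z)) < 1)).
  { apply (locally_lt (fun z => Cmod (d z ^ m * d z ^ m * cnorm4 (G z))) (fun _ => 1)).
    - apply (continuous_Cmod (fun z => d z ^ m * d z ^ m * cnorm4 (G z))%C).
      apply continuous_Cmult; auto. apply continuous_Cmult; now apply continuous_Cpow.
    - apply continuous_const.
    - rewrite N0, Cmult_0_r, Cmod_0. lra. }
  generalize (filter_and _ _ (HD z0 D0) (filter_and _ _ Nd (filter_and _ _ L1 L2))).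
  apply filter_imp. overC. intros z [Dz [Nz [H1 H2]]] Nzz. specialize (Nz Nzz).
  destruct (Csqrt_exists (vnorm (X z))) as [s Es]. destruct (Csqrt_exists (vnorm (Y z))) as [t Et].
  assert (EE := Hexp z s t Dz Es Et).
  assert (Vn := vnorm_scale _ _ _ _ (Hfac z Dz)). rewrite <- Es in Vn.
  assert (Ss : Cmod s < 1) by (apply Cmod_sq_lt_1; now rewrite Vn).
  assert (Q0 := f_equal c0 EE). assert (Q1 := f_equal c1 EE).
  assert (Q2 := f_equal c2 EE). assert (Q3 := f_equal c3 EE).
  unfold cq_exp in Q0, Q1, Q2, Q3. cbn [c0 c1 c2 c3] in *.
  rewrite <- (Hsc z Dz) in Q0, Q1, Q2, Q3. rewrite <- !Cmult_assoc in Q1, Q2, Q3.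
  apply cexp_cancel in Q0, Q1, Q2, Q3.
  destruct (sinc_compare s t Ss Q0) as [K|K].
  - unfold cq_vec. apply cquat_ext; cbn [c0 c1 c2 c3]; auto.
  - exfalso.
    apply (no_contraction_near_isolated_zero (pr (cq_vec (X z))) (pr (cq_vec (Y z))) (d z) m (pr (G z)) _ s Vn); auto.
    + rewrite (Hfac z Dz). destruct Hpr as [->|[->|[->| ->]]]; reflexivity.
    + destruct Hpr as [->|[->|[->| ->]]]; cbn [cq_vec c0 c1 c2 c3]; auto;
        rewrite Cmod_0, Rmult_0_r; lra.
Qed.

Lemma induced_eq_at Omega X Y f q : circular Omega -> induces Omega X f ->
  Omega q -> X (profile q) = Y (profile q) -> forall g, induces Omega Y g -> f q = g q.
Proof.
  intros Hc HX HO E g HY. destruct (slice_decomp q) as [J [b [HJ [Hb Eq]]]].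
  rewrite Eq in HO, E |- *. rewrite profile_slice in E by auto.
  rewrite (HX J _ b HJ HO), (HY J _ b HJ HO). now f_equal.
Qed.

Theorem corollary1p3 (Omega : quat -> Prop) (h ht hv : quat -> quat)
  (Omega_slice_domain : slice_domain Omega)
  (Omega_circular : circular Omega)
  (h_regular : slice_regular Omega h)
  (ht_regular : slice_regular Omega ht)
  (exp_h_not_preserving : ~ slice_preserving Omega (star_exp h))
  (hv_vector_part : vector_part Omega h hv)
  (hv_zero : exists p, nonreal_isolated_zero Omega hv p) :
  (forall q, Omega q -> star_exp h q = star_exp ht q) <->
  (forall q, Omega q -> ht q = h q).
Proof.
  assert (Ho : open Omega) by apply Omega_slice_domain.
  destruct (slice_regular_stem _ _ Ho h_regular) as [X [RX IX]].
  split.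
  - intros Hexp. destruct (slice_regular_stem _ _ Ho ht_regular) as [Y [RY IY]].
    destruct hv_zero as [p Hp].
    assert (IV := vector_part_induces _ _ _ X Ho Omega_circular IX hv_vector_part).
    destruct (isolated_zero_stem Omega hv p _ Ho Omega_circular IV Hp) as [m [G [HG [Hfac [N0 NG]]]]].
    assert (Op : Omega p) by apply Hp.
    assert (Ip : 0 < Im (profile p)) by (apply profile_im_pos, Hp).
    assert (D0 := profile_domain Omega p Op). set (z0 := profile p) in *.
    assert (HD : forall z, stem_domain Omega z -> locally z (stem_domain Omega))
      by (intros; now apply stem_domain_open).
    assert (Hsc := scalar_parts_eq Omega h ht X Y Omega_slice_domain Omega_circular RX RY IX IY Hexp).
    assert (Hd : forall z, hol (delta p) z).
    { intros z. apply hol_mult; apply hol_minus; auto using hol_id, hol_const. }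
    assert (Nd : locally z0 (fun z => z <> z0 -> delta p z <> 0%C)).
    { assert (Hn : hol (fun z => (z - Cconj z0)%C) z0) by (apply hol_minus; [apply hol_id|apply hol_const]).
      assert (Nn : (z0 - Cconj z0)%C <> 0%C).
      { intros K. apply (f_equal Im) in K. unfold Cminus in K. rewrite im_plus, im_opp, im_conj in K.
        change (Im (RtoC 0)) with 0 in K. lra. }
      generalize (locally_neq0 _ _ (hol_continuous _ _ Hn) Nn). apply filter_imp. overC.
      intros z Nz N. apply Cmult_neq_0; [now apply Cminus_eq_contra|exact Nz]. }
    assert (Near := vector_parts_eq_near (stem_domain Omega) X Y G (delta p) m z0 HD D0
      (proj1 RX) (proj1 RY) HG Hfac (hol_continuous _ _ (Hd z0)) Nd N0 NG
      (fun z s t Dz => star_exp_eq_stems Omega h ht X Y z s t Omega_circular Dz IX IY Hexp) Hsc).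
    (* The equality is known off [z0] only: pass to a nearby point, which has a full
       neighbourhood avoiding [z0]. *)
    destruct (locally_other z0 _ (filter_and _ _ (HD z0 D0) (locally_locally _ _ Near)))
      as [z1 [N1 [D1 Near1]]].
    assert (Loc : locally z1 (fun z => cq_vec (X z) = cq_vec (Y z))).
    { assert (Hn : hol (fun z => (z - z0)%C) z1) by (apply hol_minus; [apply hol_id|apply hol_const]).
      generalize (filter_and _ _ Near1 (locally_neq0 _ _ (hol_continuous _ _ Hn) (Cminus_eq_contra _ _ N1))).
      apply filter_imp. overC. intros z [A B]. apply A. intros ->. apply B. ring. }
    assert (Id : forall pr : cquat -> C,
       (forall F z, hol_cquat F z -> hol (fun w => pr (F w)) z) ->
       (forall A B, cq_vec A = cq_vec B -> pr A = pr B) ->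
       forall z, stem_domain Omega z -> pr (X z) = pr (Y z)).
    { intros pr Hpr Hv z Dz. apply Ceq_minus.
      apply (identity_principle Omega (fun w => pr (X w) - pr (Y w))%C z1 Omega_slice_domain Omega_circular);
        auto.
      - intros w Dw. apply hol_minus; apply Hpr; [now apply RX|now apply RY].
      - revert Loc. apply filter_imp. overC. intros w Ew. rewrite (Hv _ _ Ew). ring. }
    intros q HO. symmetry. apply (induced_eq_at Omega X Y h q Omega_circular IX HO); auto.
    assert (Dq := profile_domain Omega q HO).
    apply cquat_ext.
    + now apply Hsc.
    + apply Id; auto; [intros F w HF; apply HF | intros A B E; exact (f_equal c1 E)].
    + apply Id; auto; [intros F w HF; apply HF | intros A B E; exact (f_equal c2 E)].
    + apply Id; auto; [intros F w HF; apply HF | intros A B E; exact (f_equal c3 E)].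
  - intros E.
    assert (IY : induces Omega X ht).
    { intros J a b HJ HO. rewrite E by auto. now apply IX. }
    intros q HO. destruct (slice_decomp q) as [J [b [HJ [Hb Eq]]]]. rewrite Eq in HO |- *.
    destruct (Csqrt_exists (vnorm (X (q_re q, b)))) as [s Es].
    rewrite (star_exp_value Omega X h J _ b _ Omega_circular IX HJ HO (cq_exp_series _ _ Es)).
    now rewrite (star_exp_value Omega X ht J _ b _ Omega_circular IY HJ HO (cq_exp_series _ _ Es)).
Qed.
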